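(* There is a $10.874$-approximation algorithm for graph scheduling (equivalently, npSMC-G on line graphs).
   Context: (Non-preemptive) graph scheduling with group completion times: given an undirected graph $G = (V,E)$, each edge $e$ is a job with processing time $p_e > 0$; each edge must be processed non-preemptively (during an interval of length $p_e$), and at any time the set of edges being processed must form a matching of $G$. $C_e$ denotes the completion time of edge $e$. A family $\mathcal{S}$ of groups of edges with weights $w_S > 0$ is given, $C_S := \max_{e \in S} C_e$, and the objective is to minimize $\sum_S w_S C_S$. (Equivalently, this is non-preemptive sum multicoloring with group completion times on the line graph of $G$.) An $\alpha$-approximation algorithm runs in polynomial time and outputs a solution of cost at most $\alpha$ times the optimum. *)

(* Defs.v *)
From mathcomp Require Import all_boot all_order all_algebra.
From mathcomp Require Import all_classical all_reals.

Set Implicit Arguments.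
Unset Strict Implicit.
Unset Printing Implicit Defensive.

Import Order.TTheory GRing.Theory Num.Theory.
Local Open Scope classical_set_scope.
Local Open Scope ring_scope.

(* Polynomial time is measured on a random access machine under the          *)
(* logarithmic cost criterion (Aho, Hopcroft and Ullman), with structured     *)
(* control flow in place of jumps.  Registers and memory cells hold unbounded *)
(* integers; registers are named statically in the program, memory cells are  *)
(* addressed through the contents of a register.                              *)

Inductive arith_op := Add | Sub | Mul | Div.

Definition arith_eval (o : arith_op) (a b : int) : int :=
  match o with
  | Add => a + b
  | Sub => a - b
  | Mul => a * b
  | Div => (a %/ b)%Z
  end.

Inductive cmd :=
  | Const of nat & int                   (* r_d := z                   *)
  | Arith of nat & arith_op & nat & nat  (* r_d := r_a op r_b          *)
  | Read of nat & nat                    (* r_d := cell[r_a]           *)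
  | Write of nat & nat                   (* cell[r_a] := r_b           *)
  | Skip
  | Seq of cmd & cmd
  | If of nat & cmd & cmd                (* if r_a > 0 then c1 else c2 *)
  | While of nat & cmd.                  (* while r_a > 0 do c         *)

Record state := State { reg : nat -> int; cell : nat -> int }.

Definition upd_reg (st : state) (d : nat) (z : int) : state :=
  State [eta reg st with d |-> z] (cell st).

Definition upd_cell (st : state) (a : nat) (z : int) : state :=
  State (reg st) [eta cell st with a |-> z].

(* The length of the binary expansion of |z|, with bitlen 0 = 1. *)
Definition bitlen (z : int) : nat := (trunc_log 2 `|z|%N).+1.

(* [exec c st t st'] : started in [st], [c] halts in [st'] at total cost [t]. *)
(* There is no rule for an access at a negative address: the run is stuck.    *)
Inductive exec : cmd -> state -> nat -> state -> Prop :=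
  | exec_const st d z :
      exec (Const d z) st (bitlen z).+1 (upd_reg st d z)
  | exec_arith st d o a b :
      exec (Arith d o a b) st (bitlen (reg st a) + bitlen (reg st b)).+1
        (upd_reg st d (arith_eval o (reg st a) (reg st b)))
  | exec_read st d a (k : nat) :
      reg st a = k%:Z ->
      exec (Read d a) st (bitlen k%:Z + bitlen (cell st k)).+1
        (upd_reg st d (cell st k))
  | exec_write st a b (k : nat) :
      reg st a = k%:Z ->
      exec (Write a b) st (bitlen k%:Z + bitlen (reg st b)).+1
        (upd_cell st k (reg st b))
  | exec_skip st : exec Skip st 1 st
  | exec_seq c1 c2 st1 st2 st3 t1 t2 :
      exec c1 st1 t1 st2 -> exec c2 st2 t2 st3 ->
      exec (Seq c1 c2) st1 (t1 + t2) st3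
  | exec_if_true a c1 c2 st st' t :
      0 < reg st a -> exec c1 st t st' ->
      exec (If a c1 c2) st ((bitlen (reg st a)).+1 + t) st'
  | exec_if_false a c1 c2 st st' t :
      reg st a <= 0 -> exec c2 st t st' ->
      exec (If a c1 c2) st ((bitlen (reg st a)).+1 + t) st'
  | exec_while_true a c st1 st2 st3 t1 t2 :
      0 < reg st1 a -> exec c st1 t1 st2 -> exec (While a c) st2 t2 st3 ->
      exec (While a c) st1 ((bitlen (reg st1 a)).+1 + t1 + t2) st3
  | exec_while_false a c st :
      reg st a <= 0 -> exec (While a c) st (bitlen (reg st a)).+1 st.

(* A sequence of integers is passed in memory cells 0, 1, ..., its length     *)
(* being held in register 0; the output is read off in the same way.          *)
Definition init_state (inp : seq int) : state :=
  State [eta (fun=> 0) with 0%N |-> (size inp)%:Z] (fun k => inp`_k).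

Definition returns (st : state) (out : seq int) : Prop :=
  reg st 0%N = (size out)%:Z /\
  forall k, (k < size out)%N -> cell st k = out`_k.

Definition runs (c : cmd) (inp : seq int) (t : nat) (out : seq int) : Prop :=
  exists2 st, exec c (init_state inp) t st & returns st out.

Definition bitsize (s : seq int) : nat := \sum_(z <- s) bitlen z.

(* An undirected edge is represented by its two endpoints in increasing       *)
(* order, so that [ends_lt] and [ends_inj] exclude loops and parallel edges.  *)
(* Numerical data are rational so that they can be given to an algorithm.     *)
Record instance := Instance {
  nvert : nat;
  nedge : nat;
  ngroup : nat;
  ends : 'I_nedge -> 'I_nvert * 'I_nvert;
  ptime : 'I_nedge -> rat;
  group : 'I_ngroup -> {set 'I_nedge};
  weight : 'I_ngroup -> rat;
  ends_lt : forall e, ((ends e).1 < (ends e).2)%N;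
  ends_inj : injective ends;
  ptime_gt0 : forall e, 0 < ptime e;
  weight_gt0 : forall g, 0 < weight g
}.

Definition incident (I : instance) (v : 'I_(nvert I)) (e : 'I_(nedge I)) :=
  (v == (ends e).1) || (v == (ends e).2).

Definition is_matching (I : instance) (M : {set 'I_(nedge I)}) : Prop :=
  forall (e f : 'I_(nedge I)) (v : 'I_(nvert I)),
    e \in M -> f \in M -> incident v e -> incident v f -> e = f.

Section Schedules.
Variables (R : realType) (I : instance).

(* A non-preemptive schedule is given by the starting times of the jobs. *)
Definition schedule := 'I_(nedge I) -> R.

Implicit Type s : schedule.

Definition edge_completion s (e : 'I_(nedge I)) : R := s e + ratr (ptime e).

Definition active s (t : R) : {set 'I_(nedge I)} :=
  [set e | s e <= t < edge_completion s e]%SET.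

Definition feasible : set schedule :=
  [set s | (forall e, 0 <= s e) /\ (forall t, is_matching (active s t))].

(* Completion times of feasible schedules are positive, so the default 0 of   *)
(* the maximum only matters for an empty group.                               *)
Definition group_completion s (g : 'I_(ngroup I)) : R :=
  \big[Num.max/0]_(e in group g) edge_completion s e.

Definition cost s : R :=
  \sum_(g < ngroup I) ratr (weight g) * group_completion s g.

Definition opt : R := inf [set cost s | s in feasible].

End Schedules.

Definition encode_rat (x : rat) : seq int := [:: numq x; denq x].

(* The vertices are listed explicitly, so that the size of an instance is at  *)
(* least its number of vertices.                                              *)
Definition encode (I : instance) : seq int :=
  [:: (nvert I)%:Z; (nedge I)%:Z; (ngroup I)%:Z]
  ++ [seq (val v)%:Z | v <- enum 'I_(nvert I)]
  ++ flatten [seq [:: (val (ends e).1)%:Z; (val (ends e).2)%:Z]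
                  ++ encode_rat (ptime e) | e <- enum 'I_(nedge I)]
  ++ flatten [seq encode_rat (weight g) ++ #|group g|%:Z
                  :: [seq (val e)%:Z | e <- enum (group g)]
             | g <- enum 'I_(ngroup I)].

(* An output lists, edge after edge, the numerator and the denominator of the *)
(* starting time; the fractions need not be in lowest terms.                  *)
Definition encodes_schedule (R : realType) (I : instance) (out : seq int)
    (s : schedule R I) : Prop :=
  size out = (2 * nedge I)%N /\
  forall e : 'I_(nedge I),
    out`_(2 * e).+1 != 0 /\ s e = (out`_(2 * e))%:~R / (out`_(2 * e).+1)%:~R.

Definition approximation_algorithm (R : realType) (alpha : R) (c : cmd) : Prop :=
  exists q : {poly nat}, forall I : instance,
    exists (t : nat) (out : seq int) (s : schedule R I),
      [/\ runs c (encode I) t out,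
          (t <= q.[bitsize (encode I)])%N,
          encodes_schedule out s,
          feasible s
        & cost s <= alpha * opt R I].

(* Main.v *)
Require Import Defs.
From mathcomp Require Import all_boot all_order all_algebra.
From mathcomp Require Import all_classical all_reals.
From mathcomp Require Import zify ring lra.

(**
  Jobs sharing a vertex are processed one after another, so a set A of such
  jobs satisfies (\sum_A p)^2 <= 2 \sum_A p C in every schedule.  These
  inequalities give a primal-dual procedure which orders the jobs without
  solving a linear program.  Take a vertex v of maximal load L for the jobs
  still present.  If some job at v belongs to no group with residual weight,
  remove it.  Otherwise let each job at v charge its processing time to such a
  group, and decrease the residual weights in proportion until one of them
  vanishes: one unit of this step removes a total weight L, which charged at
  the load L is worth L^2, at most twice its contribution \sum p C to the
  optimum.  Hence \sum_S w_S K_S <= 2 OPT, where K_S is the maximal load just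
  before the first job of S is removed.

  Now cut the removal order into blocks and schedule the blocks backwards, each
  one greedily.  A job waits only while one of its two ends is at work, so a
  block of maximal load K takes time at most 2 K.  The best cutting is found by
  dynamic programming.  It is at least as good as the average over the cuttings
  at the powers q^(j + N k), k = 0, 1, ..., of q = 1 + 1/N, for j < N, which
  costs (1 + 1/N)^(N+1) times \sum_S w_S K_S.  With N = 8192 the ratio is
  2 * 2 * (1 + 1/N)^(N+1) <= 10.874.
*)

Set Implicit Arguments.
Unset Strict Implicit.
Unset Printing Implicit Defensive.

Import Order.TTheory GRing.Theory Num.Theory.
Local Open Scope ring_scope.

(** * A language of polynomial-time programs *)

(** The claim is about a program on a machine with logarithmic cost, so the sizes of all numbers
    matter as much as the ratio. Times and weights are brought over common denominators and the
    primal-dual step is carried out on integers: instead of dividing by a rate, all residual weights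
    are multiplied by it. Each round multiplies them by at most [tot], and there are as many rounds
    as input numbers, so lengths stay polynomial. Control flow is restricted to loops over the input
    length; running time then follows from the program text, and correctness reduces to weakest
    preconditions whose side conditions bound the stored values. The shifted geometric cuttings
    occur only in the analysis. Cutting at a randomly shifted geometric grid of ratio r costs a
    factor r / ln r on average, which is least at r = e; taking q - 1 = 1/N makes r = q^N tend to e
    and keeps the computation rational. With the two factors 2 this tends to 4e = 10.8731..., so
    that 10.874 leaves room for a finite N. *)

Definition fits (c : nat) (z : int) : bool := (`|z|%N < 2 ^ c)%N.

Lemma fits_bitlen c z : (0 < c)%N -> fits c z -> (bitlen z <= c)%N.
Proof.
rewrite /fits /bitlen => c0 zc; case: (posnP `|z|%N) => [-> //|z0].
by rewrite -(@ltn_exp2l 2) //; apply: leq_ltn_trans zc; apply: trunc_logP.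
Qed.

Lemma fits_of_bitlen z : fits (bitlen z) z.
Proof. by rewrite /fits /bitlen; apply: trunc_log_ltn. Qed.

Lemma fits_le c d z : (c <= d)%N -> fits c z -> fits d z.
Proof. by move=> cd /leq_trans; apply; rewrite leq_exp2l. Qed.

Lemma expn2_ge2 c : (0 < c)%N -> (2 <= 2 ^ c)%N.
Proof. by move=> c0; rewrite -{1}(expn1 2) leq_exp2l. Qed.

Lemma leq_add_mul a b : (2 <= a -> 2 <= b -> a + b <= a * b)%N.
Proof. nia. Qed.

Lemma fitsD c d x y : (0 < c)%N -> (0 < d)%N ->
  fits c x -> fits d y -> fits (c + d) (x + y).
Proof.
rewrite /fits expnD => c0 d0 xc yd.
apply: leq_trans (leq_add_mul (expn2_ge2 c0) (expn2_ge2 d0)).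
move: (2 ^ c)%N (2 ^ d)%N xc yd => C D; lia.
Qed.

Lemma fits_opp c x : fits c (- x) = fits c x.
Proof. by rewrite /fits abszN. Qed.

Lemma fitsM c d x y : fits c x -> fits d y -> fits (c + d) (x * y).
Proof.
rewrite /fits expnD abszM => xc yd.
by apply: leq_ltn_trans (ltn_mul xc yd).
Qed.

Lemma absz_divz_le x y : (`|(x %/ y)%Z| <= `|x|)%N.
Proof.
have := divz_eq x y; case: (eqVneq y 0) => [->|y0]; first by rewrite divz0.
have := modz_ge0 x y0; have := ltz_mod x y0.
move: (x %/ y)%Z (x %% y)%Z => q r; nia.
Qed.

(** For a sum, 2^c + 2^d is at most 2^(c+d) because both powers are at least 2. Hence the positive
    widths, and one bound serves all four operations. *)
Lemma fits_arith o c d x y : (0 < c)%N -> (0 < d)%N ->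
  fits c x -> fits d y -> fits (c + d) (arith_eval o x y).
Proof.
move=> c0 d0 xc yd; case: o => /=.
- exact: fitsD.
- by apply: fitsD => //; rewrite fits_opp.
- exact: fitsM.
- apply: (@fits_le c); first exact: leq_addr.
  exact: leq_ltn_trans (absz_divz_le x y) xc.
Qed.

(** An upper bound rather than the exact cost: the branches of a conditional can share one bound,
    and bounds need not follow the data processed. *)
Definition within (c : cmd) (st : state) (T : nat) (st' : state) :=
  exists2 t, exec c st t st' & (t <= T)%N.

Lemma within_seq c1 c2 st1 st2 st3 t1 t2 :
  within c1 st1 t1 st2 -> within c2 st2 t2 st3 ->
  within (Seq c1 c2) st1 (t1 + t2) st3.
Proof.
move=> [u1 e1 l1] [u2 e2 l2]; exists (u1 + u2)%N; last exact: leq_add.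
exact: exec_seq e1 e2.
Qed.

Lemma within_le c st t1 t2 st' :
  (t1 <= t2)%N -> within c st t1 st' -> within c st t2 st'.
Proof. by move=> l [u e lu]; exists u => //; apply: leq_trans l. Qed.

Lemma within_const st d z : within (Const d z) st (bitlen z).+1 (upd_reg st d z).
Proof. by eexists; first exact: exec_const. Qed.

Lemma within_arith c st d o a b : (0 < c)%N -> fits c (reg st a) ->
  fits c (reg st b) ->
  within (Arith d o a b) st (c + c).+1
    (upd_reg st d (arith_eval o (reg st a) (reg st b))).
Proof.
move=> c0 fa fb; eexists; first exact: exec_arith.
by rewrite ltnS leq_add // fits_bitlen.
Qed.

Lemma within_read c st d a (k : nat) : (0 < c)%N -> reg st a = k%:Z ->
  fits c k%:Z -> fits c (cell st k) ->
  within (Read d a) st (c + c).+1 (upd_reg st d (cell st k)).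
Proof.
move=> c0 ak fa fb; eexists; first exact: (exec_read _ ak).
by rewrite ltnS leq_add // fits_bitlen.
Qed.

Lemma within_write c st a b (k : nat) : (0 < c)%N -> reg st a = k%:Z ->
  fits c k%:Z -> fits c (reg st b) ->
  within (Write a b) st (c + c).+1 (upd_cell st k (reg st b)).
Proof.
move=> c0 ak fa fb; eexists; first exact: (exec_write _ ak).
by rewrite ltnS leq_add // fits_bitlen.
Qed.

Lemma within_if c st a c1 c2 T st' : (0 < c)%N -> fits c (reg st a) ->
  within (if 0 < reg st a then c1 else c2) st T st' ->
  within (If a c1 c2) st (c.+1 + T) st'.
Proof.
move=> c0 fa; have lc := fits_bitlen c0 fa.
case: ifP => [a0|a0] [t e le].
- eexists; first exact: (exec_if_true _ a0 e).
  by rewrite leq_add.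
- have {}a0 : reg st a <= 0 by rewrite leNgt a0.
  eexists; first exact: (exec_if_false _ a0 e).
  by rewrite leq_add.
Qed.

(** Induction on the number of rounds left. The invariant [P i] pins the counter register to
    [n - i], so the test succeeds exactly [n] times. *)
Lemma within_while c n (P : nat -> state -> Prop) r body T st :
  (0 < c)%N -> fits c n%:Z ->
  (forall i st, (i <= n)%N -> P i st -> reg st r = (n - i)%N%:Z) ->
  (forall i st, (i < n)%N -> P i st ->
     exists2 st', within body st T st' & P i.+1 st') ->
  P 0%N st ->
  exists2 st', within (While r body) st (n * (c.+1 + T) + c.+1) st' & P n st'.
Proof.
move=> c0 fc Pr Pb P0.
suff H i st1 : (i <= n)%N -> P (n - i)%N st1 ->
    exists2 st', within (While r body) st1 (i * (c.+1 + T) + c.+1) st' & P n st'.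
  by apply: H; rewrite // subnn.
elim: i st1 => [|i IH] st1 lin Pi.
- rewrite subn0 in Pi; exists st1 => //.
  have r0 := Pr n st1 (leqnn _) Pi; rewrite subnn in r0.
  eexists; first by apply: exec_while_false; rewrite r0.
  by rewrite r0 mul0n add0n ltnS.
- have ltn : (n - i.+1 < n)%N by lia.
  have rr : reg st1 r = i.+1%:Z by rewrite (Pr _ _ (ltnW ltn) Pi); congr Posz; lia.
  have [st2 [t2 e2 l2] P2] := Pb _ _ ltn Pi.
  have [|st3 [t3 e3 l3] P3] := IH st2 (ltnW lin); first by rewrite -subSn in P2.
  exists st3 => //; eexists.
    by apply: exec_while_true e2 e3; rewrite rr.
  have lb : (bitlen (reg st1 r) <= c)%N.
    by apply: fits_bitlen => //; rewrite rr; apply: leq_ltn_trans fc; lia.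
  by rewrite mulSn -[X in (_ <= X)%N]addnA leq_add // leq_add.
Qed.

(* Programs are written in a language whose only loop runs a variable through *)
(* 0, ..., N - 1, where N is the length of the input, so that every program   *)
(* takes a polynomial number of steps. [Pos e] is 1 if e > 0 and 0 otherwise, *)
(* [Arr a e] is the cell of the array [a] with index |e|, and [Sum x e] is    *)
(* the sum of [e] over x < N.                                                 *)
Inductive aexp :=
  | Lit of int
  | Var of nat
  | Op of arith_op & aexp & aexp
  | Pos of aexp
  | Arr of nat & aexp
  | Sum of nat & aexp.

Inductive stm :=
  | Assign of nat & aexp
  | Store of nat & aexp & aexp
  | Then of stm & stm
  | Cond of aexp & stm & stm
  | For of nat & stm.

Record store := Mem { var : nat -> int; arr : nat -> nat -> int }.

Definition setv (x : nat) (v : int) (s : store) : store :=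
  Mem [eta var s with x |-> v] (arr s).

Definition seta (a j : nat) (v : int) (s : store) : store :=
  Mem (var s)
    (fun a' => if a' == a then fun j' => if j' == j then v else arr s a j'
               else arr s a').

Lemma arr_seta a j v s a' j' : arr (seta a j v s) a' j' =
  if (a' == a) && (j' == j) then v else arr s a' j'.
Proof. by rewrite /=; case: eqP => // ->. Qed.

(* Register 1 holds N, register 2x the variable [x], and the registers [scr   *)
(* k], for k = 0, 1, ..., form the evaluation stack.                          *)
Definition scr (k : nat) : nat := k.*2.+3.

Definition copy (d a : nat) : cmd := Seq (Const d 0) (Arith d Add d a).

(* The array 0 is the input and output zone, cells 0, ..., N - 1, and is not  *)
(* extensible. The other arrays are interleaved above it: (2j + 1) 2^a        *)
(* determines (a, j).                                                         *)
Definition addr (n a j : nat) : nat := (n + j.*2.+1 * 2 ^ a)%N.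

Definition abs_code (k : nat) : cmd :=
  Seq (Const (scr k.+1) 0)
  (Seq (Arith (scr k.+1) Defs.Sub (scr k.+1) (scr k))
       (If (scr k.+1) (copy (scr k) (scr k.+1)) Skip)).

Definition addr_code (a k : nat) : cmd :=
  Seq (Arith (scr k) Add (scr k) (scr k))
  (Seq (Const (scr k.+1) 1)
  (Seq (Arith (scr k) Add (scr k) (scr k.+1))
  (Seq (Const (scr k.+1) (2 ^ a)%N)
  (Seq (Arith (scr k) Mul (scr k) (scr k.+1))
       (Arith (scr k) Add (scr k) 1))))).

Definition load_code (a k : nat) : cmd :=
  if a is 0 then
    Seq (Arith (scr k.+1) Defs.Sub 1 (scr k))
        (If (scr k.+1) (Read (scr k) (scr k)) (Const (scr k) 0))
  else Seq (addr_code a k) (Read (scr k) (scr k)).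

Definition save_code (a k : nat) : cmd :=
  if a is 0 then
    Seq (Arith (scr k.+2) Defs.Sub 1 (scr k.+1))
        (If (scr k.+2) (Write (scr k.+1) (scr k)) Skip)
  else Seq (addr_code a k.+1) (Write (scr k.+1) (scr k)).

Definition loop_code (i c : nat) (x : nat) (body : cmd) : cmd :=
  Seq (Const (scr i) 0)
  (Seq (copy (scr c) 1)
       (While (scr c)
          (Seq (copy x.*2 (scr i))
          (Seq body
          (Seq (Const (scr c.+1) 1)
          (Seq (Arith (scr i) Add (scr i) (scr c.+1))
               (Arith (scr c) Defs.Sub (scr c) (scr c.+1)))))))).

Fixpoint cexp (k : nat) (e : aexp) : cmd :=
  match e with
  | Lit z => Const (scr k) z
  | Var x => copy (scr k) x.*2
  | Op o e1 e2 =>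
      Seq (cexp k e1)
      (Seq (cexp k.+1 e2) (Arith (scr k) o (scr k) (scr k.+1)))
  | Pos e1 =>
      Seq (cexp k e1) (If (scr k) (Const (scr k) 1) (Const (scr k) 0))
  | Arr a e1 => Seq (cexp k e1) (Seq (abs_code k) (load_code a k))
  | Sum x e1 =>
      Seq (Const (scr k) 0)
      (Seq (copy (scr k.+1) x.*2)
      (Seq (loop_code k.+2 k.+3 x
              (Seq (cexp k.+4 e1) (Arith (scr k) Add (scr k) (scr k.+4))))
           (copy x.*2 (scr k.+1))))
  end.

Fixpoint cstm (k : nat) (s : stm) : cmd :=
  match s with
  | Assign x e => Seq (cexp k e) (copy x.*2 (scr k))
  | Store a e1 e2 =>
      Seq (cexp k e2)
      (Seq (cexp k.+1 e1) (Seq (abs_code k.+1) (save_code a k)))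
  | Then s1 s2 => Seq (cstm k s1) (cstm k s2)
  | Cond e s1 s2 => Seq (cexp k e) (If (scr k) (cstm k s1) (cstm k s2))
  | For x s1 => loop_code k.+2 k.+3 x (cstm k.+4 s1)
  end.

(** * Semantics of the language and soundness of the compiled code *)

Section Correctness.

Variables (N b : nat).
Hypotheses (b_gt0 : (0 < b)%N) (N_fits : fits b N).

Fixpoint eval (e : aexp) (s : store) : int :=
  match e with
  | Lit z => z
  | Var x => var s x
  | Op o e1 e2 => arith_eval o (eval e1 s) (eval e2 s)
  | Pos e1 => ((0 < eval e1 s)%R : nat)
  | Arr a e1 => arr s a `|eval e1 s|%N
  | Sum x e1 => \sum_(i < N) eval e1 (setv x i s)
  end.

(** The factor of [b] in the length of the value of [e] when all stored numbers have [b] bits. A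
    [Sum] adds one because it has fewer than 2^b terms. *)
Fixpoint width (e : aexp) : nat :=
  match e with
  | Lit z => bitlen z
  | Var x => 1
  | Op o e1 e2 => width e1 + width e2
  | Pos e1 => width e1
  | Arr a e1 => width e1 + a + 3
  | Sum x e1 => (width e1).+1
  end.

Lemma width_gt0 e : (0 < width e)%N.
Proof. by elim: e => //= *; lia. Qed.

Definition small (s : store) : Prop :=
  (forall x, fits b (var s x)) /\ (forall a j, fits b (arr s a j)).

Lemma small_setv s x v : small s -> fits b v -> small (setv x v s).
Proof. by move=> [sv sa] fv; split=> //= y; case: ifP. Qed.

Lemma small_seta s a j v : small s -> fits b v -> small (seta a j v s).
Proof.
move=> [sv sa] fv; split=> //= a' j'.
by case: ifP => // _ /=; case: ifP.
Qed.

Lemma fits_ord (i : nat) : (i <= N)%N -> fits b i.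
Proof. by move=> iN; apply: leq_ltn_trans N_fits. Qed.

Lemma fits_sum c n (F : nat -> int) : (n <= N)%N ->
  (forall i, (i < n)%N -> fits c (F i)) -> fits (c + b) (\sum_(i < n) F i).
Proof.
move=> nN FF; apply: (@leq_ltn_trans (\sum_(i < n) `|F i|)%N).
  elim: n {nN FF} => [|n IH]; first by rewrite !big_ord0.
  rewrite !big_ord_recr /=; apply: leq_trans (leq_add IH (leqnn _)).
  by move: (\sum_(i < n) F i) (F n) => x y; lia.
apply: (@leq_ltn_trans (\sum_(i < n) 2 ^ c)%N).
  by apply: leq_sum => i _; apply: ltnW; apply: FF.
rewrite sum_nat_const card_ord expnD mulnC ltn_pmul2l ?expn_gt0 //.
exact: leq_ltn_trans nN N_fits.
Qed.

Lemma fits_eval e s : small s -> fits (width e * b) (eval e s).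
Proof.
elim: e s => [z|x|o e1 IH1 e2 IH2|e IH|a e IH|x e IH] s sm /=.
- apply: (@fits_le (bitlen z)); last exact: fits_of_bitlen.
  by rewrite leq_pmulr.
- by rewrite mul1n; case: sm.
- by rewrite mulnDl; apply: fits_arith; rewrite ?muln_gt0 ?width_gt0 //; auto.
- have : (2 <= 2 ^ (width e * b))%N by rewrite expn2_ge2 ?muln_gt0 ?width_gt0.
  by rewrite /fits; apply: leq_trans; case: ltrP.
- by apply: (@fits_le b); rewrite ?leq_pmull ?addnS //; case: sm.
- rewrite mulSn addnC.
  apply: (fits_sum (F := fun i => eval e (setv x i s))) => // i iN.
  by apply: IH; apply: small_setv => //; apply: fits_ord; apply: ltnW.
Qed.

(** Writes to array 0 beyond the zone are dropped, as the guard in [save_code] does; otherwise they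
    would hit the interleaved arrays. *)
Definition storeto (a j : nat) (v : int) (s : store) : store :=
  if (a == 0%N) && (N <= j)%N then s else seta a j v s.

Fixpoint wploop (f : (store -> Prop) -> store -> Prop) (x : nat)
    (Q : store -> Prop) (n i : nat) (s : store) : Prop :=
  if n is n'.+1 then f (wploop f x Q n' i.+1) (setv x i s) else Q s.

(** Only values that are stored must fit in [b] bits; intermediate values are controlled by [width].
    Through these side conditions the size analysis of the algorithm enters. *)
Fixpoint wp (t : stm) (Q : store -> Prop) (s : store) : Prop :=
  match t with
  | Assign x e => fits b (eval e s) /\ Q (setv x (eval e s) s)
  | Store a e1 e2 =>
      fits b (eval e2 s) /\ Q (storeto a `|eval e1 s|%N (eval e2 s) s)
  | Then t1 t2 => wp t1 (wp t2 Q) s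
  | Cond e t1 t2 => if 0 < eval e s then wp t1 Q s else wp t2 Q s
  | For x t1 => wploop (wp t1) x Q N 0 s
  end.

(** [sim_zero] fixes the value 0 for array 0 beyond the zone, where the cells belong to other
    arrays; [load_code] tests the index accordingly. *)
Record sim (s : store) (st : state) : Prop := Sim {
  sim_var : forall x, reg st x.*2 = var s x;
  sim_base : reg st 1 = N;
  sim_low : forall j, (j < N)%N -> cell st j = arr s 0 j;
  sim_zero : forall j, (N <= j)%N -> arr s 0 j = 0;
  sim_arr : forall a j, (0 < a)%N -> cell st (addr N a j) = arr s a j }.

Lemma sim_scr s st k z : sim s st -> sim s (upd_reg st (scr k) z).
Proof.
by case=> hv hb hl hz ha; split=> [x||||] //=; case: eqP => //; rewrite /scr; lia.
Qed.

Lemma sim_setv s st x v : sim s st -> sim (setv x v s) (upd_reg st x.*2 v).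
Proof.
case=> hv hb hl hz ha; split=> [y||||] //=.
- by rewrite hv (inj_eq (can_inj doubleK)).
- by case: eqP => //; lia.
Qed.

Lemma reg_scr st k z : reg (upd_reg st (scr k) z) (scr k) = z.
Proof. by rewrite /= eqxx. Qed.

Lemma reg_scr_neq st j k z : j != k ->
  reg (upd_reg st (scr k) z) (scr j) = reg st (scr j).
Proof. by move=> jk; rewrite /= /scr; case: ifP => // /eqP; lia. Qed.

Lemma reg_scr_var st x k z : reg (upd_reg st x.*2 z) (scr k) = reg st (scr k).
Proof. by rewrite /= /scr; case: ifP => // /eqP; lia. Qed.

Lemma upd_reg_twice st d y z : upd_reg (upd_reg st d y) d z = upd_reg st d z.
Proof. by congr State; apply/funext => r /=; case: (r == d). Qed.

Lemma within_copy c st d a : (0 < c)%N -> d != a -> fits c (reg st a) ->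
  within (copy d a) st (c + c).+4 (upd_reg st d (reg st a)).
Proof.
move=> c0 da fa.
have -> : upd_reg st d (reg st a) =
  upd_reg (upd_reg st d 0) d (reg (upd_reg st d 0) d + reg (upd_reg st d 0) a).
  by rewrite upd_reg_twice /= eqxx (eq_sym a) (negbTE da) add0r.
apply: (@within_le _ _ (2 + (c + c).+1)); first by rewrite !addSn.
apply: within_seq; first exact: (within_const st d 0).
apply: (within_arith _ Add c0) => /=; rewrite ?eqxx ?expn_gt0 //.
  by rewrite /fits /= expn_gt0.
by case: ifP => // _; rewrite /fits /= expn_gt0.
Qed.

Definition keeps (k : nat) (st st' : state) : Prop :=
  forall j, (j < k)%N -> reg st' (scr j) = reg st (scr j).

Lemma keeps_trans k l st1 st2 st3 : (k <= l)%N ->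
  keeps k st1 st2 -> keeps l st2 st3 -> keeps k st1 st3.
Proof. by move=> kl k1 k2 j jk; rewrite k2 ?k1 //; apply: leq_trans kl. Qed.

Lemma keeps_scr k l st z : (k <= l)%N -> keeps k st (upd_reg st (scr l) z).
Proof. by move=> kl j jk; rewrite reg_scr_neq //; lia. Qed.

(* [c] turns the abstract store [s] into [s'] without touching the registers  *)
(* below [scr k].                                                             *)
Definition steps (k : nat) (c : cmd) (T : nat) (s : store) (st : state)
    (s' : store) (R : state -> Prop) : Prop :=
  exists st', [/\ within c st T st', sim s' st', keeps k st st' & R st'].

Lemma steps_seq k l c1 c2 T1 T2 s1 s2 s3 st (R1 R2 : state -> Prop) :
  (k <= l)%N ->
  steps k c1 T1 s1 st s2 R1 ->
  (forall st2, sim s2 st2 -> keeps k st st2 -> R1 st2 ->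
     steps l c2 T2 s2 st2 s3 R2) ->
  steps k (Seq c1 c2) (T1 + T2) s1 st s3 R2.
Proof.
move=> kl [st2 [w1 sm1 k1 r1]] /(_ _ sm1 k1 r1) [st3 [w2 sm2 k2 r2]].
exists st3; split=> //; first exact: within_seq w1 w2.
exact: keeps_trans kl k1 k2.
Qed.

Lemma steps_le k c T1 T2 s1 st s2 (R1 R2 : state -> Prop) : (T1 <= T2)%N ->
  (forall st', R1 st' -> R2 st') ->
  steps k c T1 s1 st s2 R1 -> steps k c T2 s1 st s2 R2.
Proof.
move=> lT R12 [st' [w sm ks r]]; exists st'; split=> //; last exact: R12.
exact: within_le w.
Qed.

Lemma steps_scr k c T s st z (R : state -> Prop) l : (k <= l)%N -> sim s st ->
  within c st T (upd_reg st (scr l) z) -> R (upd_reg st (scr l) z) ->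
  steps k c T s st s R.
Proof.
move=> kl sm w r; exists (upd_reg st (scr l) z); split=> //.
- exact: sim_scr.
- exact: keeps_scr.
Qed.

Lemma fits0 c : fits c 0.
Proof. by rewrite /fits expn_gt0. Qed.

Lemma steps_abs k c s st (v : int) : (0 < c)%N -> sim s st ->
  reg st (scr k) = v -> fits c v ->
  steps k (abs_code k) (7 * c + 20) s st s
    (fun st' => reg st' (scr k) = `|v|%N).
Proof.
move=> c0 sm vk fv.
apply: (@steps_le _ _ (2 + (c + c).+1 + (c.+1 + (c + c).+4)) _ _ _ _
   (fun st' => reg st' (scr k) = `|v|%N)) => //; first lia.
rewrite -addnA; apply: steps_seq (leqnn k) _ _.
  apply: (@steps_scr k _ _ _ _ 0 (fun st' => reg st' (scr k.+1) = 0 /\ reg st' (scr k) = v) k.+1) => //.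
  - exact: within_const.
  - by rewrite reg_scr reg_scr_neq //; lia.
move=> st1 sm1 _ [r1 r2]; apply: steps_seq (leqnn k) _ _.
  apply: (@steps_scr k _ _ _ _ (0 - v) (fun st' => reg st' (scr k.+1) = - v /\ reg st' (scr k) = v) k.+1) => //.
  - rewrite -[in X in within _ _ _ X]r1 -r2.
    by apply: (within_arith _ Defs.Sub c0); rewrite ?r1 ?r2 ?fits0.
  - by rewrite reg_scr reg_scr_neq ?sub0r //; lia.
move=> st2 sm2 _ [r3 r4].
case: (ltrP 0 (- v)) => v0.
- apply: (@steps_scr k _ _ _ _ (- v) _ k) => //; last by rewrite reg_scr; lia.
  apply: within_if => //; rewrite r3 ?fits_opp // v0 -r3.
  apply: within_copy => //; last by rewrite r3 fits_opp.
  by rewrite /scr; lia.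
- exists st2; split=> //; last by rewrite r4; lia.
  apply: within_if => //; rewrite r3 ?fits_opp // ltNge v0 /=.
  by exists 1%N => //; apply: exec_skip.
Qed.

Lemma steps_arith k l c s st o i j x y : (k <= l)%N -> (0 < c)%N -> sim s st ->
  reg st i = x -> reg st j = y -> fits c x -> fits c y ->
  steps k (Arith (scr l) o i j) (c + c).+1 s st s
    (fun st' => st' = upd_reg st (scr l) (arith_eval o x y)).
Proof.
move=> kl c0 sm ix jy fx fy; subst x y.
by apply: (steps_scr kl sm) => //; apply: within_arith.
Qed.

Lemma steps_const k l s st z T : (k <= l)%N -> sim s st -> (bitlen z < T)%N ->
  steps k (Const (scr l) z) T s st s (fun st' => st' = upd_reg st (scr l) z).
Proof.
move=> kl sm zT; apply: (steps_scr kl sm) => //.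
exact: within_le (within_const _ _ _).
Qed.

Lemma fits_nat c (n : nat) : fits c n = (n < 2 ^ c)%N.
Proof. by []. Qed.

Lemma steps_addr a k c s st (j : nat) : (b <= c)%N -> sim s st ->
  reg st (scr k) = j -> fits c j ->
  steps k (addr_code a k) (12 * (c + a + 3) + 12) s st s
    (fun st' => reg st' (scr k) = addr N a j).
Proof.
move=> bc sm jk fj; set w := (c + a + 3)%N.
have w0 : (0 < w)%N by rewrite /w; lia.
have f1 : fits (c + 2) j.*2.+1.
  by move: fj; rewrite !fits_nat expnD /=; move: (2 ^ c)%N => x; lia.
have fa : fits a.+1 (2 ^ a)%N by rewrite fits_nat ltn_exp2l.
have fw c' z : (c' <= w)%N -> fits c' z -> fits w z by exact: fits_le.
apply: (@steps_le _ _ ((w + w).+1 + (w.+1 + ((w + w).+1 + (w.+1 +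
  ((w + w).+1 + (w + w).+1))))) _ _ _ _
   (fun st' => reg st' (scr k) = addr N a j)) => //; first lia.
apply: steps_seq (leqnn k) _ _.
  by apply: (steps_arith Defs.Add (leqnn k) w0 sm jk jk);
     apply: fw fj; rewrite /w; lia.
move=> st1 sm1 _ e1; apply: steps_seq (leqnn k) _ _.
  exact: (steps_const (leqnSn k) sm1).
move=> st2 sm2 _ e2; apply: steps_seq (leqnn k) _ _.
  apply: (@steps_arith _ _ _ _ _ Defs.Add _ _ (j + j)%N 1) => //.
  - by rewrite e2 reg_scr_neq ?e1 ?reg_scr //; lia.
  - by rewrite e2 reg_scr.
  - apply: (fw (c + 2)%N); first by rewrite /w; lia.
    by apply: leq_ltn_trans f1; rewrite /=; lia.
  - by rewrite fits_nat -{1}(expn0 2) ltn_exp2l.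
move=> st3 sm3 _ e3; apply: steps_seq (leqnn k) _ _.
  apply: (steps_const (z := (2 ^ a)%N) (leqnSn k) sm3).
  by rewrite ltnS (leq_trans (fits_bitlen _ fa)) // /w; lia.
move=> st4 sm4 _ e4; apply: steps_seq (leqnn k) _ _.
  apply: (@steps_arith _ _ _ _ _ Defs.Mul _ _ j.*2.+1 (2 ^ a)%N) => //.
  - rewrite e4 reg_scr_neq ?e3 ?reg_scr //=; last lia.
    by lia.
  - by rewrite e4 reg_scr.
  - by apply: fw f1; rewrite /w; lia.
  - by apply: fw fa; rewrite /w; lia.
move=> st5 sm5 _ e5.
have := @steps_arith k k w s st5 Defs.Add (scr k) 1 (j.*2.+1 * 2 ^ a)%N N.
case.
- by [].
- by [].
- by [].
- by rewrite e5 reg_scr.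
- by case: sm5.
- have -> : w = (c + 2 + a.+1)%N by rewrite /w; lia.
  exact: (fitsM (x := j.*2.+1) (y := (2 ^ a)%N)).
- by apply: fw N_fits; rewrite /w; lia.
move=> st6 [w6 sm6 k6 e6]; exists st6; split=> //.
by rewrite e6 reg_scr /= /addr; congr Posz; lia.
Qed.

Lemma fits_addr a c (j : nat) : (b <= c)%N -> fits c j ->
  fits (c + a + 3) (addr N a j).
Proof.
move=> bc; have := fits_le bc N_fits; rewrite !fits_nat /addr !expnD.
have : (0 < 2 ^ a)%N by rewrite expn_gt0.
by move: (2 ^ c)%N (2 ^ a)%N => x y; nia.
Qed.

(** After cancelling the smaller power of 2, one side is odd, so the other side keeps no factor
    2. *)
Lemma addr_inj a a' j j' : addr N a j = addr N a' j' -> a = a' /\ j = j'.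
Proof.
move/addnI => /= e; suff aa : a = a'.
  split=> //; move: e; rewrite aa => /eqP.
  by rewrite eqn_pmul2r ?expn_gt0 // => /eqP; lia.
wlog : a a' j j' e / (a <= a')%N => [H|aa'].
  by case: (leqP a a') => [/(H _ _ _ _ e)|/ltnW /(H _ _ _ _ (esym e)) ->].
move: e; rewrite -(subnKC aa') expnD mulnCA mulnC => /eqP.
rewrite eqn_pmul2l ?expn_gt0 // => /eqP e.
case: (posnP (a' - a)%N) => [->|a0]; first by rewrite addn0.
have := congr1 odd e; rewrite /= odd_double oddM oddX /=.
by rewrite (gtn_eqF a0) andbF.
Qed.

Lemma steps_load a k c s st (j : nat) : (b <= c)%N -> sim s st -> small s ->
  reg st (scr k) = j -> fits c j ->
  steps k (load_code a k) (20 * (c + a + 3) + 20) s st s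
    (fun st' => reg st' (scr k) = arr s a j).
Proof.
move=> bc sm [_ sma] jk fj; have c0 : (0 < c)%N by apply: leq_trans bc.
case: a => [|a] /=; last first.
  apply: (@steps_le _ _ (12 * (c + a.+1 + 3) + 12 +
     ((c + a.+1 + 3) + (c + a.+1 + 3)).+1) _ _ _ _
     (fun st' => reg st' (scr k) = arr s a.+1 j)) => //; first lia.
  apply: steps_seq (leqnn k) _ _; first exact: steps_addr bc sm jk fj.
  move=> st1 sm1 _ r1.
  apply: (@steps_scr k _ _ _ _ (arr s a.+1 j) _ k) => //.
    rewrite -(sim_arr sm1) //; apply: (@within_read (c + a.+1 + 3) _ _ _ (addr N a.+1 j)) => //.
    - by rewrite addnS.
    - exact: fits_addr.
    - by rewrite (sim_arr sm1) //; apply: fits_le (sma _ _); lia.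
  by rewrite reg_scr.
apply: (@steps_le _ _ ((c + c).+1 + ((c.+1).+1 + (c + c).+1)) _ _ _ _
     (fun st' => reg st' (scr k) = arr s 0 j)) => //; first lia.
have fN := fits_le bc N_fits.
apply: steps_seq (leqnn k) _ _.
  by apply: (steps_arith Defs.Sub (leqnSn k) c0 sm _ jk fN fj); case: sm.
move=> st1 sm1 _ e1.
have r1 : reg st1 (scr k.+1) = N%:Z - j%:Z by rewrite e1 reg_scr.
have r0 : reg st1 (scr k) = j by rewrite e1 reg_scr_neq //; lia.
have f1 : fits c.+1 (reg st1 (scr k.+1)).
  by rewrite r1; move: fN fj; rewrite /fits expnS; move: (2 ^ c)%N => x; lia.
case: (ltnP j N) => jN.
- apply: (@steps_scr k _ _ _ _ (arr s 0 j) _ k) => //; last by rewrite reg_scr.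
  apply: within_if => //; rewrite r1 subr_gt0 ltz_nat jN -(sim_low sm1) //.
  by apply: within_read => //; rewrite (sim_low sm1) //; apply: fits_le (sma _ _).
- apply: (@steps_scr k _ _ _ _ 0 _ k) => //; last first.
    by rewrite reg_scr (sim_zero sm1).
  apply: within_if => //; rewrite r1 subr_gt0 ltz_nat ltnNge jN /=.
  apply: within_le (within_const _ _ _).
  by rewrite ltnS (leq_trans (fits_bitlen c0 (fits0 c))) // leq_addr.
Qed.

Lemma sim_cell s st a j v : (if a == 0%N then (j < N)%N else true) ->
  sim s st ->
  sim (seta a j v s) (upd_cell st (if a == 0%N then j else addr N a j) v).
Proof.
move=> aj [hv hb hl hz ha]; split=> // [i iN|i Ni|a' i a'0]; rewrite arr_seta.
- rewrite /=; case: (eqVneq a 0%N) aj => [a0 jN|a0 _].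
    by case: ifP => // _; rewrite hl.
  rewrite hl //; case: eqP => // e.
  have /(leq_trans iN) : (N <= addr N a j)%N by exact: leq_addr.
  by rewrite e ltnn.
- case: (eqVneq a 0%N) aj => [a0 jN|a0 _].
    by case: eqP => [e|_]; [lia | rewrite hz].
  by rewrite hz.
- rewrite /=; case: (eqVneq a 0%N) aj => [a0 jN|a0 _].
    rewrite a0 (gtn_eqF a'0) -ha //; case: eqP => // e.
    have := leq_addr (i.*2.+1 * 2 ^ a') N; rewrite -/(addr N a' i) e; lia.
  case: (eqVneq a' a) => [->|na]; last first.
    by rewrite ha //; case: eqP => // /addr_inj [e]; rewrite e eqxx in na.
  rewrite ha; last by rewrite lt0n.
  case: (eqVneq i j) => [->|ij]; first by rewrite eqxx.
  by case: eqP => // /addr_inj [_ e]; rewrite e eqxx in ij.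
Qed.

Lemma steps_save a k c s st (j : nat) v : (b <= c)%N -> sim s st ->
  fits c v -> reg st (scr k) = v -> reg st (scr k.+1) = j -> fits c j ->
  steps k (save_code a k) (20 * (c + a + 3) + 20) s st (storeto a j v s)
    (fun=> True).
Proof.
move=> bc sm fv vk jk fj; have c0 : (0 < c)%N by apply: leq_trans bc.
case: a => [|a] /=; last first.
  apply: (@steps_le _ _ (12 * (c + a.+1 + 3) + 12 +
     ((c + a.+1 + 3) + (c + a.+1 + 3)).+1) _ _ _ _ (fun=> True)) => //; first lia.
  have [st1 [w1 sm1 k1 r1]] := steps_addr a.+1 bc sm jk fj.
  have r2 : reg st1 (scr k) = v by rewrite k1.
  exists (upd_cell st1 (addr N a.+1 j) (reg st1 (scr k))); split=> //.
  - apply: within_seq; first exact: w1.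
    apply: within_write => //; first by rewrite addnS.
      exact: fits_addr.
    by rewrite r2; apply: fits_le fv; lia.
  - by rewrite r2; apply: (@sim_cell s st1 a.+1 j).
  - by move=> i ik /=; rewrite k1 //; apply: leq_trans ik _.
apply: (@steps_le _ _ ((c + c).+1 + ((c.+1).+1 + (c + c).+1)) _ _ _ _
     (fun=> True)) => //; first lia.
have fN := fits_le bc N_fits.
apply: steps_seq (leqnn k) _ _.
  have kk2 : (k <= k.+2)%N by lia.
  by apply: (steps_arith Defs.Sub kk2 c0 sm _ jk fN fj); case: sm.
move=> st1 sm1 _ e1.
have r1 : reg st1 (scr k.+2) = N%:Z - j%:Z by rewrite e1 reg_scr.
have r0 : reg st1 (scr k.+1) = j by rewrite e1 reg_scr_neq //; lia.
have r2 : reg st1 (scr k) = v by rewrite e1 reg_scr_neq //; lia.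
have f1 : fits c.+1 (reg st1 (scr k.+2)).
  by rewrite r1; move: fN fj; rewrite /fits expnS; move: (2 ^ c)%N => x; lia.
rewrite /storeto /=; case: (ltnP j N) => jN.
- exists (upd_cell st1 j v); split=> //; last first.
    by apply: (@sim_cell s st1 0 j).
  apply: within_if => //; rewrite r1 subr_gt0 ltz_nat jN -r2.
  by apply: within_write => //; rewrite r2.
- exists st1; split=> //.
  apply: within_if => //; rewrite r1 subr_gt0 ltz_nat ltnNge jN /=.
  by exists 1%N => //; apply: exec_skip.
Qed.

Definition loop_time (T : nat) : nat := N * (T + 10 * b + 30) + 4 * b + 20.

(** The invariant also sees [scr k], the accumulator of a [Sum]; this is why that register alone
    below [scr k.+2] may change. The index lives in [scr k.+2] and is copied to [x] in each round,
    so a body that overwrites [x] does not disturb the count. *)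
Lemma steps_loop k x body T (J : nat -> store -> int -> Prop) s st :
  (forall i s st, (i < N)%N -> sim (setv x i s) st ->
     J i s (reg st (scr k)) ->
     exists s' st', [/\ within body st T st', sim s' st',
       (forall j, (j < k.+4)%N -> j != k -> reg st' (scr j) = reg st (scr j))
       & J i.+1 s' (reg st' (scr k))]) ->
  sim s st -> J 0%N s (reg st (scr k)) ->
  exists s' st', [/\ within (loop_code k.+2 k.+3 x body) st (loop_time T) st',
    sim s' st',
    (forall j, (j < k.+2)%N -> j != k -> reg st' (scr j) = reg st (scr j))
    & J N s' (reg st' (scr k))].
Proof.
move=> Hb sm J0.
pose P i st1 := exists2 s1, sim s1 st1 & [/\ J i s1 (reg st1 (scr k)),
  reg st1 (scr k.+2) = i, reg st1 (scr k.+3) = (N - i)%N &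
  forall j, (j < k.+2)%N -> j != k -> reg st1 (scr j) = reg st (scr j)].
have scr_neq i j (ij : i != j) : (scr i == scr j) = false.
  by rewrite /scr; apply/eqP; lia.
have [st2 w2 P2] : exists2 st2, within (loop_code k.+2 k.+3 x body) st
    (2 + ((b + b).+4 + (N * (b.+1 + ((b + b).+4 + (T + (2 + ((b + b).+1 + (b + b).+1))))) + b.+1))) st2
    & P N st2; last first.
  case: P2 => s2 sm2 [J2 _ _ K2]; exists s2, st2; split=> //.
  by apply: within_le w2; rewrite /loop_time; nia.
have sm1 := sim_scr k.+2 0 sm.
have := sim_scr k.+3 N sm1; set st2 := upd_reg _ _ _ => sm2.
have P0 : P 0%N st2.
  exists s => //; split.
  - by rewrite /st2 !reg_scr_neq //; lia.
  - by rewrite /st2 reg_scr_neq ?reg_scr //; lia.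
  - by rewrite /st2 reg_scr subn0.
  - by move=> j jk _; rewrite /st2 !reg_scr_neq //; lia.
have [||st3 w3 P3] := within_while b_gt0 N_fits _ _ P0 (r := scr k.+3)
  (body := Seq (copy x.*2 (scr k.+2)) (Seq body
          (Seq (Const (scr k.+4) 1)
          (Seq (Arith (scr k.+2) Defs.Add (scr k.+2) (scr k.+4))
               (Arith (scr k.+3) Defs.Sub (scr k.+3) (scr k.+4))))))
  (T := ((b + b).+4 + (T + (2 + ((b + b).+1 + (b + b).+1))))).
- by move=> i st1 _ [s1 _ [_ _ ->]].
- move=> i st1 iN [s1 sm3 [J1 r2 r3 K1]].
  have smx := sim_setv x i sm3.
  have Jx : J i s1 (reg (upd_reg st1 x.*2 i) (scr k)) by rewrite reg_scr_var.
  have [s4 [st4 [w4 sm4 K4 J4]]] := Hb i s1 _ iN smx Jx.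
  have r42 : reg st4 (scr k.+2) = i by rewrite K4 ?reg_scr_var //; lia.
  have r43 : reg st4 (scr k.+3) = (N - i)%N by rewrite K4 ?reg_scr_var //; lia.
  set st5 := upd_reg st4 (scr k.+4) 1.
  set st6 := upd_reg st5 (scr k.+2) (arith_eval Defs.Add i 1).
  set st7 := upd_reg st6 (scr k.+3) (arith_eval Defs.Sub (N - i)%N 1).
  exists st7.
    have xk : x.*2 != scr k.+2 by apply/eqP; rewrite /scr; lia.
    have := @within_copy b st1 x.*2 (scr k.+2) b_gt0 xk; rewrite r2 => wc.
    apply: within_seq; first by apply: wc; apply: fits_ord; apply: ltnW.
    apply: within_seq; first exact: w4.
    apply: within_seq; first exact: within_const.
    have r52 : reg st5 (scr k.+2) = i by rewrite reg_scr_neq //; lia.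
    have r54 : reg st5 (scr k.+4) = 1 by rewrite reg_scr.
    have r63 : reg st6 (scr k.+3) = (N - i)%N by rewrite !reg_scr_neq //; lia.
    have r64 : reg st6 (scr k.+4) = 1 by rewrite reg_scr_neq //; lia.
    have f1 : fits b 1 by rewrite /fits (leq_trans _ (expn2_ge2 b_gt0)).
    have := @within_arith b st5 (scr k.+2) Defs.Add _ _ b_gt0.
    move=> /(_ (scr k.+2) (scr k.+4)); rewrite r52 r54 => w6.
    apply: within_seq; first by apply: w6 => //; apply: fits_ord; apply: ltnW.
    have := @within_arith b st6 (scr k.+3) Defs.Sub _ _ b_gt0.
    move=> /(_ (scr k.+3) (scr k.+4)); rewrite r63 r64 => w7.
    by apply: w7 => //; apply: fits_ord; apply: leq_subr.
  exists s4; first by do 3 apply: sim_scr.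
  split.
  - by rewrite /st7 /st6 /st5 !reg_scr_neq //; lia.
  - rewrite /st7 reg_scr_neq; last lia.
    by rewrite /st6 reg_scr /=; lia.
  - by rewrite /st7 reg_scr /=; lia.
  - move=> j jk jk'; rewrite /st7 /st6 /st5 !reg_scr_neq; try lia.
    by rewrite K4 ?reg_scr_var ?K1 //; lia.
exists st3 => //.
apply: within_seq; first exact: within_const.
apply: within_seq; last exact: w3.
have := @within_copy b (upd_reg st (scr k.+2) 0) (scr k.+3) 1 b_gt0.
by rewrite (sim_base sm1); apply.
Qed.

Fixpoint texp (e : aexp) : nat :=
  match e with
  | Lit z => (bitlen z).+1
  | Var x => (b + b).+4
  | Op o e1 e2 =>
      texp e1 + (texp e2 + (width (Op o e1 e2) * b + width (Op o e1 e2) * b).+1)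
  | Pos e1 => texp e1 + ((width e1 * b).+1 + 2)
  | Arr a e1 =>
      texp e1 + (7 * (width e1 * b) + 20 + (20 * (width e1 * b + a + 3) + 20))
  | Sum x e1 =>
      2 + ((b + b).+4 +
      (loop_time (texp e1 + ((width e1).+1 * b + (width e1).+1 * b).+1) +
       (b + b).+4))
  end.

Fixpoint tstm (t : stm) : nat :=
  match t with
  | Assign x e => texp e + (width e * b + width e * b).+4
  | Store a e1 e2 => texp e2 + (texp e1 +
      (7 * (width e1 * b) + 20 + (20 * (width e1 * b + a + 3) + 20)))
  | Then t1 t2 => tstm t1 + tstm t2
  | Cond e t1 t2 => texp e + ((width e * b).+1 + (tstm t1 + tstm t2))
  | For x t1 => loop_time (tstm t1)
  end.

Lemma setv_twice x y z s : setv x y (setv x z s) = setv x y s.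
Proof. by congr Mem; apply/funext => i /=; case: (i == x). Qed.

Lemma setv_var x s : setv x (var s x) s = s.
Proof.
case: s => v a; congr Mem; apply/funext => i /=.
by case: (eqVneq i x) => [->|].
Qed.

Lemma le_width_b e : (b <= width e * b)%N.
Proof. by rewrite leq_pmull // width_gt0. Qed.

Lemma width_b_gt0 e : (0 < width e * b)%N.
Proof. by rewrite muln_gt0 width_gt0. Qed.

Lemma fits1 c : (0 < c)%N -> fits c 1.
Proof. by move=> c0; rewrite /fits (leq_trans _ (expn2_ge2 c0)). Qed.

(** Evaluation leaves the store as it was: a [Sum] saves its bound variable in [scr k.+1] and
    restores it at the end. Its partial sums fit the width of the whole sum, by [fits_sum] with
    fewer terms. *)
Lemma steps_cexp k e s st : sim s st -> small s ->
  steps k (cexp k e) (texp e) s st s (fun st' => reg st' (scr k) = eval e s).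
Proof.
elim: e k s st => [z|x|o e1 IH1 e2 IH2|e IH|a e IH|x e IH] k s st sm ss.
- apply: (steps_scr (leqnn k) sm); first exact: within_const.
  by rewrite reg_scr.
- apply: (@steps_scr k _ _ _ _ (var s x) _ k) => //; last by rewrite reg_scr.
  rewrite -(sim_var sm); apply: within_copy => //.
    by apply/eqP; rewrite /scr; lia.
  by rewrite (sim_var sm); case: ss.
- rewrite /=; set w := (_ * b)%N; have w0 : (0 < w)%N.
    exact: (width_b_gt0 (Op o e1 e2)).
  have fw1 : fits w (eval e1 s).
    by apply: fits_le (fits_eval _ ss); rewrite leq_mul2r leq_addr orbT.
  have fw2 : fits w (eval e2 s).
    by apply: fits_le (fits_eval _ ss); rewrite leq_mul2r leq_addl orbT.
  have [st1 [w1 sm1 k1 r1]] := IH1 k _ _ sm ss.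
  have [st2 [w2 sm2 k2 r2]] := IH2 k.+1 _ _ sm1 ss.
  have r1' : reg st2 (scr k) = eval e1 s by rewrite k2.
  have := @within_arith w st2 (scr k) o _ _ w0.
  move=> /(_ (scr k) (scr k.+1)); rewrite r1' r2 => /(_ fw1 fw2) w3.
  eexists; split; first exact: within_seq w1 (within_seq w2 w3).
  + exact: sim_scr.
  + move=> j jk; rewrite reg_scr_neq; last by rewrite neq_ltn jk.
    by rewrite k2 ?k1 //; apply: ltnW.
  + exact: reg_scr.
- have [st1 [w1 sm1 k1 r1]] := IH k _ _ sm ss.
  have fw := fits_eval e ss.
  exists (upd_reg st1 (scr k) (eval (Pos e) s)); split; last exact: reg_scr.
  + apply: within_seq w1 _; apply: within_if; rewrite ?r1 ?width_b_gt0 //=.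
    case: ifP => _; apply: within_le (within_const _ _ _); rewrite ltnS.
      by apply: fits_bitlen.
    by apply: fits_bitlen => //; apply: fits0.
  + exact: sim_scr.
  + exact: keeps_trans (leqnn k) k1 (keeps_scr _ _ _).
- have [st1 [w1 sm1 k1 r1]] := IH k _ _ sm ss.
  have [st2 [w2 sm2 k2 r2]] :=
    steps_abs (width_b_gt0 e) sm1 r1 (fits_eval e ss).
  have fa : fits (width e * b) `|eval e s|%N by exact: (fits_eval e ss).
  have [st3 [w3 sm3 k3 r3]] := steps_load a (le_width_b e) sm2 ss r2 fa.
  exists st3; split=> //; first exact: within_seq w1 (within_seq w2 w3).
  exact: keeps_trans (leqnn k) k1 (keeps_trans (leqnn k) k2 k3).
- have fv : fits b (var s x) by case: ss.
  have sm1 := sim_scr k 0 sm; set st1 := upd_reg st _ _ in sm1.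
  have := sim_scr k.+1 (var s x) sm1; set st2 := upd_reg st1 _ _ => sm2.
  have kx : scr k.+1 != x.*2 by apply/eqP; rewrite /scr; lia.
  have := @within_copy b st1 (scr k.+1) x.*2 b_gt0 kx.
  rewrite (sim_var sm1) => /(_ fv) w2.
  pose J i s1 acc := (exists z, s1 = setv x z s) /\
    acc = \sum_(j < i) eval e (setv x j s) :> int.
  have J0 : J 0%N s (reg st2 (scr k)).
    split; first by exists (var s x); rewrite setv_var.
    by rewrite big_ord0 /st2 reg_scr_neq ?reg_scr //; lia.
  set W := ((width e).+1 * b)%N.
  have W0 : (0 < W)%N by rewrite /W muln_gt0.
  have [|s3 [st3 [w3 sm3 k3 [[z e3] r3]]]] := @steps_loop k x
    (Seq (cexp k.+4 e) (Arith (scr k) Defs.Add (scr k) (scr k.+4)))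
    (texp e + (W + W).+1) J s st2 _ sm2 J0.
    move=> i s1 st3 iN sm3 [[z ez] acc]; rewrite ez setv_twice in sm3.
    have ssi : small (setv x i s).
      by apply: small_setv => //; apply: fits_ord; apply: ltnW.
    have [st4 [w4 sm4 k4 r4]] := IH k.+4 _ _ sm3 ssi.
    have r4' : reg st4 (scr k) = \sum_(j < i) eval e (setv x j s).
      by rewrite k4 //; lia.
    have fW : fits W (\sum_(j < i) eval e (setv x j s)).
      rewrite /W mulSn addnC.
      apply: (fits_sum (F := fun i => eval e (setv x i s))) (ltnW iN) _ => j ji.
      apply: fits_eval; apply: small_setv => //; apply: fits_ord.
      by apply: ltnW; apply: ltn_trans iN.
    have fe : fits W (eval e (setv x i s)).
      by apply: fits_le (fits_eval _ ssi); rewrite /W leq_mul2r leqnSn orbT.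
    have := @within_arith W st4 (scr k) Defs.Add _ _ W0.
    move=> /(_ (scr k) (scr k.+4)); rewrite r4 r4' => /(_ fW fe) w5.
    exists (setv x i s); eexists; split; first exact: within_seq w4 w5.
    - exact: sim_scr.
    - by move=> j jk jk'; rewrite reg_scr_neq // k4.
    - split; first by exists i.
      by rewrite reg_scr big_ord_recr.
  rewrite {}e3 in sm3.
  have sx : reg st3 (scr k.+1) = var s x.
    by rewrite k3 ?reg_scr //; lia.
  exists (upd_reg st3 x.*2 (var s x)); split.
  + apply: within_seq; first exact: (within_const st (scr k) 0).
    apply: within_seq w2 (within_seq w3 _); rewrite -sx.
    by apply: within_copy; rewrite ?sx // eq_sym.
  + by have := sim_setv x (var s x) sm3; rewrite setv_twice setv_var.
  + move=> j jk; rewrite reg_scr_var k3; [|lia|lia].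
    by rewrite /st2 /st1 !reg_scr_neq //; lia.
  + by rewrite reg_scr_var r3.
Qed.

(** The bound [tstm t] depends on the program text, [N] and [b] only, which is what makes polynomial
    running time a syntactic matter. *)
Theorem wp_sound k t (Q : store -> Prop) s st :
  wp t Q s -> sim s st -> small s ->
  exists s' st', [/\ within (cstm k t) st (tstm t) st', sim s' st',
    keeps k st st', small s' & Q s'].
Proof.
elim: t k Q s st => [x e|a e1 e2|t1 IH1 t2 IH2|e t1 IH1 t2 IH2|x t IH] k Q s st.
- move=> /= [fe Qe] sm ss.
  have [st1 [w1 sm1 k1 r1]] := steps_cexp k e sm ss.
  exists (setv x (eval e s) s), (upd_reg st1 x.*2 (eval e s)); split=> //.
  + apply: within_seq w1 _; rewrite -r1; apply: within_copy.
    * exact: width_b_gt0.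
    * by apply/eqP; rewrite /scr; lia.
    * by rewrite r1; apply: fits_eval.
  + exact: sim_setv.
  + by move=> j jk; rewrite reg_scr_var k1.
  + exact: small_setv.
- move=> /= [fe Qe] sm ss.
  have [st1 [w1 sm1 k1 r1]] := steps_cexp k e2 sm ss.
  have [st2 [w2 sm2 k2 r2]] := steps_cexp k.+1 e1 sm1 ss.
  have [st3 [w3 sm3 k3 r3]] :=
    steps_abs (width_b_gt0 e1) sm2 r2 (fits_eval e1 ss).
  have fa : fits (width e1 * b) `|eval e1 s|%N by exact: (fits_eval e1 ss).
  have rk : reg st3 (scr k) = eval e2 s by rewrite k3 ?k2.
  have fv := fits_le (le_width_b e1) fe.
  have [st4 [w4 sm4 k4 _]] := steps_save a (le_width_b e1) sm3 fv rk r3 fa.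
  exists (storeto a `|eval e1 s|%N (eval e2 s) s), st4; split=> //.
  + exact: within_seq w1 (within_seq w2 (within_seq w3 w4)).
  + move=> j jk; rewrite k4 ?k3 ?k2 ?k1 //; lia.
  + by rewrite /storeto; case: ifP => // _; apply: small_seta.
- move=> /= H sm ss.
  have [s1 [st1 [w1 sm1 k1 ss1 H1]]] := IH1 k _ _ _ H sm ss.
  have [s2 [st2 [w2 sm2 k2 ss2 H2]]] := IH2 k _ _ _ H1 sm1 ss1.
  exists s2, st2; split=> //; first exact: within_seq w1 w2.
  exact: keeps_trans k1 k2.
- move=> /= H sm ss.
  have [st1 [w1 sm1 k1 r1]] := steps_cexp k e sm ss.
  have [s2 [st2 [w2 sm2 k2 ss2 H2]]] : exists s' st',
      [/\ within (if 0 < eval e s then cstm k t1 else cstm k t2) st1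
            (tstm t1 + tstm t2) st', sim s' st', keeps k st1 st', small s' & Q s'].
    case: ifP H => _ H.
      have [s2 [st2 [w2 ? ? ? ?]]] := IH1 k _ _ _ H sm1 ss.
      by exists s2, st2; split=> //; apply: within_le w2; apply: leq_addr.
    have [s2 [st2 [w2 ? ? ? ?]]] := IH2 k _ _ _ H sm1 ss.
    by exists s2, st2; split=> //; apply: within_le w2; apply: leq_addl.
  exists s2, st2; split=> //; last exact: keeps_trans k1 k2.
  apply: within_seq w1 _; apply: within_if; rewrite ?r1 ?width_b_gt0 //.
  exact: fits_eval.
- move=> /= H sm ss.
  pose J i s1 (acc : int) := small s1 /\ wploop (wp t) x Q (N - i) i s1.
  have J0 : J 0%N s (reg st (scr k)) by rewrite /J subn0.
  have [|s3 [st3 [w3 sm3 k3 [ss3 H3]]]] := @steps_loop k x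
    (cstm k.+4 t) (tstm t) J s st _ sm J0.
    move=> i s1 st1 iN sm1 [ss1]; have -> : (N - i = (N - i.+1).+1)%N by lia.
    move=> /= H1.
    have [|s2 [st2 [w2 sm2 k2 ss2 H2]]] := IH k.+4 _ _ _ H1 sm1.
      by apply: small_setv => //; apply: fits_ord; apply: ltnW.
    by exists s2, st2; split=> // j jk _; apply: k2.
  rewrite subnn /= in H3.
  exists s3, st3; split=> // j jk; apply: k3; lia.
Qed.

Lemma wp_mono t (Q R : store -> Prop) s :
  (forall s', Q s' -> R s') -> wp t Q s -> wp t R s.
Proof.
elim: t Q R s => [x e|a e1 e2|t1 IH1 t2 IH2|e t1 IH1 t2 IH2|x t IH] Q R s QR /=.
- by case=> ? /QR.
- by case=> ? /QR.
- by apply: IH1 => s'; apply: IH2.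
- by case: ifP => _; [apply: IH1 | apply: IH2].
- move: 0%N; elim: N s => [|n IHn] s i /=; first exact: QR.
  by apply: IH => s'; apply: IHn.
Qed.

Fixpoint vars_set (t : stm) : seq nat :=
  match t with
  | Assign x _ => [:: x]
  | Store _ _ _ => [::]
  | Then t1 t2 => vars_set t1 ++ vars_set t2
  | Cond _ t1 t2 => vars_set t1 ++ vars_set t2
  | For x t1 => x :: vars_set t1
  end.

Fixpoint arrs_set (t : stm) : seq nat :=
  match t with
  | Assign _ _ => [::]
  | Store a _ _ => [:: a]
  | Then t1 t2 => arrs_set t1 ++ arrs_set t2
  | Cond _ t1 t2 => arrs_set t1 ++ arrs_set t2
  | For _ t1 => arrs_set t1
  end.

Definition same (vs xs : seq nat) (s s' : store) : Prop :=
  (forall x, x \notin vs -> var s' x = var s x) /\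
  (forall a, a \notin xs -> arr s' a = arr s a).

Lemma same_setv vs xs s s' x v : x \in vs ->
  same vs xs s s' -> same vs xs s (setv x v s').
Proof.
move=> xv [hv ha]; split=> // y yv /=; rewrite -hv //.
by case: eqP => // e; rewrite e xv in yv.
Qed.

Lemma same_storeto vs xs s s' a j v : a \in xs ->
  same vs xs s s' -> same vs xs s (storeto a j v s').
Proof.
move=> ax [hv ha]; rewrite /storeto; case: ifP => // _.
split=> // a' a'x /=; rewrite -ha //.
by case: eqP => // e; rewrite e ax in a'x.
Qed.

(** Proved once by induction on the statement, so that loop invariants need not list the variables
    and arrays that a body never writes. *)
Lemma wp_frame t vs xs (Q : store -> Prop) s s0 :
  {subset vars_set t <= vs} -> {subset arrs_set t <= xs} ->
  same vs xs s0 s -> wp t Q s -> wp t (fun s' => same vs xs s0 s' /\ Q s') s.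
Proof.
elim: t Q s => [x e|a e1 e2|t1 IH1 t2 IH2|e t1 IH1 t2 IH2|x t IH] Q s tv ta sm /=.
- by move=> [f q]; split=> //; split=> //; apply: same_setv => //; apply: tv; rewrite inE.
- move=> [f q]; split=> //; split=> //.
  by apply: same_storeto => //; apply: ta; rewrite inE.
- have [tv1 tv2] : {subset vars_set t1 <= vs} /\ {subset vars_set t2 <= vs}.
    by split=> y yt; apply: tv; rewrite /= mem_cat yt ?orbT.
  have [ta1 ta2] : {subset arrs_set t1 <= xs} /\ {subset arrs_set t2 <= xs}.
    by split=> y yt; apply: ta; rewrite /= mem_cat yt ?orbT.
  by move=> /(IH1 _ _ tv1 ta1 sm); apply: wp_mono => s' [sm' /IH2]; apply.
- have [tv1 tv2] : {subset vars_set t1 <= vs} /\ {subset vars_set t2 <= vs}.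
    by split=> y yt; apply: tv; rewrite /= mem_cat yt ?orbT.
  have [ta1 ta2] : {subset arrs_set t1 <= xs} /\ {subset arrs_set t2 <= xs}.
    by split=> y yt; apply: ta; rewrite /= mem_cat yt ?orbT.
  by case: ifP => _; [apply: IH1 | apply: IH2].
- move: 0%N; elim: N s sm => [|n IHn] s sm i /=; first by split.
  have xv : x \in vs by apply: tv; rewrite /= inE eqxx.
  move=> /IH H; apply: wp_mono (H _ _ _).
  + by move=> s' [sm' q]; apply: IHn.
  + by move=> y yt; apply: tv; rewrite /= inE yt orbT.
  + by move=> y yt; apply: ta.
  + exact: same_setv.
Qed.

(** Each round and the exit also know, through [same], that nothing outside the write set of the
    loop has changed since it was entered. *)
Lemma wp_for x t (Q : store -> Prop) (I : nat -> store -> Prop) s :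
  I 0%N s ->
  (forall (i : nat) s', (i < N)%N -> same (x :: vars_set t) (arrs_set t) s s' ->
     I i s' -> wp t (I i.+1) (setv x i s')) ->
  (forall s', same (x :: vars_set t) (arrs_set t) s s' -> I N s' -> Q s') ->
  wp (For x t) Q s.
Proof.
move=> I0 Ii IQ /=.
suff H n i s' : (n + i = N)%N -> same (x :: vars_set t) (arrs_set t) s s' ->
    I i s' -> wploop (wp t) x Q n i s'.
  by apply: H; rewrite ?addn0.
elim: n i s' => [|n IHn] i s' ni sm Is' /=.
  by rewrite add0n in ni; apply: IQ => //; rewrite -ni.
have sm' : same (x :: vars_set t) (arrs_set t) s (setv x i s').
  by apply: same_setv => //; rewrite inE eqxx.
have iN : (i < N)%N by rewrite -ni; lia.
have sub1 : {subset vars_set t <= x :: vars_set t}.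
  by move=> y yt; rewrite inE yt orbT.
have sub2 : {subset arrs_set t <= arrs_set t} by [].
have := wp_frame sub1 sub2 sm' (Ii i s' iN sm Is').
by apply: wp_mono => s2 [sm2 I2]; apply: IHn => //; lia.
Qed.

End Correctness.

(** * Polynomial running time *)

Definition poly_bounded (f : nat -> nat -> nat) : Prop :=
  exists c d, forall n b, (f n b <= c * (n + b).+1 ^ d)%N.

Lemma poly_bounded_const c : poly_bounded (fun _ _ => c).
Proof. by exists c, 0%N => n b; rewrite expn0 muln1. Qed.

Lemma poly_bounded_fst : poly_bounded (fun n _ => n).
Proof. by exists 1%N, 1%N => n b; rewrite expn1 mul1n; lia. Qed.

Lemma poly_bounded_snd : poly_bounded (fun _ b => b).
Proof. by exists 1%N, 1%N => n b; rewrite expn1 mul1n; lia. Qed.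

Lemma poly_boundedD f g : poly_bounded f -> poly_bounded g ->
  poly_bounded (fun n b => f n b + g n b)%N.
Proof.
move=> [c [d cd]] [c' [d' cd']]; exists (c + c')%N, (d + d')%N => n b.
rewrite mulnDl leq_add //.
- by rewrite (leq_trans (cd n b)) // leq_mul2l leq_pexp2l ?orbT // leq_addr.
- by rewrite (leq_trans (cd' n b)) // leq_mul2l leq_pexp2l ?orbT // leq_addl.
Qed.

Lemma poly_boundedM f g : poly_bounded f -> poly_bounded g ->
  poly_bounded (fun n b => f n b * g n b)%N.
Proof.
move=> [c [d cd]] [c' [d' cd']]; exists (c * c')%N, (d + d')%N => n b.
by rewrite expnD mulnACA leq_mul.
Qed.

Lemma poly_bounded_le f g : (forall n b, (f n b <= g n b)%N) ->
  poly_bounded g -> poly_bounded f.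
Proof.
by move=> fg [c [d cd]]; exists c, d => n b; apply: leq_trans (cd n b).
Qed.

Ltac poly_bound := repeat first
  [ assumption | exact: poly_bounded_const | exact: poly_bounded_fst
  | exact: poly_bounded_snd | apply: poly_boundedD | apply: poly_boundedM ].

Lemma poly_bounded_loop f : poly_bounded f ->
  poly_bounded (fun n b => loop_time n b (f n b)).
Proof. by move=> ?; rewrite /loop_time; poly_bound. Qed.

Lemma poly_bounded_texp e : poly_bounded (fun n b => texp n b e).
Proof.
elim: e => [z|x|o e1 IH1 e2 IH2|e IH|a e IH|x e IH] /=.
- exact: poly_bounded_const.
- by apply: (@poly_bounded_le _ (fun _ b => b + b + 4)%N); [lia | poly_bound].
- apply: (@poly_bounded_le _ (fun n b => texp n b e1 + (texp n b e2 +
    ((width e1 + width e2) * b + (width e1 + width e2) * b + 1)))%N); [lia|].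
  by poly_bound.
- apply: (@poly_bounded_le _ (fun n b => texp n b e + (width e * b + 3))%N).
    by lia.
  by poly_bound.
- by poly_bound.
- pose T n b := (texp n b e + ((width e).+1 * b + (width e).+1 * b + 1))%N.
  apply: (@poly_bounded_le _ (fun n b => 2 + (b + b + 4 +
    (loop_time n b (T n b) + (b + b + 4))))%N).
    by move=> n b; rewrite /T addn1; lia.
  have : poly_bounded (fun n b => loop_time n b (T n b)).
    by apply: poly_bounded_loop; rewrite /T; poly_bound.
  by move=> ?; poly_bound.
Qed.

Lemma poly_bounded_tstm t : poly_bounded (fun n b => tstm n b t).
Proof.
elim: t => [x e|a e1 e2|t1 IH1 t2 IH2|e t1 IH1 t2 IH2|x t IH] /=.
- have := poly_bounded_texp e => ?.
  apply: (@poly_bounded_le _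
    (fun n b => texp n b e + (width e * b + width e * b + 4))%N); [lia|].
  by poly_bound.
- have := poly_bounded_texp e1; have := poly_bounded_texp e2 => ? ?.
  by poly_bound.
- by poly_bound.
- have := poly_bounded_texp e => ?.
  apply: (@poly_bounded_le _ (fun n b => texp n b e +
    (width e * b + 1 + (tstm n b t1 + tstm n b t2)))%N); [lia|].
  by poly_bound.
- exact: poly_bounded_loop.
Qed.

(** Register 0 carries the input length at the start but is also variable 0, in which the program
    leaves the output length. The loops take their bound from register 1, which no variable
    occupies. *)
Definition compile (t : stm) : cmd := Seq (copy 1 0) (cstm 0 t).

Definition start (inp : seq int) : store :=
  Mem [eta (fun=> 0) with 0%N |-> (size inp)%:Z]
      (fun a j => if a == 0%N then inp`_j else 0).

Theorem compile_runs b t inp (Q : store -> Prop) :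
  (0 < b)%N -> fits b (size inp) -> (forall j, fits b inp`_j) ->
  wp (size inp) b t Q (start inp) ->
  exists2 s, Q s & forall out, (size out <= size inp)%N ->
    var s 0 = size out -> (forall k, (k < size out)%N -> arr s 0 k = out`_k) ->
    exists2 T, (T <= (b + b).+4 + tstm (size inp) b t)%N
      & runs (compile t) inp T out.
Proof.
move=> b0 fN fi H.
have w0 := @within_copy b (init_state inp) 1 0 b0 erefl fN.
set st1 := upd_reg _ _ _ in w0.
have sm : sim (size inp) (start inp) st1.
  split=> //=.
  - by case=> [|x].
  - by move=> j; apply: nth_default.
  - move=> a j a0; rewrite (gtn_eqF a0) nth_default //.
    exact: leq_addr.
have ss : small b (start inp).
  split=> [x|a j] /=; case: ifP => // _; exact: fits0.
have [s [st2 [[T w2 lT] sm2 _ _ Qs]]] := wp_sound b0 fN 0 H sm ss.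
exists s => // out so s0 sk.
have [T0 e0 l0] := w0.
exists (T0 + T)%N; first exact: leq_add.
exists st2; first exact: exec_seq e0 w2.
split; first by rewrite -s0 -(sim_var sm2).
by move=> k ks; rewrite (sim_low sm2) ?sk //; apply: leq_trans so.
Qed.

(** * Cutting a sequence into blocks *)

Lemma sqr_le_bound (F : realFieldType) (x a b : F) :
  0 <= x -> x <= a -> a * a <= b -> x ^+ 2 <= b.
Proof. by move=> x0 xa; apply: le_trans; rewrite expr2 ler_pM. Qed.

(* The limit of (1 + 1/n)^(n+1) is e; repeated squaring with rounding up.     *)
Lemma euler_bound (F : realFieldType) : exists2 n, (0 < n)%N &
  (1 + n%:R^-1) ^+ n.+1 <= 27185%:R / 10000%:R :> F.
Proof.
(* The excess over e is about e / (2n), so 2.7185 takes an n of several thousand; a power of 2 is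
   reached by thirteen squarings. *)
exists 8192 => //; have : 1 + 8192%:R^-1 <= 10001220704%:R / 10000000000%:R :> F.
  by lra.
have : 0 <= 1 + 8192%:R^-1 :> F by lra.
rewrite exprSr; move: (1 + _) => q q_ge0 q_le; have q0 n : 0 <= q ^+ n by rewrite exprn_ge0.
have h0 : q ^+ 1 <= 10001220704%:R / 10000000000%:R by rewrite expr1.
have h1 : q ^+ 2 <= 10002441558%:R / 10000000000%:R.
  by rewrite (exprM q 1 2); apply: (sqr_le_bound (q0 _) h0); clear; lra.
have h2 : q ^+ 4 <= 10004883713%:R / 10000000000%:R.
  by rewrite (exprM q 2 2); apply: (sqr_le_bound (q0 _) h1); clear; lra.
have h3 : q ^+ 8 <= 10009769812%:R / 10000000000%:R.
  by rewrite (exprM q 4 2); apply: (sqr_le_bound (q0 _) h2); clear; lra.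
have h4 : q ^+ 16 <= 10019549169%:R / 10000000000%:R.
  by rewrite (exprM q 8 2); apply: (sqr_le_bound (q0 _) h3); clear; lra.
have h5 : q ^+ 32 <= 10039136556%:R / 10000000000%:R.
  by rewrite (exprM q 16 2); apply: (sqr_le_bound (q0 _) h4); clear; lra.
have h6 : q ^+ 64 <= 10078426280%:R / 10000000000%:R.
  by rewrite (exprM q 32 2); apply: (sqr_le_bound (q0 _) h5); clear; lra.
have h7 : q ^+ 128 <= 10157467629%:R / 10000000000%:R.
  by rewrite (exprM q 64 2); apply: (sqr_le_bound (q0 _) h6); clear; lra.
have h8 : q ^+ 256 <= 10317414864%:R / 10000000000%:R.
  by rewrite (exprM q 128 2); apply: (sqr_le_bound (q0 _) h7); clear; lra.
have h9 : q ^+ 512 <= 10644904948%:R / 10000000000%:R.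
  by rewrite (exprM q 256 2); apply: (sqr_le_bound (q0 _) h8); clear; lra.
have h10 : q ^+ 1024 <= 11331400136%:R / 10000000000%:R.
  by rewrite (exprM q 512 2); apply: (sqr_le_bound (q0 _) h9); clear; lra.
have h11 : q ^+ 2048 <= 12840062905%:R / 10000000000%:R.
  by rewrite (exprM q 1024 2); apply: (sqr_le_bound (q0 _) h10); clear; lra.
have h12 : q ^+ 4096 <= 16486721541%:R / 10000000000%:R.
  by rewrite (exprM q 2048 2); apply: (sqr_le_bound (q0 _) h11); clear; lra.
have h13 : q ^+ 8192 <= 27181198718%:R / 10000000000%:R.
  by rewrite (exprM q 4096 2); apply: (sqr_le_bound (q0 _) h12); clear; lra.
apply: le_trans (ler_wpM2r q_ge0 h13) _.
by apply: le_trans (ler_wpM2l _ q_le) _; clear; lra.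
Qed.

Section Averaging.

Variable N : nat.
Hypothesis N_gt0 : (0 < N)%N.

Let q : rat := 1 + N%:R^-1.
Let r : rat := q ^+ N.

Lemma ratio_gt1 : 1 < q.
Proof. by rewrite ltrDl invr_gt0 ltr0n. Qed.

Let q_gt0 : 0 < q. Proof. exact: lt_trans ratio_gt1. Qed.
Let q_ge1 : 1 <= q. Proof. exact: ltW ratio_gt1. Qed.

Let r_gt1 : 1 < r. Proof. by rewrite exprn_egt1 ?ratio_gt1 // -lt0n. Qed.

(** Bernoulli's inequality q^k >= 1 + k/N, used at k = N |z|. *)
Lemma ex_power_ge (z : int) : exists c, z%:~R <= q ^+ c.
Proof.
have Nx (k : nat) : 1 + k%:R / N%:R <= q ^+ k.
  elim: k => [|k IH]; first by rewrite mul0r addr0 expr0.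
  rewrite exprS; apply: le_trans (ler_wpM2l (ltW q_gt0) IH).
  rewrite /q -addn1 natrD; have : 0 <= k%:R / N%:R * N%:R^-1 :> rat.
    by rewrite !mulr_ge0 ?invr_ge0.
  by lra.
exists (N * `|z|)%N; apply: le_trans (Nx _).
rewrite natrM mulrAC divff ?pnatr_eq0 -?lt0n // mul1r.
rewrite -[X in X + _]/(1%:R) -natrD pmulrn ler_int; lia.
Qed.

Definition power_above (z : int) : nat := ex_minn (ex_power_ge z).

Lemma power_above_ge z : z%:~R <= q ^+ power_above z.
Proof. by rewrite /power_above; case: ex_minnP. Qed.

(** Rounding up to a power of q costs at most a factor q, by minimality of the exponent. The
    exponent 0 has no predecessor, and there [1 <= z] is used. *)
Lemma power_above_le z : 1 <= z -> q ^+ power_above z <= q * z%:~R.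
Proof.
move=> z1; rewrite /power_above; case: ex_minnP => -[|c] _ min.
  rewrite expr0; apply: le_trans q_ge1 _.
  by rewrite ler_peMr ?ler1z // ltW.
rewrite exprS ler_pM2l // ltW // ltNge; apply/negP => /min.
by rewrite ltnn.
Qed.

Lemma power_above_mono z z' : z <= z' -> (power_above z <= power_above z')%N.
Proof.
move=> zz; rewrite {1}/power_above; case: ex_minnP => c _; apply.
by apply: le_trans (power_above_ge z'); rewrite ler_int.
Qed.

(* The least element of j + N * nat that is at least c, for j < N.            *)
Definition snap (j c : nat) : nat := (j + N * ((c - j + N.-1) %/ N))%N.

Lemma snap_ge j c : (c <= snap j c)%N.
Proof.
rewrite /snap; have := divn_eq (c - j + N.-1) N.
have := ltn_pmod (c - j + N.-1) N_gt0.
by move: (_ %/ N)%N (_ %% N)%N => x y; nia.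
Qed.

Lemma snap_mono j c d : (c <= d -> snap j c <= snap j d)%N.
Proof.
by move=> cd; rewrite leq_add2l leq_mul2l leq_div2r ?orbT // leq_add2r leq_sub2r.
Qed.

(** Both values lie in one residue class modulo [N]. Hence the powers of q at distinct snapped
    levels differ by a factor of at least r. *)
Lemma snap_gap j c d : (snap j c < snap j d -> snap j c + N <= snap j d)%N.
Proof.
rewrite /snap ltn_add2l ltn_pmul2l // -addnA leq_add2l => cd.
by rewrite -mulnSr leq_pmul2l.
Qed.

Lemma snap0 j : snap j 0 = j.
Proof. by rewrite /snap sub0n add0n divn_small ?muln0 ?addn0 // prednK. Qed.

(** Only the residue class of [c] itself moves when [c] becomes [c + 1]; it jumps from [c] to
    [c + N], as [snap_modn] and [snap_modnS] record. *)
Lemma snapS j c : (j < N)%N -> j != (c %% N)%N -> snap j c.+1 = snap j c.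
Proof.
move=> jN jc; rewrite /snap; case: (leqP c.+1 j) => [cj|jc'].
  by move: (cj) (ltnW cj); rewrite -!subn_eq0 => /eqP -> /eqP ->.
rewrite subSn // addSn -addnS prednK // divnDr // divnn N_gt0.
congr (_ + _ * _)%N.
have x0 : ((c - j) %% N != 0)%N.
  apply: contra jc => /eqP x0; rewrite -(subnK (_ : j <= c)%N) //.
  by rewrite -modnDml x0 add0n modn_small.
rewrite [in RHS](divn_eq (c - j) N) -addnA divnMDl //; congr addn.
have := ltn_pmod (c - j) N_gt0; move: x0; move: (_ %% _)%N => x x0 xN.
have -> : (x + N.-1 = N + x.-1)%N by lia.
by rewrite divnDl // divnn N_gt0 divn_small //; lia.
Qed.

Lemma snap_modn c : snap (c %% N) c = c.
Proof.
have e : (c - c %% N = c %/ N * N)%N by rewrite {1}(divn_eq c N) addnK.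
rewrite /snap e divnMDl // [(N.-1 %/ N)%N]divn_small ?prednK // addn0.
by rewrite addnC mulnC -divn_eq.
Qed.

Lemma snap_modnS c : snap (c %% N) c.+1 = (c + N)%N.
Proof.
have e : (c.+1 - c %% N + N.-1 = (c %/ N).+1 * N)%N.
  rewrite mulSn; have := divn_eq c N; have := N_gt0.
  by move: (c %/ N * N)%N (c %% N)%N => x y; lia.
rewrite /snap e mulnK // mulnC mulSn; have := divn_eq c N.
by move: (c %/ N * N)%N (c %% N)%N => x y; lia.
Qed.

(** Averaged over the shifts, snapping multiplies q^c by a constant. From c to c + 1 a single term
    changes, from q^c to q^(c+N), in accordance with (q - 1) (1 + ... + q^(N-1)) = q^N - 1. *)
Lemma sum_snap c :
  \sum_(j < N) q ^+ snap j c = q ^+ c * \sum_(j < N) q ^+ j.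
Proof.
elim: c => [|c IH].
  by rewrite mul1r; apply: eq_bigr => j _; rewrite snap0.
have jN : (c %% N < N)%N by rewrite ltn_mod.
move: IH; rewrite (bigD1 (Ordinal jN)) //= [in X in _ -> X](bigD1 (Ordinal jN)) //=.
rewrite snap_modn snap_modnS => IH.
have -> : \sum_(i < N | i != Ordinal jN) q ^+ snap i c.+1 =
          \sum_(i < N | i != Ordinal jN) q ^+ snap i c.
  by apply: eq_bigr => i ij; rewrite snapS.
have Sq : q * \sum_(j < N) q ^+ j = \sum_(j < N) q ^+ j - 1 + q ^+ N.
  have := subrX1 q N; rewrite mulrBl mul1r => /eqP; rewrite eq_sym subr_eq => /eqP ->.
  by ring.
rewrite exprS -mulrA mulrCA Sq mulrDr mulrBr mulr1 -IH exprD; ring.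
Qed.

Section Chain.

(* [G b] is the least cost of cutting the first [b] jobs of the removal order *)
(* into blocks. A block starting at [a] has load [K a], paid by each group    *)
(* [s] whose first job, at [h s], comes before the end of the block.          *)
Variables (m n : nat) (K : nat -> int) (W : nat -> int) (h : nat -> nat).
Variable (G : nat -> int).
Hypotheses (K_ge1 : forall i, (i < m)%N -> 1 <= K i)
  (K_mono : forall i j, (i <= j)%N -> (j < m)%N -> K j <= K i)
  (W_ge0 : forall s, (s < n)%N -> 0 <= W s)
  (G0 : G 0%N <= 0)
  (GS : forall a b, (a <= b)%N -> (b < m)%N ->
     G b.+1 <= G a + K a * \sum_(s < n | (h s < b.+1)%N) W s).

Let lev (j i : nat) : nat := snap j (power_above (K i)).
(** The sum of the geometric series 1 + 1/r + 1/r^2 + ..., which dominates the levels of successive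
    blocks. *)
Let rho : rat := r / (r - 1).

Let lev_mono j i i' : (i <= i')%N -> (i' < m)%N -> (lev j i' <= lev j i)%N.
Proof. by move=> ii im; apply/snap_mono/power_above_mono/K_mono. Qed.

Let K_le_lev j i : (K i)%:~R <= q ^+ lev j i.
Proof.
apply: le_trans (power_above_ge _) _; rewrite ler_weXn2l ?snap_ge //.
Qed.

Let rhoK x : rho * (x - x / r) = x.
Proof.
rewrite /rho; field.
by rewrite subr_eq0 !gt_eqF // (lt_trans _ r_gt1).
Qed.

(* Cutting where the snapped level changes gives a chain whose cost is        *)
(* dominated by a geometric series; the subtracted term telescopes.           *)
Lemma chain_shift j b : (b < m)%N ->
  (G b.+1)%:~R <= \sum_(s < n | (h s < b.+1)%N)
      (W s)%:~R * (rho * (q ^+ lev j (h s) - q ^+ lev j b / r)).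
Proof.
have [k] := ubnP b; elim: k b => // k IH b bk bm.
have ex : exists a, (lev j a <= lev j b)%N by exists b.
(* [a] starts the plateau of the snapped level that contains [b]: the last block runs from [a] to
   [b], and the induction hypothesis covers the jobs before [a]. *)
case: (ex_minnP ex) => a ab amin.
have lab : (a <= b)%N by exact: amin.
have la : lev j a = lev j b.
  by apply/eqP; rewrite eqn_leq ab lev_mono.
have below i : (a <= i)%N -> (i <= b)%N -> lev j i = lev j b.
  move=> ai ib; apply/eqP; rewrite eqn_leq [X in _ && X]lev_mono // andbT -la.
  by rewrite lev_mono // (leq_ltn_trans ib).
have Wr s : (s < n)%N -> 0 <= (W s)%:~R :> rat by move=> sn; rewrite ler0z W_ge0.
have lam0 : 0 <= q ^+ lev j b by rewrite exprn_ge0 // ltW.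
have step : (G a)%:~R + q ^+ lev j b * \sum_(s < n | (h s < b.+1)%N) (W s)%:~R <=
    \sum_(s < n | (h s < b.+1)%N)
      (W s)%:~R * (rho * (q ^+ lev j (h s) - q ^+ lev j b / r)).
  have [a0|a0] := posnP a.
    rewrite -[leRHS]add0r lerD ?a0 ?lerz0 // mulr_sumr.
    apply: ler_sum => s hs.
    by rewrite (below (h s)) ?a0 // rhoK mulrC.
  have -> : a = a.-1.+1 by rewrite prednK.
  have am : (a.-1 < m)%N by lia.
  have jump : r * q ^+ lev j b <= q ^+ lev j a.-1.
    rewrite /r -exprD ler_weXn2l ?q_ge1 // addnC; apply: snap_gap.
    rewrite ltnNge; apply/negP => /amin; lia.
  apply: le_trans (lerD (IH a.-1 _ am) (lexx _)) _; first lia.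
  rewrite prednK // mulr_sumr big_mkcond [X in _ + X <= _]big_mkcond.
  rewrite [X in _ <= X]big_mkcond -big_split /=; apply: ler_sum => s _ /=.
  case: ifP => ha; last first.
    case: ifP => hb; rewrite ?addr0 // add0r below ?rhoK 1?mulrC //.
    by rewrite leqNgt ha.
  have -> : (h s < b.+1)%N by apply: leq_trans ha _; lia.
  rewrite [q ^+ lev j b * _]mulrC -mulrDr ler_wpM2l ?Wr //.
  (* Write lam and lam' for the powers of q at the levels of [b] and [a - 1]. By [rhoK] the new term
     is rho (lam - lam / r), so what remains is lam <= lam' / r; this is [jump]. *)
  rewrite -[X in _ + X](rhoK (q ^+ lev j b)) -mulrDr ler_wpM2l //.
    by rewrite /rho divr_ge0 // ?subr_ge0 ltW // (lt_trans _ r_gt1).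
  rewrite addrA lerD2r -addrA gerDl addrC subr_le0.
  by rewrite ler_pdivlMr ?(lt_trans _ r_gt1) // mulrC.
apply: le_trans step; rewrite -la.
have := GS lab bm; rewrite -(ler_int rat) rmorphD rmorphM rmorph_sum /=.
move/le_trans; apply; rewrite lerD2l ler_wpM2r ?K_le_lev //.
by apply: sumr_ge0 => s _; apply: Wr.
Qed.

Lemma chain_bound : (0 < m)%N ->
  (G m)%:~R <= q ^+ N.+1 *
    \sum_(s < n | (h s < m)%N) (W s)%:~R * (K (h s))%:~R.
Proof.
move=> m0; have Nr : 0 < N%:R :> rat by rewrite ltr0n.
have rho0 : 0 <= rho by rewrite /rho divr_ge0 // ?subr_ge0 ltW // (lt_trans _ r_gt1).
have Gj (j : 'I_N) : (G m)%:~R <= \sum_(s < n | (h s < m)%N)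
      (W s)%:~R * (rho * q ^+ lev j (h s)).
  have := @chain_shift j m.-1; rewrite prednK // => /(_ (leqnn _)).
  move/le_trans; apply; apply: ler_sum => s _.
  rewrite ler_wpM2l ?ler0z ?W_ge0 // ler_wpM2l // gerBl.
  by rewrite divr_ge0 ?exprn_ge0 // ltW // (lt_trans _ r_gt1).
rewrite -(ler_pM2l Nr); apply: (@le_trans _ _ (\sum_(j < N) (G m)%:~R)).
  by rewrite sumr_const card_ord -[X in _ <= X]mulr_natl.
apply: le_trans (ler_sum _ (fun j _ => Gj j)) _.
rewrite exchange_big /= mulrA mulr_sumr; apply: ler_sum => s hs.
rewrite -mulr_sumr -mulr_sumr sum_snap [leRHS]mulrCA.
rewrite ler_wpM2l ?ler0z ?W_ge0 //.
(* The choice q - 1 = 1/N turns the geometric sum into N (r - 1), and r - 1 cancels the denominator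
   of [rho]. *)
have Sq : \sum_(j < N) q ^+ j = N%:R * (r - 1).
  have := subrX1 q N; rewrite -/r => ->.
  have -> : q - 1 = N%:R^-1 by rewrite /q; ring.
  by rewrite mulrA divff ?mul1r ?gt_eqF.
have := power_above_le (K_ge1 hs).
set x := q ^+ _; set k : rat := (K (h s))%:~R => xk.
have -> : rho * (x * \sum_(j < N) q ^+ j) = N%:R * (r * x).
  rewrite Sq /rho; field.
  by rewrite subr_eq0 gt_eqF.
by rewrite -mulrA ler_pM2l // exprSr -/r -mulrA ler_pM2l // (lt_trans _ r_gt1).
Qed.

End Chain.

End Averaging.

(* 27185 / 10000 is a quarter of the approximation ratio.                     *)
Lemma chain_bound_euler m n (K W : nat -> int) (h : nat -> nat) (G : nat -> int) :
  (forall i, (i < m)%N -> 1 <= K i) ->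
  (forall i j, (i <= j)%N -> (j < m)%N -> K j <= K i) ->
  (forall s, (s < n)%N -> 0 <= W s) ->
  G 0%N <= 0 ->
  (forall a b, (a <= b)%N -> (b < m)%N ->
     G b.+1 <= G a + K a * \sum_(s < n | (h s < b.+1)%N) W s) ->
  exists2 c : rat, c <= 27185%:R / 10000%:R &
    0 <= c /\ (G m)%:~R <= c * \sum_(s < n | (h s < m)%N) (W s * K (h s))%:~R.
Proof.
move=> K1 Km W0 G0 GS; have [N N0 qN] := euler_bound rat.
exists ((1 + N%:R^-1) ^+ N.+1); first exact: qN.
clear qN; split; first by rewrite exprn_ge0 // addr_ge0 // invr_ge0.
have [->|m0] := posnP m.
  rewrite big_pred0; last by move=> s; rewrite ltn0.
  by rewrite mulr0 lerz0.
have := chain_bound N0 K1 Km W0 G0 GS m0.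
by under eq_bigr do rewrite -intrM.
Qed.

(** * The primal-dual order *)

Section PrimalDual.

Variables (R : realDomainType) (N m g : nat) (P W : nat -> int).
Variables (inc mem : nat -> nat -> bool).
Hypotheses (mgN : (m + g <= N)%N)
  (P_gt0 : forall e, (e < m)%N -> 0 < P e)
  (W_ge0 : forall s, 0 <= W s)
  (W_eq0 : forall s, (g <= s)%N -> W s = 0)
  (inc_ex : forall e, (e < m)%N -> exists2 v, (v < N)%N & inc e v).

Definition alive (os : seq nat) (e : nat) : bool := (e < m)%N && (e \notin os).

Definition load (os : seq nat) (v : nat) : int :=
  \sum_(e < N | alive os e && inc e v) P e.

Definition top (os : seq nat) : int := \big[Num.max/0]_(v < N) load os v.

(** Dominates every load and every rate of payment; the 1 keeps its powers nondecreasing even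
    without jobs. *)
Definition tot : int := 1 + \sum_(e < N | (e < m)%N) P e.

(** Equals [size os] as long as no job of the group has been removed; then [take (hit os s) os] is
    [os] itself and the charge follows the current load. *)
Definition hit (os : seq nat) (s : nat) : nat := find (mem s) os.

Lemma P_ge0 e : (e < m)%N -> 0 <= P e.
Proof. by move/P_gt0/ltW. Qed.

Lemma sum_P_le (A B : pred nat) : (forall e, A e -> B e) ->
  (forall e, B e -> (e < m)%N) -> \sum_(e < N | A e) P e <= \sum_(e < N | B e) P e.
Proof.
move=> AB Bm; rewrite big_mkcond [leRHS]big_mkcond; apply: ler_sum => e _.
have := AB e; case: (A e) => [->//|_]; by case: ifP => // /Bm /P_ge0.
Qed.

Lemma load_ge0 os v : 0 <= load os v.
Proof. by apply: sumr_ge0 => e /andP[/andP[/P_ge0]]. Qed.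

Lemma load_sub os os' v : {subset os <= os'} -> load os' v <= load os v.
Proof.
move=> sub; apply: (@sum_P_le [pred e | alive os' e && inc e v]
  [pred e | alive os e && inc e v]) => e /=; last by case/andP=> /andP[].
rewrite /alive => /andP[/andP[-> eo] ->]; rewrite andbT /=.
by apply: contra eo; apply: sub.
Qed.

Lemma load_le_top os v : (v < N)%N -> load os v <= top os.
Proof.
move=> vN; rewrite /top (bigD1 (Ordinal vN)) //= le_max lexx //.
Qed.

Lemma top_le os c : 0 <= c -> (forall v, (v < N)%N -> load os v <= c) -> top os <= c.
Proof.
move=> c0 lc; rewrite /top; elim/big_ind: _ => // [x y xc yc|v _].
  by rewrite ge_max xc.
exact: lc.
Qed.

Lemma top_ge0 os : 0 <= top os.
Proof.
rewrite /top; elim/big_ind: _ => // [x y xc yc|v _]; last exact: load_ge0.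
by rewrite le_max xc.
Qed.

Lemma top_sub os os' : {subset os <= os'} -> top os' <= top os.
Proof.
move=> sub; apply: top_le => [|v vN]; first exact: top_ge0.
exact: le_trans (load_sub _ sub) (load_le_top _ vN).
Qed.

Lemma top_argmax os v : (v < N)%N ->
  (forall v', (v' < N)%N -> load os v' <= load os v) -> top os = load os v.
Proof.
move=> vN vmax; apply/le_anti; rewrite load_le_top // top_le // load_ge0 //.
Qed.

Lemma top_gt0 os e : alive os e -> 0 < top os.
Proof.
move=> ae; have /andP[em _] := ae; have [v vN ev] := inc_ex em.
apply: lt_le_trans (load_le_top os vN); rewrite /load.
have eN : (e < N)%N by apply: leq_trans em _; lia.
rewrite (bigD1 (Ordinal eN)) /= ?ae ?ev //.
apply: ltr_wpDr (P_gt0 em).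
by apply: sumr_ge0 => i /andP[/andP[/andP[/P_ge0]]].
Qed.

(* [C] and [Cg] stand for the completion times of the jobs and of the groups  *)
(* in an arbitrary schedule.                                                  *)
Definition completions (C Cg : nat -> R) : Prop :=
  [/\ forall v (A : pred nat), (forall e, A e -> (e < m)%N && inc e v) ->
        (\sum_(e < N | A e) P e)%:~R ^+ 2 <=
        2 * \sum_(e < N | A e) (P e)%:~R * C e,
      forall s e, (s < g)%N -> (e < m)%N -> mem s e -> C e <= Cg s &
      forall s, 0 <= Cg s].

(* [rw s] is the residual weight of the group [s], multiplied by [k]; what    *)
(* has been paid so far is charged at the current maximal load, as long as no *)
(* job of the group has been removed, and at the load just before the first   *)
(* removal otherwise.  Each step before the end removes a job or exhausts a   *)
(* group, hence [pd_prog].                                                    *)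
Record pd_inv (t : nat) (os : seq nat) (rw : nat -> int) : Prop := PdInv {
  pd_uniq : uniq os;
  pd_lt : forall e, e \in os -> (e < m)%N;
  pd_ge0 : forall s, 0 <= rw s;
  pd_le : forall s, rw s <= W s * tot ^+ t;
  pd_hit : forall s e, e \in os -> mem s e -> rw s = 0;
  pd_prog : size os = m \/
    (m - size os + \sum_(s < N) (0 < rw s)%R + t <= m + g)%N;
  pd_dual : forall C Cg, completions C Cg -> exists2 k : int, 0 < k &
    (forall s, rw s <= k * W s) /\
    \sum_(s < N) ((k * W s - rw s) * top (take (hit os s) os))%:~R <=
    2 * \sum_(s < N) (k * W s - rw s)%:~R * Cg s }.

Lemma tot_ge1 : 1 <= tot.
Proof. by rewrite lerDl sumr_ge0 // => e /P_ge0. Qed.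

Lemma pd_start : pd_inv 0 [::] W.
Proof.
split=> //.
- by move=> s; rewrite expr0 mulr1.
- right; rewrite subn0 addn0 leq_add2l.
  apply: (@leq_trans (\sum_(s < N | (s < g)%N) 1)%N).
    rewrite [leqRHS]big_mkcond; apply: leq_sum => s _.
    by case: (ltnP s g) => sg; rewrite ?leq_b1 ?W_eq0.
  have gN : (g <= N)%N by lia.
  by rewrite -(big_ord_widen N (fun=> 1%N) gN) sum_nat_const card_ord muln1.
- move=> C Cg _; exists 1 => //; split=> [s|]; first by rewrite mul1r.
  by rewrite !big1 ?mulr0 // => s _; rewrite mul1r subrr mul0r.
Qed.

Lemma tot_gt0 : 0 < tot.
Proof. exact: lt_le_trans tot_ge1. Qed.

Lemma pd_leS t rw : (forall s, rw s <= W s * tot ^+ t) ->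
  forall s, rw s <= W s * tot ^+ t.+1.
Proof.
move=> rwt s; apply: le_trans (rwt s) _; rewrite ler_wpM2l //.
by rewrite ler_weXn2l // tot_ge1.
Qed.

Lemma pd_eq0 t os rw s : pd_inv t os rw -> (g <= s)%N -> rw s = 0.
Proof.
move=> I gs; apply/le_anti; rewrite (pd_ge0 I) andbT.
by have := pd_le I s; rewrite W_eq0 // mul0r.
Qed.

Lemma size_lt os : uniq os -> (forall e, e \in os -> (e < m)%N) ->
  (size os <= m)%N.
Proof.
move=> uos os_lt; rewrite -[leqRHS](size_iota 0).
by apply: uniq_leq_size => // e eo; rewrite mem_iota add0n os_lt.
Qed.

Lemma pd_size t os rw : pd_inv t os rw -> (size os <= m)%N.
Proof. by move=> I; apply: size_lt (pd_uniq I) (pd_lt I). Qed.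

Lemma all_removed os e : uniq os -> (forall e, e \in os -> (e < m)%N) ->
  size os = m -> alive os e = false.
Proof.
move=> uos os_lt sz; apply/negP => /andP[em eo].
have : (size (e :: os) <= m)%N.
  apply: size_lt => [|i]; first by rewrite /= eo.
  by rewrite inE => /predU1P[->//|/os_lt].
by rewrite /= sz ltnn.
Qed.

(** The main loop has a fixed number of rounds; once all jobs are removed, the remaining rounds only
    weaken the bound on the residual weights. *)
Lemma pd_idle t os rw : pd_inv t os rw -> (forall e, ~~ alive os e) ->
  pd_inv t.+1 os rw.
Proof.
move=> I dead; case: (I) => uos os_lt ge0 le hit0 prog dual.
split=> //; first exact: pd_leS.
left; apply/eqP; rewrite eqn_leq (pd_size I) /=.
rewrite -[leqLHS](size_iota 0); apply: uniq_leq_size; first exact: iota_uniq.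
move=> e; rewrite mem_iota /= => em; have := dead e.
by rewrite /alive em negbK.
Qed.

(** A removal never raises a charge: it is frozen if the group was hit before, stays at the load
    before the removal if [e] is its first removed job, and follows the decreasing load
    otherwise. *)
Lemma hit_rcons os e s :
  top (take (hit (rcons os e) s) (rcons os e)) <= top (take (hit os s) os).
Proof.
rewrite /hit -cats1 find_cat; case: ifP => ho.
  by rewrite take_cat -has_find ho.
have -> : find (mem s) os = size os.
  by apply/eqP; rewrite eqn_leq find_size leqNgt -has_find ho.
rewrite take_size take_cat ltnNge leq_addr /= addKn.
by apply: top_sub => i io; rewrite mem_cat io.
Qed.

Lemma pd_remove t os rw e : pd_inv t os rw -> alive os e ->
  (forall s, (s < N)%N -> mem s e -> rw s = 0) -> pd_inv t.+1 (rcons os e) rw.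
Proof.
move=> I /andP[em eo] dry; case: (I) => uos os_lt ge0 le hit0 prog dual.
have lt' i : i \in rcons os e -> (i < m)%N.
  by rewrite mem_rcons inE => /predU1P[->|/os_lt].
have u' : uniq (rcons os e) by rewrite rcons_uniq eo.
split=> //.
- exact: pd_leS.
- move=> s i; rewrite mem_rcons inE => /predU1P[->|io]; last exact: hit0.
  by case: (ltnP s N) => [/dry//|Ns] _; apply: pd_eq0 I _; lia.
- have := size_lt u' lt'; rewrite size_rcons.
  by case: prog => [->|]; [rewrite ltnn | right; lia].
- move=> C Cg CC; have [k k0 [rwk H]] := dual C Cg CC.
  exists k => //; split=> //; apply: le_trans H; apply: ler_sum => s _.
  by rewrite ler_int ler_wpM2l ?subr_ge0 // hit_rcons.
Qed.

Section Payment.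

Variables (t : nat) (os : seq nat) (rw : nat -> int) (v b : nat).
Variable (pay : nat -> nat).
Let rate (s : nat) : int :=
  \sum_(e < N | alive os e && inc e v && (pay e == s)) P e.
Hypotheses (I : pd_inv t os rw)
  (topv : top os = load os v)
  (payP : forall e, alive os e -> inc e v ->
     [/\ (pay e < N)%N, mem (pay e) e & 0 < rw (pay e)])
  (bN : (b < N)%N) (rate_b : 0 < rate b)
  (b_min : forall s, (s < N)%N -> 0 < rate s ->
     rw b * rate s <= rw s * rate b).

Let rate_ge0 s : 0 <= rate s.
Proof. by apply: sumr_ge0 => e /andP[/andP[/andP[/P_ge0]]]. Qed.

Let rate_gt0 s : 0 < rate s -> 0 < rw s.
Proof.
move=> r0; have [e /andP[/andP[ae ie] /eqP <-]|none] :=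
  pickP [pred e : 'I_N | alive os e && inc e v && (pay e == s)].
  by have [] := payP ae ie.
by rewrite /rate big_pred0 // ltxx in r0.
Qed.

Let rate_eq0 s : rw s = 0 -> rate s = 0.
Proof.
move=> rw0; apply/eqP; rewrite eq_le rate_ge0 andbT leNgt.
by apply/negP => /rate_gt0; rewrite rw0 ltxx.
Qed.

Let rate_le s : rate s <= tot.
Proof.
apply: (@le_trans _ _ (\sum_(e < N | (e < m)%N) P e)); last by rewrite lerDr.
apply: (@sum_P_le [pred e | alive os e && inc e v && (pay e == s)]
   [pred e | e < m]%N) => e //=.
by case/andP=> /andP[/andP[]].
Qed.

Let sum_rate (F : nat -> R) :
  \sum_(s < N) (rate s)%:~R * F s =
  \sum_(e < N | alive os e && inc e v) (P e)%:~R * F (pay e).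
Proof.
rewrite (eq_bigr (fun s : 'I_N => \sum_(e < N | alive os e && inc e v)
    (if pay e == s then (P e)%:~R * F (pay e) else 0))); last first.
  move=> s _; rewrite /rate rmorph_sum mulr_suml /= -big_mkcondr.
  by apply: eq_bigr => e /andP[_ /eqP <-].
rewrite exchange_big /=; apply: eq_bigr => e /andP[ae ie].
have [pN _ _] := payP ae ie.
rewrite (bigD1 (Ordinal pN)) //= eqxx big1 ?addr0 // => s sp.
by case: eqP => // ps; case/eqP: sp; apply/val_inj.
Qed.

Let sum_rate1 : \sum_(s < N) rate s = top os.
Proof.
have := sum_rate (fun=> 1); under eq_bigr do rewrite mulr1.
under [RHS]eq_bigr do rewrite mulr1.
rewrite -!rmorph_sum /= topv => /eqP; rewrite eqr_int => /eqP ->.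
by [].
Qed.

(** Multiplying through by [rate b] avoids division. The newly paid weight is rw(b) rate(s) for each
    [s]; the rates add up to the load L, so its charge is rw(b) L^2, and the load inequality at [v]
    pays for it, each job being covered by the group it charges. Minimality of the ratio at [b]
    keeps the residual weights nonnegative, and [b] is exhausted. *)
Lemma pd_pay : pd_inv t.+1 os (fun s => rw s * rate b - rw b * rate s).
Proof.
case: (I) => uos os_lt ge0 le hit0 prog dual.
have rate0 s : (N <= s)%N -> rate s = 0.
  by move=> Ns; apply: rate_eq0; apply: pd_eq0 I _; lia.
have ge0' s : 0 <= rw s * rate b - rw b * rate s.
  rewrite subr_ge0; case: (ltnP s N) => [sN|Ns].
    have := rate_ge0 s; rewrite le0r => /predU1P[->|/b_min]; last exact.
    by rewrite mulr0 mulr_ge0 ?rate_ge0.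
  by rewrite rate0 // mulr0 mulr_ge0 ?rate_ge0.
split=> //.
- move=> s; apply: (@le_trans _ _ (rw s * rate b)).
    by rewrite gerBl mulr_ge0 ?rate_ge0.
  by rewrite exprSr mulrA ler_pM ?rate_ge0 ?rate_le.
- move=> s e eo se; have rs0 := hit0 s e eo se.
  by rewrite rs0 (rate_eq0 rs0) mulr0 mul0r subrr.
- case: prog => [->|prog]; [by left | right].
  rewrite addnS -addSn -addnS; apply: leq_trans prog.
  rewrite leq_add2r leq_add2l (bigD1 (Ordinal bN)) //=.
  rewrite [ltnRHS](bigD1 (Ordinal bN)) //= subrr ltxx (rate_gt0 rate_b) ltnS.
  apply: leq_sum => s _; case: (ltrP 0 (rw s)) => [|rs]; first by rewrite leq_b1.
  have rs0 : rw s = 0 by apply/le_anti; rewrite rs ge0.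
  by rewrite rs0 (rate_eq0 rs0) mulr0 mul0r subrr.
- move=> C Cg CC; have [k k0 [rwk H]] := dual C Cg CC.
  exists (k * rate b); first exact: mulr_gt0.
  split=> [s|].
    apply: (@le_trans _ _ (rw s * rate b)).
      by rewrite gerBl mulr_ge0 ?rate_ge0.
    by rewrite mulrAC ler_wpM2r ?rate_ge0.
  have paid s : k * rate b * W s - (rw s * rate b - rw b * rate s) =
     rate b * (k * W s - rw s) + rw b * rate s by ring.
  (* A positive rate implies a positive residual weight, hence by [pd_hit] no removed job, so the
     group is charged at the full load [top os]. *)
  have charge : rw b * top os * top os =
      \sum_(s < N) rw b * rate s * top (take (hit os s) os).
    rewrite -{1}sum_rate1 mulr_sumr mulr_suml; apply: eq_bigr => s _.
    have := rate_ge0 s; rewrite le0r => /predU1P[->|/rate_gt0 rs].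
      by rewrite !mulr0 !mul0r.
    rewrite /hit hasNfind ?take_size //; apply/hasPn => e eo.
    by apply/negP => se; rewrite (hit0 s e) ?ltxx in rs.
  have -> : \sum_(s < N) ((k * rate b * W s - (rw s * rate b - rw b * rate s))
       * top (take (hit os s) os))%:~R =
     (rate b)%:~R * (\sum_(s < N) ((k * W s - rw s) * top (take (hit os s) os))%:~R)
     + (rw b * top os * top os)%:~R :> R.
    rewrite charge [X in _ + X]rmorph_sum /= [X in X + _]mulr_sumr -big_split /=; apply: eq_bigr => s _.
    by rewrite paid -intrM -intrD mulrDl mulrA.
  have -> : \sum_(s < N) (k * rate b * W s - (rw s * rate b - rw b * rate s))%:~R
       * Cg s = (rate b)%:~R * (\sum_(s < N) (k * W s - rw s)%:~R * Cg s) +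
     (rw b)%:~R * \sum_(e < N | alive os e && inc e v) (P e)%:~R * Cg (pay e) :> R.
    rewrite -sum_rate [X in X + _]mulr_sumr [X in _ + X]mulr_sumr -big_split /=; apply: eq_bigr => s _.
    by rewrite paid intrD !intrM mulrDl !mulrA.
  rewrite mulrDr lerD //; first by rewrite mulrCA ler_wpM2l // ler0z rate_ge0.
  rewrite -mulrA intrM mulrCA ler_wpM2l ?ler0z // topv.
  have [busy CCg _] := CC.
  have := busy v [pred e | alive os e && inc e v].
  rewrite intrM -expr2 => /(_ _)/le_trans; apply.
    by move=> e /= /andP[/andP[-> _] ->].
  rewrite ler_wpM2l //; apply: ler_sum => e /andP[ae ie].
  have [_ pe rp] := payP ae ie; have /andP[em _] := ae.
  rewrite ler_wpM2l ?ler0z ?P_ge0 // CCg // ltnNge; apply/negP => gp.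
  by rewrite (pd_eq0 I gp) ltxx in rp.
Qed.

End Payment.

(** As [m + g < N], there are too many rounds for all of them to count in [pd_prog], so every job
    has been removed. A group with residual weight was then never hit and is charged at the final
    load 0, so the unpaid part costs nothing. *)
Lemma pd_final os rw : pd_inv N os rw -> (m + g < N)%N -> size os = m /\
  forall C Cg, completions C Cg ->
    \sum_(s < N) (W s * top (take (hit os s) os))%:~R <=
    2 * \sum_(s < N) (W s)%:~R * Cg s.
Proof.
move=> I mgN'; case: (I) => uos os_lt ge0 le hit0 prog dual.
have sz : size os = m by case: prog => // H; exfalso; lia.
split=> // C Cg CC; have [k k0 [rwk H]] := dual C Cg CC.
have kR : 0 < k%:~R :> R by rewrite ltr0z.
have Cg0 : forall s, 0 <= Cg s by case: CC.
rewrite -(ler_pM2l kR) mulrCA.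
apply: (@le_trans _ _ (2 * \sum_(s < N) (k * W s - rw s)%:~R * Cg s)); last first.
  rewrite ler_wpM2l // mulr_sumr; apply: ler_sum => s _.
  by rewrite mulrA -intrM ler_wpM2r // ler_int gerBl.
apply: le_trans H; rewrite mulr_sumr; apply: ler_sum => s _.
rewrite -intrM ler_int mulrA.
case: (boolP (has (mem s) os)) => [/hasP[e eo se]|ho].
  by rewrite (hit0 s e) // subr0.
rewrite /hit hasNfind // take_size.
have -> : top os = 0; last by rewrite !mulr0.
apply/le_anti; rewrite top_ge0 andbT; apply: top_le => // v _.
by rewrite /load big_pred0 // => e; rewrite all_removed.
Qed.

(** The job at position [i] is still present, and loads are integers. The rounding of loads to
    powers of q relies on this. *)
Lemma top_take_ge1 os i : uniq os -> (forall e, e \in os -> (e < m)%N) ->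
  (i < size os)%N -> 1 <= top (take i os).
Proof.
move=> uos os_lt ios; rewrite -[1]add0r lezD1.
apply: (@top_gt0 _ (nth 0%N os i)).
rewrite /alive os_lt ?mem_nth //=; move: uos.
rewrite -{1}(cat_take_drop i os) (drop_nth 0%N) // cat_uniq /=.
by case/and3P=> _; rewrite negb_or => /andP[].
Qed.

Lemma top_take_mono os i j : (i <= j)%N -> top (take j os) <= top (take i os).
Proof.
move=> ij; apply: top_sub => e; rewrite -(subnKC ij) takeD => ei.
by rewrite mem_cat ei.
Qed.

End PrimalDual.

(** * List scheduling of the blocks *)

Section ListScheduling.

Variables (N m : nat) (P : nat -> int) (U V : nat -> nat).
Hypotheses (mN : (m <= N)%N) (P_gt0 : forall e, (e < m)%N -> 0 < P e).

Definition inc (e v : nat) : bool := (U e == v) || (V e == v).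

Definition est (av : nat -> int) (e : nat) : int := Num.max (av (U e)) (av (V e)).

Definition put (f : nat -> int) (i : nat) (x : int) : nat -> int :=
  fun j => if j == i then x else f j.

Definition placed (D : seq nat) (v : nat) : int :=
  \sum_(e < N | (val e \in D) && inc e v) P e.

(* Work done at [v] before time [c], counted from the start of the block.     *)
Definition busy (D : seq nat) (av : nat -> int) (c : int) (v : nat) : int :=
  placed D v - Num.max 0 (av v - c).

(* The block [X] is scheduled greedily from [T] on. Any job still to be       *)
(* placed has had one of its two ends at work ever since, whence [bl_busy],   *)
(* and the loads of its ends are at most [d], whence [bl_le].                 *)
Record block_inv (X : pred nat) (T d : int) (D : seq nat)
    (av st : nat -> int) : Prop := BlockInv {
  bl_sub : forall e, e \in D -> X e;
  bl_ge : forall e, e \in D -> T <= st e;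
  bl_le : forall e, e \in D -> st e + P e <= T + 2 * d;
  bl_av : forall e v, e \in D -> inc e v -> st e + P e <= av v;
  bl_disj : forall e f v, e \in D -> f \in D -> e != f -> inc e v -> inc f v ->
    st e + P e <= st f \/ st f + P f <= st e;
  bl_busy : exists2 c, T <= c & forall e, X e -> e \notin D ->
    c <= est av e /\ c - T <= busy D av c (U e) + busy D av c (V e) }.

Lemma inc_U e : inc e (U e). Proof. by rewrite /inc eqxx. Qed.
Lemma inc_V e : inc e (V e). Proof. by rewrite /inc eqxx orbT. Qed.

Section Block.

Variables (X : pred nat) (T d : int).
Hypotheses (X_lt : forall e, X e -> (e < m)%N)
  (X_load : forall v, \sum_(e < N | X e && inc e v) P e <= d).

Lemma placed_cons D e v : (e < m)%N -> e \notin D ->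
  placed (e :: D) v = placed D v + (if inc e v then P e else 0).
Proof.
move=> em eD; have eN : (e < N)%N by apply: leq_trans mN.
have -> : (if inc e v then P e else 0) =
    \sum_(i < N | (val i == e) && inc i v) P i.
  rewrite big_mkcondr (big_pred1 (Ordinal eN)) //.
rewrite /placed big_mkcond [in RHS]big_mkcond [X in _ + X]big_mkcond -big_split /=.
apply: eq_bigr => i _; rewrite inE; case: eqP => [->|_] /=.
  by rewrite (negbTE eD) add0r.
by rewrite addr0.
Qed.

Lemma placed_le D v : (forall e, e \in D -> X e) -> placed D v <= d.
Proof.
move=> DX; apply: le_trans (X_load v).
apply: (@sum_P_le N m P P_gt0 [pred e | (e \in D) && inc e v]
  [pred e | X e && inc e v]) => e /= /andP[]; last by move/X_lt.
by move/DX => -> ->.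
Qed.

Lemma block_start av st :
  (forall e, X e -> av (U e) = T /\ av (V e) = T) -> block_inv X T d [::] av st.
Proof.
move=> avT; split=> //; exists T => // e /avT[aU aV] _.
rewrite /est /busy /placed aU aV !subrr maxxx.
by rewrite !big_pred0 // maxxx.
Qed.

(** Let c' be the start of [e], the earliest one possible. Until c' each waiting job has an end at
    work, so the clock of [bl_busy] can advance to c'; placing [e] from c' on adds no work before
    c'. At the two ends of [e] the work before c' plus twice [P e] is at most 2 d, which bounds its
    completion. *)
Lemma block_step D av st e : block_inv X T d D av st -> X e -> e \notin D ->
  (forall f, X f -> f \notin D -> est av e <= est av f) ->
  block_inv X T d (e :: D)
    (put (put av (U e) (est av e + P e)) (V e) (est av e + P e))
    (put st e (est av e)).
Proof.
move=> [sub ge le avl disj [c Tc bus]] Xe eD emin.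
set c' := est av e; set av' := put _ _ _.
have em := X_lt Xe; have Pe := P_gt0 em.
have [cc' ce] := bus e Xe eD.
have ave v : inc e v -> av v <= c'.
  by case/orP => /eqP <-; rewrite /c' /est le_max lexx ?orbT.
have av'E v : av' v = if inc e v then c' + P e else av v.
  rewrite /av' /put /inc (eq_sym (U e)) (eq_sym (V e)).
  by case: (v == V e); rewrite ?orbT ?orbF //; case: (v == U e).
have av_le v : av v <= av' v.
  by rewrite av'E; case: ifP => // /ave; lia.
have stD f : f \in D -> put st e c' f = st f.
  by rewrite /put; case: eqP => // -> fD; rewrite fD in eD.
have later f : X f -> f \notin D ->
    c' - T <= busy D av c' (U f) + busy D av c' (V f).
  move=> Xf fD; have [_] := bus f Xf fD; have := emin f Xf fD.
  rewrite -/c' /busy /est; lia.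
have busyE v : busy (e :: D) av' c' v = busy D av c' v.
  rewrite /busy placed_cons // av'E; case: ifP => [/ave|_]; last by rewrite addr0.
  lia.
split.
- by move=> f; rewrite inE => /predU1P[->|/sub].
- move=> f; rewrite inE => /predU1P[->|fD]; last by rewrite stD ?ge.
  by rewrite /put eqxx; apply: le_trans cc'.
- move=> f; rewrite inE => /predU1P[->|fD]; last by rewrite stD ?le.
  rewrite /put eqxx; have := later e Xe eD.
  have sub' f' : f' \in e :: D -> X f'.
    by rewrite inE => /predU1P[->|/sub].
  have := placed_le (U e) sub'; have := placed_le (V e) sub'.
  rewrite !placed_cons // inc_U inc_V /busy; lia.
- move=> f v; rewrite inE => /predU1P[->|fD] fv.
    by rewrite /put eqxx av'E fv.
  by rewrite stD //; apply: le_trans (avl _ _ fD fv) (av_le v).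
- move=> f f' v; rewrite !inE => /predU1P[->|fD] /predU1P[->|fD'] ff fv fv'.
  + by rewrite eqxx in ff.
  + right; rewrite (stD f') // /put eqxx.
    exact: le_trans (avl _ _ fD' fv') (ave _ fv).
  + left; rewrite (stD f) // /put eqxx.
    exact: le_trans (avl _ _ fD fv) (ave _ fv').
  + by rewrite !stD //; apply: disj ff fv fv'.
- exists c'; first exact: le_trans cc'.
  move=> f Xf; rewrite inE negb_or => /andP[fe fD]; split.
    apply: le_trans (emin f Xf fD) _; rewrite /est ge_max !le_max.
    by rewrite !av_le orbT.
  by rewrite !busyE later.
Qed.

End Block.

Section Backtrack.

Variables (W : nat -> int) (mem : nat -> nat -> bool) (os : seq nat).
Variables (K G : nat -> int).
Hypotheses (W_ge0 : forall s, 0 <= W s) (os_uniq : uniq os)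
  (os_size : size os = m)
  (K_ge0 : forall i, 0 <= K i)
  (K_load : forall i v, (i < m)%N ->
     load N m P inc (take i os) v <= K i).

Let h (s : nat) : nat := find (mem s) os.

Let before (b : nat) : int := \sum_(s < N | (h s < b)%N) W s.

(* The order [os] is scheduled backwards: its jobs from position [b] on are   *)
(* done before [T]. A group is completed when its job removed first is, at    *)
(* position [h s].                                                            *)
Record sched_inv (b : nat) (T : int) (st : nat -> int) : Prop := SchedInv {
  sc_T : 0 <= T;
  sc_ge : forall e, e \in drop b os -> 0 <= st e;
  sc_le : forall e, e \in drop b os -> st e + P e <= T;
  sc_disj : forall e f v, e \in drop b os -> f \in drop b os -> e != f ->
    inc e v -> inc f v -> st e + P e <= st f \/ st f + P f <= st e;
  sc_cost : exists fin : nat -> int, [/\ forall s, 0 <= fin s,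
    forall s e, e \in drop b os -> mem s e -> (b <= h s)%N ->
      st e + P e <= fin s &
    \sum_(s < N | (b <= h s)%N) W s * fin s + T * before b + 2 * G b <= 2 * G m] }.

Lemma sched_start st : sched_inv m 0 st.
Proof.
have dr : drop m os = [::] by rewrite -os_size drop_size.
split=> [|e|e|e f v|]; rewrite ?dr //; exists (fun=> 0); split=> //.
by rewrite mul0r addr0 big1 ?add0r // => s _; rewrite mulr0.
Qed.

Definition block (a b : nat) (e : nat) : bool := e \in drop a (take b os).

Lemma drop_split a b e : (a <= b)%N -> (b <= m)%N ->
  (e \in drop a os) = block a b e || (e \in drop b os).
Proof.
move=> ab bm; rewrite /block; have sb : size (take b os) = b.
  by rewrite size_takel // os_size.
rewrite -[in LHS](cat_take_drop b os) drop_cat sb.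
case: ltnP => ab'; first by rewrite mem_cat.
by rewrite [drop a (take b os)]drop_oversize ?sb // (_ : a = b) ?subnn ?drop0 //; lia.
Qed.

Lemma block_disj a b e : (a <= b)%N -> block a b e -> e \notin drop b os.
Proof.
move=> ab /mem_drop eb; have := os_uniq.
rewrite -{1}(cat_take_drop b os) cat_uniq => /and3P[_ /hasPn ne _].
by apply/negP => /ne; rewrite /= eb.
Qed.

Lemma blockP a b e : (b <= m)%N ->
  reflect (exists2 i, (a <= i < b)%N & e = nth 0%N os i) (block a b e).
Proof.
move=> bm; have sb : size (take b os) = b by rewrite size_takel // os_size.
apply: (iffP (nthP 0%N)) => [[j]|[i /andP[ai ib] ->]].
  rewrite size_drop sb nth_drop => jb <-; exists (a + j)%N; first lia.
  by rewrite nth_take //; lia.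
exists (i - a)%N; first by rewrite size_drop sb; lia.
by rewrite nth_drop nth_take subnKC.
Qed.

Lemma mem_before i s e : (i <= h s)%N -> mem s e -> e \notin take i os.
Proof.
move=> ih se; apply/negP => ei.
have : has (mem s) (take i os) by apply/hasP; exists e.
move=> hi; have si : (size (take i os) <= i)%N by rewrite size_take; case: ltnP.
have : (h s < i)%N; last by rewrite ltnNge ih.
by rewrite /h -{1}(cat_take_drop i os) find_cat hi (leq_trans _ si) // -has_find.
Qed.

(** The block takes time at most 2 K(a) and delays just the groups counted in [before b], which
    raises the cost by 2 K(a) before(b) = 2 (G(b) - G(a)). So the cost inequality passes from [b] to
    [a] without loss. *)
Lemma sched_step a b T D av st st' : (a < b)%N -> (b <= m)%N ->
  (forall e, e \in os -> (e < m)%N) ->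
  G b = G a + K a * before b ->
  sched_inv b T st ->
  block_inv (block a b) T (K a) D av st' ->
  (forall e, block a b e -> e \in D) ->
  (forall e, ~~ block a b e -> st' e = st e) ->
  sched_inv a (T + 2 * K a) st'.
Proof.
move=> ab bm os_lt Gb [T0 ge le disj [fin [fin0 finE cost]]] blk all out.
have K0 := K_ge0 a.
have old e : e \in drop b os -> st' e = st e.
  by move=> eb; apply: out; apply: contraL eb; apply: block_disj (ltnW ab).
have cases e : e \in drop a os -> e \in D \/ e \in drop b os.
  by rewrite (drop_split _ (ltnW ab) bm) => /orP[/all|]; [left|right].
split.
- lia.
- move=> e /cases[eD|eb]; last by rewrite old ?ge.
  exact: le_trans (bl_ge blk eD).
- move=> e /cases[eD|eb]; first exact: bl_le blk _ eD.
  by rewrite old //; have := le e eb; lia.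
- move=> e f v /cases[eD|eb] /cases[fD|fb] ef ev fv.
  + exact: (bl_disj blk eD fD ef ev fv).
  + right; rewrite (old f) //; exact: le_trans (le _ fb) (bl_ge blk eD).
  + left; rewrite (old e) //; exact: le_trans (le _ eb) (bl_ge blk fD).
  + by rewrite !old //; apply: disj ef ev fv.
exists (fun s => if (b <= h s)%N then fin s else T + 2 * K a); split.
- by move=> s; case: ifP => // _; lia.
- move=> s e /cases[eD|eb] se ah; case: ifP => bh.
  + have := bl_sub blk eD; rewrite /block => /mem_drop ei.
    by have := mem_before bh se; rewrite ei.
  + exact: bl_le blk _ eD.
  + by rewrite old // finE.
  + by rewrite old //; have := le e eb; lia.
- apply: le_trans cost; rewrite Gb.
  have -> : before b = before a + \sum_(s < N | (a <= h s)%N && (h s < b)%N) W s.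
    rewrite /before big_mkcond [X in _ = X + _]big_mkcond.
    rewrite [X in _ = _ + X]big_mkcond -big_split /=; apply: eq_bigr => s _.
    by case: (ltnP (h s) a); case: (ltnP (h s) b); rewrite ?addr0 ?add0r //; lia.
  have -> : \sum_(s < N | (a <= h s)%N) W s * (if (b <= h s)%N then fin s else T + 2 * K a)
     = \sum_(s < N | (b <= h s)%N) W s * fin s +
       (\sum_(s < N | (a <= h s)%N && (h s < b)%N) W s) * (T + 2 * K a).
    rewrite mulr_suml big_mkcond [X in _ = X + _]big_mkcond.
    rewrite [X in _ = _ + X]big_mkcond -big_split /=; apply: eq_bigr => s _.
    by case: (ltnP (h s) b); case: (leqP a (h s)); rewrite ?addr0 ?add0r //; lia.
  move: (\sum_(s < N | _) W s * _) (before a) (\sum_(s < N | _) W s) => x y z.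
  by lia.
Qed.

(** The jobs of the block have positions from [a] on, so all of them are present when the load
    before position [a] is measured. *)
Lemma block_load a b v : (a < m)%N -> (forall e, e \in os -> (e < m)%N) ->
  \sum_(e < N | block a b e && inc e v) P e <= K a.
Proof.
move=> am os_lt; apply: le_trans (K_load v am).
apply: (@sum_P_le N m P P_gt0 [pred e | block a b e && inc e v]
  [pred e | alive m (take a os) e && inc e v]) => e /=; last first.
  by case/andP=> /andP[].
rewrite /block /alive => /andP[eb ->]; rewrite andbT.
have eos : e \in os by apply: mem_take (mem_drop eb).
rewrite os_lt //=; apply/negP => ea.
have := take_uniq b os_uniq; rewrite -(cat_take_drop a (take b os)) cat_uniq.
case/and3P=> _ /hasPn /(_ e eb) + _; rewrite /= => /negP; apply.
case: (leqP a b) => [ab|/ltnW ba]; first by rewrite take_takel.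
by move: eb; rewrite drop_oversize // size_take os_size; case: ifP; lia.
Qed.

End Backtrack.

End ListScheduling.

(** * The program and its correctness *)

Declare Scope aexp_scope.
Delimit Scope aexp_scope with A.
Bind Scope aexp_scope with aexp.
Notation "x + y" := (Op Defs.Add x y) : aexp_scope.
Notation "x - y" := (Op Defs.Sub x y) : aexp_scope.
Notation "x * y" := (Op Defs.Mul x y) : aexp_scope.
Notation "x / y" := (Op Defs.Div x y) : aexp_scope.
Notation "t1 ;; t2" := (Then t1 t2) (at level 55, right associativity).
Notation "'# x" := (Var x) (at level 2, x at level 0, format "''#' x").

(** Conditions are expressions with values 0 and 1: conjunction is a product, and an existential
    quantifier is the sign of a sum. *)
Definition eq_e (x y : aexp) : aexp := (Lit 1 - Pos (x - y) - Pos (y - x))%A.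
Definition lt_e (x y : aexp) : aexp := Pos (y - x).
Definition not_e (x : aexp) : aexp := (Lit 1 - Pos x)%A.

(* The least index whose image under [e], a function of the variable [y], is  *)
(* positive, and the number of indices if there is none.                      *)
Definition find_e (x y : nat) (e : aexp) : aexp :=
  Sum x (not_e (Sum y (not_e (lt_e '#x '#y) * Pos e))).

Definition findn (N : nat) (p : pred nat) : nat := find p (iota 0 N).

(** * Values of the search expressions *)

Section Eval.

Variable N : nat.

Lemma eval_eq x y s : eval N (eq_e x y) s = Posz (eval N x s == eval N y s).
Proof.
rewrite /= !subr_gt0; case: (ltgtP (eval N x s)) => //= h.
Qed.

Lemma eval_lt x y s : eval N (lt_e x y) s = Posz (eval N x s < eval N y s)%R.
Proof. by rewrite /= subr_gt0. Qed.

Lemma eval_not x s : eval N (not_e x) s = Posz (~~ (0 < eval N x s)%R).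
Proof. by rewrite /=; case: ltrP. Qed.

Lemma evalS x e s : eval N (Sum x e) s = \sum_(i < N) eval N e (setv x i s).
Proof. by []. Qed.

Lemma evalM x y s : eval N (x * y) s = eval N x s * eval N y s.
Proof. by []. Qed.

Lemma evalD x y s : eval N (x + y) s = eval N x s + eval N y s.
Proof. by []. Qed.

Lemma evalP x s : eval N (Pos x) s = Posz (0 < eval N x s)%R.
Proof. by []. Qed.

Lemma evalA a x s : eval N (Arr a x) s = arr s a (absz (eval N x s)).
Proof. by []. Qed.

Lemma Posz_bool_gt0 (c : bool) : (0 < Posz c) = c.
Proof. by case: c. Qed.

Lemma Posz_boolM (c d : bool) : Posz c * Posz d = Posz (c && d).
Proof. by case: c; rewrite ?mul1r ?mul0r. Qed.

Lemma sum_gt0P (F : nat -> int) : (forall i, (i < N)%N -> 0 <= F i) ->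
  (0 < \sum_(i < N) F i) = has (fun i => 0 < F i) (iota 0 N).
Proof.
move=> F0; apply/idP/hasP => [|[i]].
  move=> S0; apply/hasP; apply: contraLR S0 => /hasPn none.
  rewrite -leNgt big1 // => i _; apply/le_anti; rewrite F0 // andbT leNgt.
  by apply: none; rewrite mem_iota /=.
rewrite mem_iota /= => iN Fi; rewrite (bigD1 (Ordinal iN)) //=.
by apply: ltr_wpDr => //; apply: sumr_ge0 => j _; apply: F0.
Qed.

Lemma eq_sum_gt0 (F F' : 'I_N -> int) : (forall i, F i = F' i) ->
  (0 < \sum_(i < N) F i) = (0 < \sum_(i < N) F' i).
Proof. by move=> FF'; under eq_bigr do rewrite FF'. Qed.

Lemma findn_le (p : pred nat) : (findn N p <= N)%N.
Proof. by rewrite /findn -{2}(size_iota 0 N) find_size. Qed.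

(** An index counts exactly when it lies strictly before the first witness, and there are as many
    such indices as the position of that witness. *)
Lemma sum_find (p : pred nat) :
  \sum_(i < N) Posz (~~ has (fun j => (j <= i)%N && p j) (iota 0 N)) =
  Posz (findn N p).
Proof.
have findE i : (i < N)%N ->
    ~~ has (fun j => (j <= i)%N && p j) (iota 0 N) = (i < findn N p)%N.
  move=> iN; apply/hasPn/idP => [none|lt j].
    rewrite ltnNge; apply/negP => fi.
    have hp : has p (iota 0 N).
      by rewrite has_find size_iota (leq_ltn_trans fi).
    have fN : (findn N p < N)%N by rewrite /findn -{2}(size_iota 0 N) -has_find.
    have := none (findn N p); rewrite mem_iota fN /= fi /=.
    move/(_ isT)/negP; apply; have := nth_find 0%N hp.
    by rewrite nth_iota.
  rewrite mem_iota /= => jN; rewrite negb_and -ltnNge.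
  case: (ltnP i j) => //= ji.
  have := @before_find _ 0%N p (iota 0 N) j (leq_ltn_trans ji lt).
  by rewrite nth_iota // => ->.
rewrite (eq_bigr (fun i : 'I_N => Posz (i < findn N p)%N)); last first.
  by move=> i _; rewrite findE.
rewrite (eq_bigr (fun i : 'I_N => if (i < findn N p)%N then 1 else 0)); last first.
  by move=> i _; case: ifP.
rewrite -big_mkcond -(big_ord_widen N (fun=> 1) (findn_le p)) sumr_const card_ord.
by rewrite pmulrn intz.
Qed.

(** The condition must not read the counting variable [x]; this is stated through values, without a
    notion of free variable, and holds by computation for the concrete expressions. *)
Lemma eval_find x y e s (p : pred nat) : x != y ->
  (forall i j, eval N e (setv y i (setv x j s)) = eval N e (setv y i s)) ->
  (forall i, (i < N)%N -> (0 < eval N e (setv y (Posz i) s)) = p i) ->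
  eval N (find_e x y e) s = Posz (findn N p).
Proof.
move=> xy indep pE; rewrite -sum_find /find_e [LHS]/=; apply: eq_bigr => i _.
rewrite -[LHS]/(eval N (not_e (Sum y (not_e (lt_e '#x '#y) * Pos e))) (setv x i s)).
rewrite eval_not; congr (Posz (nat_of_bool (~~ _))).
rewrite [X in 0 < X](_ : _ =
    \sum_(j < N) Posz ((j <= i)%N && p j)); last first.
  rewrite [LHS]/=; apply: eq_bigr => j _; rewrite indep pE // -Posz_boolM.
  congr (_ * _); rewrite -/(not_e _) -/(lt_e _ _).
  rewrite -[LHS]/(eval N (not_e (lt_e '#x '#y)) (setv y j (setv x i s))).
  rewrite eval_not eval_lt Posz_bool_gt0 /= !eqxx (negbTE xy) ltz_nat -leqNgt.
  by [].
rewrite (sum_gt0P (F := fun j => Posz ((j <= i)%N && p j))) //.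
by apply: eq_has => j; rewrite Posz_bool_gt0.
Qed.

Variant findn_spec (p : pred nat) : nat -> Prop :=
  | FindnIn k of (k < N)%N & p k : findn_spec p k
  | FindnOut of (forall j, (j < N)%N -> ~~ p j) : findn_spec p N.

Lemma findnP (p : pred nat) : findn_spec p (findn N p).
Proof.
rewrite /findn; case: (boolP (has p (iota 0 N))) => [hp|/hasPn np].
  have fN : (find p (iota 0 N) < N)%N by rewrite -{2}(size_iota 0 N) -has_find.
  by constructor=> //; have := nth_find 0%N hp; rewrite nth_iota.
rewrite hasNfind ?size_iota; last exact/hasPn.
by constructor=> j jN; apply: np; rewrite mem_iota.
Qed.

Definition minimizer (p : pred nat) (f : nat -> int) (k : nat) : bool :=
  p k && ~~ has (fun j => p j && (f j < f k)) (iota 0 N).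

Variant argmin_spec (p : pred nat) (f : nat -> int) : nat -> Prop :=
  | ArgminIn k of (k < N)%N & p k &
      (forall j, (j < N)%N -> p j -> f k <= f j) : argmin_spec p f k
  | ArgminOut of (forall j, (j < N)%N -> ~~ p j) : argmin_spec p f N.

Lemma argminP p f : argmin_spec p f (findn N (minimizer p f)).
Proof.
case: findnP => [k kN /andP[pk /hasPn kmin]|none].
  constructor=> // j jN pj; have := kmin j; rewrite mem_iota => /(_ jN).
  by rewrite pj leNgt.
constructor=> i iN; apply/negP => pi.
have [k pk kmin] := @Order.TotalTheory.arg_minP _ _ _ (Ordinal iN) (fun i => p i) f pi.
have /negP := none k (ltn_ord k); apply; rewrite /minimizer pk /=.
apply/hasPn => j; rewrite mem_iota => jN; rewrite negb_and -leNgt.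
by case: (boolP (p j)) => //= pj; apply: (kmin (Ordinal jN)).
Qed.

End Eval.

(* Arrays: the input; ends, processing times and survival flags of the jobs;  *)
(* positions in the input, weights and residual weights of the groups;        *)
(* removal order and maximal load before each removal; rates of payment;      *)
(* optimal costs of cuttings and where their last block starts; times from    *)
(* which the vertices are free, starting times and flags of the jobs          *)
(* scheduled.                                                                 *)
Notation aIn := 0%N (only parsing).
Notation aU := 1%N (only parsing).
Notation aV := 2%N (only parsing).
Notation aP := 3%N (only parsing).
Notation aAL := 4%N (only parsing).
Notation aQ := 5%N (only parsing).
Notation aW := 6%N (only parsing).
Notation aRW := 7%N (only parsing).
Notation aORD := 8%N (only parsing).
Notation aKEY := 9%N (only parsing).
Notation aRATE := 10%N (only parsing).
Notation aG := 11%N (only parsing).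
Notation aARG := 12%N (only parsing).
Notation aAV := 13%N (only parsing).
Notation aST := 14%N (only parsing).
Notation aSC := 15%N (only parsing).

Notation vN := 0%N (only parsing).
Notation vm := 1%N (only parsing).
Notation vq := 2%N (only parsing).
Notation vD := 3%N (only parsing).
Notation vE := 4%N (only parsing).
Notation vcnt := 5%N (only parsing).
Notation vk := 6%N (only parsing).
Notation vL := 7%N (only parsing).
Notation vv := 8%N (only parsing).
Notation vb := 9%N (only parsing).
Notation vr := 10%N (only parsing).
Notation vu := 11%N (only parsing).
Notation vT := 12%N (only parsing).
Notation va := 13%N (only parsing).

(** From here on each bound variable has its own number, at least 30 and apart from the program
    variables and the loop counters 20 and 21, so that nested sums cannot capture one another. *)
Definition inc_e (e v : aexp) : aexp :=
  Pos (eq_e (Arr aU e) v + eq_e (Arr aV e) v).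

(** A group is recorded as the two parts of its weight, the number of its members and the members,
    which therefore start at offset 3. *)
Definition mem_e (x y : aexp) : aexp :=
  Pos (Sum 30 (lt_e '#30 (Arr aIn (Arr aQ x + Lit 2)) *
               eq_e (Arr aIn (Arr aQ x + Lit 3 + '#30)) y)).

Definition load_e (v : aexp) : aexp :=
  Sum 31 (Arr aAL '#31 * Arr aP '#31 * inc_e '#31 v).

Definition vmax_e : aexp :=
  find_e 32 33 (not_e (Sum 34 (lt_e (load_e '#33) (load_e '#34)))).

Definition pay_e : aexp := find_e 35 36 (mem_e '#36 '#40 * Pos (Arr aRW '#36)).

Definition stuck_e : aexp :=
  find_e 37 38 (Arr aAL '#38 * inc_e '#38 '#vv *
    not_e (Sum 39 (mem_e '#39 '#38 * Pos (Arr aRW '#39)))).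

Definition rate_e (s : aexp) : aexp :=
  Sum 40 (Arr aAL '#40 * Arr aP '#40 * inc_e '#40 '#vv * eq_e pay_e s).

Definition argmin_e (x y z : nat) (p f p' f' : aexp) : aexp :=
  find_e x y (p * not_e (Sum z (p' * lt_e f' f))).

(* Ratios of residual weight to rate are compared by cross-multiplication,    *)
(* which is not of the form required by [argmin_e].                           *)
Definition ratio_e : aexp :=
  find_e 41 42 (Pos (Arr aRATE '#42) *
    not_e (Sum 43 (Pos (Arr aRATE '#43) *
      lt_e (Arr aRW '#43 * Arr aRATE '#42) (Arr aRW '#42 * Arr aRATE '#43)))).

Definition weight_e (b : aexp) : aexp :=
  Sum 44 (Arr aW '#44 *
    Pos (Sum 45 (lt_e '#45 b * mem_e '#44 (Arr aORD '#45)))).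

Definition cut_e : aexp :=
  argmin_e 46 47 48
    (lt_e '#47 ('#20 + Lit 1)) (Arr aG '#47 + Arr aKEY '#47 * '#vu)
    (lt_e '#48 ('#20 + Lit 1)) (Arr aG '#48 + Arr aKEY '#48 * '#vu).

(** The maximum of u and v as u + max(0, v - u), without a conditional. *)
Definition est_e (e : aexp) : aexp :=
  (Arr aAV (Arr aU e) + Pos (Arr aAV (Arr aV e) - Arr aAV (Arr aU e)) *
                        (Arr aAV (Arr aV e) - Arr aAV (Arr aU e)))%A.

Definition ready_e (i : nat) : aexp :=
  (not_e (lt_e '#i '#va) * lt_e '#i '#vb * not_e (Arr aSC (Arr aORD '#i)))%A.

Definition next_e : aexp :=
  argmin_e 49 50 51 (ready_e 50) (est_e (Arr aORD '#50))
                    (ready_e 51) (est_e (Arr aORD '#51)).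

Section Expressions.

Variables (N m : nat) (P W : nat -> int) (U V : nat -> nat).
Variable (mem : nat -> nat -> bool).

(** What [mem_e] computes from the raw input. The phases treat it as an abstract membership
    relation; [listedE] identifies it with the groups of the instance. *)
Definition listed (low q : nat -> int) (i e : nat) : bool :=
  0 < \sum_(j < N) Posz (Posz j < low (absz (q i + 2)))%R *
                   Posz (low (absz (q i + 3 + Posz j)) == Posz e).

Record base (a : nat -> nat -> int) : Prop := Base {
  base_U : forall e, a aU e = U e;
  base_V : forall e, a aV e = V e;
  base_P : forall e, a aP e = P e;
  base_W : forall i, a aW i = W i;
  base_mem : forall i e, listed (a aIn) (a aQ) i e = mem i e }.

Lemma eval_inc x y s (e v : nat) : base (arr s) ->
  eval N x s = e -> eval N y s = v -> eval N (inc_e x y) s = Posz (inc U V e v).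
Proof.
move=> bs xe yv; rewrite /inc_e evalP evalD !eval_eq !evalA xe yv /=.
rewrite (base_U bs) (base_V bs) /inc !eqz_nat.
by case: eqP; case: eqP.
Qed.

Lemma eval_mem x y s (i e : nat) : base (arr s) ->
  (forall j, eval N x (setv 30 j s) = i) -> (forall j, eval N y (setv 30 j s) = e) ->
  eval N (mem_e x y) s = Posz (mem i e).
Proof.
move=> bs xi ye; rewrite -(base_mem bs) /mem_e evalP evalS.
rewrite /listed; congr (Posz (nat_of_bool _)); apply: eq_sum_gt0 => j.
by rewrite evalM eval_lt eval_eq /= xi ye.
Qed.

Lemma eval_load os y s (v : nat) : base (arr s) ->
  (forall e, arr s aAL e = Posz (alive m os e)) ->
  (forall j, eval N y (setv 31 j s) = v) ->
  eval N (load_e y) s = load N m P (inc U V) os v.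
Proof.
move=> bs al yv; rewrite /load_e evalS /load [RHS]big_mkcond; apply: eq_bigr => e _.
rewrite !evalM (@eval_inc _ _ _ e v) //= al (base_P bs).
by case: alive; case: inc; rewrite ?mul1r ?mul0r ?mulr1 ?mulr0.
Qed.

Lemma eval_vmax os s : base (arr s) ->
  (forall e, arr s aAL e = Posz (alive m os e)) -> (0 < N)%N ->
  exists2 v, eval N vmax_e s = Posz v & (v < N)%N /\
    forall v', (v' < N)%N ->
      load N m P (inc U V) os v' <= load N m P (inc U V) os v.
Proof.
move=> bs al N0; pose f v := - load N m P (inc U V) os v.
exists (findn N (minimizer N predT f)).
  apply: eval_find => // i iN.
  rewrite eval_not Posz_bool_gt0 /minimizer andTb evalS; congr (~~ _).
  rewrite (eq_has (a2 := fun j => 0 < Posz (f j < f i)%R)); last first.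
    by move=> j; rewrite Posz_bool_gt0.
  rewrite -(sum_gt0P (F := fun j => Posz (f j < f i)%R)) //; apply: eq_sum_gt0 => j; rewrite eval_lt.
  by rewrite (@eval_load os _ _ i) // (@eval_load os _ _ j) // /f ltrN2.
case: argminP => [v vN _ vmin|/(_ _ N0)//]; split=> // v' /vmin.
by rewrite lerN2; apply.
Qed.

Definition payer (rw : nat -> int) (e : nat) : nat :=
  findn N (fun i => mem i e && (0 < rw i)).

Lemma eval_pay (rw : nat -> int) s (e : nat) : base (arr s) ->
  (forall i, arr s aRW i = rw i) -> var s 40 = e ->
  eval N pay_e s = Posz (payer rw e).
Proof.
move=> bs rwE ve; apply: eval_find => // i iN.
by rewrite evalM (@eval_mem _ _ _ i e) //= rwE Posz_boolM Posz_bool_gt0.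
Qed.

Definition stuck (os : seq nat) (rw : nat -> int) (v : nat) (e : nat) : bool :=
  [&& alive m os e, inc U V e v & ~~ has (fun i => mem i e && (0 < rw i)) (iota 0 N)].

Lemma eval_stuck os (rw : nat -> int) s (v : nat) : base (arr s) ->
  (forall e, arr s aAL e = Posz (alive m os e)) ->
  (forall i, arr s aRW i = rw i) -> var s vv = v ->
  eval N stuck_e s = Posz (findn N (stuck os rw v)).
Proof.
move=> bs al rwE sv; apply: eval_find => // e eN.
rewrite !evalM (@eval_inc _ _ _ e v) // evalA al eval_not evalS !Posz_boolM.
rewrite Posz_bool_gt0 /stuck -andbA; congr (_ && (_ && ~~ _)).
rewrite (eq_has (a2 := fun i => 0 < Posz (mem i e && (0 < rw i)))); last first.
  by move=> i; rewrite Posz_bool_gt0.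
rewrite -(sum_gt0P (F := fun i => Posz (mem i e && (0 < rw i)))) //.
apply: eq_sum_gt0 => i.
by rewrite evalM (@eval_mem _ _ _ i e) //= rwE Posz_boolM.
Qed.

Lemma eval_rate os (rw : nat -> int) s x (v i : nat) : base (arr s) ->
  (forall e, arr s aAL e = Posz (alive m os e)) ->
  (forall i, arr s aRW i = rw i) -> var s vv = v ->
  (forall j, eval N x (setv 40 j s) = i) ->
  eval N (rate_e x) s =
  \sum_(e < N | alive m os e && inc U V e v && (payer rw e == i)) P e.
Proof.
move=> bs al rwE sv xi; rewrite /rate_e evalS [RHS]big_mkcond.
apply: eq_bigr => e _; rewrite !evalM (@eval_inc _ _ _ e v) //.
rewrite eval_eq (@eval_pay rw _ e) // xi eqz_nat /= al (base_P bs).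
by case: alive; case: inc; case: eqP; rewrite ?mul1r ?mul0r ?mulr1 ?mulr0.
Qed.

Definition cheaper (rw rate : nat -> int) (j i : nat) : bool :=
  (0 < rate j) && (rw j * rate i < rw i * rate j).

Lemma eval_ratio (rw rate : nat -> int) s :
  (forall i, arr s aRW i = rw i) ->
  (forall i, (i < N)%N -> arr s aRATE i = rate i) ->
  eval N ratio_e s = Posz (findn N (fun i => (0 < rate i) &&
    ~~ has (fun j => cheaper rw rate j i) (iota 0 N))).
Proof.
move=> rwE rtE; apply: eval_find => // i iN.
rewrite evalM evalP evalA eval_not evalS rtE // Posz_boolM.
rewrite Posz_bool_gt0; congr (_ && ~~ _).
rewrite (eq_has (a2 := fun j => 0 < Posz (cheaper rw rate j i))); last first.
  by move=> j; rewrite Posz_bool_gt0.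
rewrite -(sum_gt0P (F := fun j => Posz (cheaper rw rate j i))) //.
apply: eq_sum_gt0 => j.
by rewrite evalM evalP eval_lt /= !rwE !rtE // Posz_boolM.
Qed.

(* Cross-multiplied comparisons of ratios with positive denominators are      *)
(* comparisons of rationals.                                                  *)
Lemma cheapestP (rw rate : nat -> int) :
  let b := findn N (fun i => (0 < rate i) &&
    ~~ has (fun j => cheaper rw rate j i) (iota 0 N)) in
  ((b < N)%N /\ 0 < rate b /\ forall i, (i < N)%N -> 0 < rate i ->
      rw b * rate i <= rw i * rate b) \/
  (b = N /\ forall i, (i < N)%N -> ~~ (0 < rate i)).
Proof.
set p := fun i => _ => /=.
case: findnP => [b bN /andP[rb /hasPn bmin]|none]; [left | right]; split=> //.
  split=> // i iN ri; have := bmin i; rewrite mem_iota => /(_ iN).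
  by rewrite /cheaper ri leNgt.
move=> i iN; apply/negP => ri.
pose f i : rat := (rw i)%:~R / (rate i)%:~R.
have [k rk kmin] := @Order.TotalTheory.arg_minP _ _ _ (Ordinal iN)
  (fun i => 0 < rate i) (fun i => f i) ri.
have /negP := none k (ltn_ord k); apply; rewrite /p rk /=.
apply/hasPn => j; rewrite mem_iota => jN; rewrite /cheaper negb_and.
case: (boolP (0 < rate j)) => //= rj; rewrite -leNgt.
have := kmin (Ordinal jN) rj; rewrite /f ler_pdivrMr ?ltr0z // mulrAC.
rewrite ler_pdivlMr ?ltr0z // -!intrM ler_int.
exact.
Qed.

Lemma eval_weight x s (b : nat) os : base (arr s) ->
  (forall i j, eval N x (setv 45 j (setv 44 i s)) = b) ->
  size os = m -> (b <= m)%N -> (m <= N)%N ->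
  (forall i, (i < m)%N -> arr s aORD i = nth 0%N os i) ->
  eval N (weight_e x) s = \sum_(i < N | (find (mem i) os < b)%N) W i.
Proof.
move=> bs xb sz bm mN ordE; rewrite /weight_e evalS [RHS]big_mkcond.
apply: eq_bigr => i _; rewrite evalM evalA evalP evalS /= (base_W bs).
have -> : (0 < \sum_(j < N) eval N (lt_e '#45 x * mem_e '#44 (Arr aORD '#45))
     (setv 45 j (setv 44 i s))) = (find (mem i) os < b)%N; last first.
  by case: ifP => _; rewrite ?mulr1 ?mulr0.
rewrite (eq_bigr (fun j : 'I_N =>
    Posz ((j < b)%N && mem i (nth 0%N os j)))); last first.
  move=> j _; rewrite evalM eval_lt xb -[eval N '#45 _]/(Posz j) ltz_nat.
  case: (ltnP j b) => jb; last by rewrite mul0r.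
  by rewrite (@eval_mem _ _ _ i (nth 0%N os j)) //= ?mul1r // => k; rewrite ordE // (leq_trans jb).
rewrite (sum_gt0P (F := fun j => Posz ((j < b)%N && mem i (nth 0%N os j)))) //.
rewrite (eq_has (a2 := fun j => (j < b)%N && mem i (nth 0%N os j))); last first.
  by move=> j; rewrite Posz_bool_gt0.
apply/hasP/idP => [[j _ /andP[jb mj]]|fb].
  apply: leq_ltn_trans jb; rewrite leqNgt; apply/negP => /(before_find 0%N).
  by rewrite mj.
exists (find (mem i) os); first by rewrite mem_iota /=; lia.
rewrite fb /=; apply: nth_find; rewrite has_find sz; lia.
Qed.

End Expressions.

(** The language has no empty statement; variable 60 serves as a sink. *)
Definition nop : stm := Assign 60 (Lit 0).

(** A search returns [N] when it fails, so ['#vN - '#vk] is positive exactly when an index was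
    found. All rates are stored before any residual weight changes, since the payers depend on the
    residual weights. *)
Definition pd_step : stm :=
  Assign vv vmax_e ;;
  Assign vL (load_e '#vv) ;;
  Assign vk stuck_e ;;
  Cond ('#vN - '#vk)
    (Store aAL '#vk (Lit 0) ;;
     Store aORD '#vcnt '#vk ;;
     Store aKEY '#vcnt '#vL ;;
     Assign vcnt ('#vcnt + Lit 1))
    (For 21 (Store aRATE '#21 (rate_e '#21)) ;;
     Assign vb ratio_e ;;
     Cond ('#vN - '#vb)
       (Assign vr (Arr aRATE '#vb) ;;
        Assign vu (Arr aRW '#vb) ;;
        For 21 (Store aRW '#21 (Arr aRW '#21 * '#vr - '#vu * Arr aRATE '#21)))
       nop).

Section Steps.

Variables (N b : nat).
Hypotheses (b_gt0 : (0 < b)%N) (N_fits : fits b N).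
Notation wp := (wp N b).

Lemma wp_assign x e v (Q : store -> Prop) s :
  eval N e s = v -> fits b v -> Q (setv x v s) -> wp (Assign x e) Q s.
Proof. by move=> <-. Qed.

Lemma wp_store a e1 e2 (j : nat) v (Q : store -> Prop) s :
  eval N e1 s = j -> eval N e2 s = v -> fits b v -> Q (seta a.+1 j v s) ->
  wp (Store a.+1 e1 e2) Q s.
Proof. by move=> ej <- fv q; rewrite /= ej. Qed.

Lemma wp_then t1 t2 (Q : store -> Prop) s :
  wp t1 (wp t2 Q) s -> wp (t1 ;; t2) Q s.
Proof. by []. Qed.

Lemma wp_cond e t1 t2 (Q : store -> Prop) s :
  (0 < eval N e s -> wp t1 Q s) -> (eval N e s <= 0 -> wp t2 Q s) ->
  wp (Cond e t1 t2) Q s.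
Proof. by move=> H1 H2 /=; case: ltrP. Qed.

(** In round [i] the cells below [i] hold new values while cell [i] is still the old one; this
    permits updates in place, as for the residual weights. *)
Lemma wp_map x a e (F : nat -> int) (Q : store -> Prop) s :
  (forall i s', (i < N)%N -> same [:: x] [:: a.+1] s s' ->
     (forall j, arr s' a.+1 j = if (j < i)%N then F j else arr s a.+1 j) ->
     eval N e (setv x i s') = F i) ->
  (forall i, (i < N)%N -> fits b (F i)) ->
  (forall s', same [:: x] [:: a.+1] s s' ->
     (forall j, arr s' a.+1 j = if (j < N)%N then F j else arr s a.+1 j) ->
     Q s') ->
  wp (For x (Store a.+1 '#x e)) Q s.
Proof.
move=> eF fF HQ.
apply: (wp_for b_gt0 N_fits (I := fun i s' =>
  forall j, arr s' a.+1 j = if (j < i)%N then F j else arr s a.+1 j)) => //.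
move=> i s' iN sm As'; apply: (wp_store (j := i) (v := F i)).
- by rewrite /= eqxx.
- exact: eF.
- exact: fF.
move=> j; rewrite arr_seta eqxx /= As' ltnS.
by case: (ltngtP j i) => // ->.
Qed.

Lemma wp_nop (Q : store -> Prop) s : Q (setv 60 0 s) -> wp nop Q s.
Proof. by move=> q; split=> //; apply: fits0. Qed.

End Steps.

Definition pd_phase : stm := For 20 pd_step.

Definition dp_step : stm :=
  Cond ('#vm - '#20)
    (Assign vu (weight_e ('#20 + Lit 1)) ;;
     Assign va cut_e ;;
     Store aARG ('#20 + Lit 1) '#va ;;
     Store aG ('#20 + Lit 1) (Arr aG '#va + Arr aKEY '#va * '#vu))
    nop.

Definition dp_phase : stm := For 20 dp_step.

Definition list_step : stm :=
  Assign vk next_e ;;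
  Cond ('#vN - '#vk)
    (Assign vu (Arr aORD '#vk) ;;
     Assign vr (est_e '#vu) ;;
     Store aST '#vu '#vr ;;
     Store aSC '#vu (Lit 1) ;;
     Assign vr ('#vr + Arr aP '#vu) ;;
     Store aAV (Arr aU '#vu) '#vr ;;
     Store aAV (Arr aV '#vu) '#vr)
    nop.

(** All vertices are made free at [vT], the end of the blocks already scheduled. Afterwards [vT]
    advances by the guaranteed length of the block, twice its load, rather than by the actual one,
    to match [sched_step]. *)
Definition bt_step : stm :=
  Cond '#vb
    (Assign va (Arr aARG '#vb) ;;
     For 21 (Store aAV '#21 '#vT) ;;
     For 21 list_step ;;
     Assign vT ('#vT + Lit 2 * Arr aKEY '#va) ;;
     Assign vb '#va)
    nop.

Definition bt_phase : stm :=
  Assign vb '#vm ;; Assign vT (Lit 0) ;; For 20 bt_step.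

Section EvalMin.

Variable N : nat.

(** [p'] and [f'] stand for [p] and [f] read at [z] instead of [y]. The compared values are required
    at eligible indices only, because the removal order is known only inside the block. *)
Lemma eval_argmin x y z p f p' f' s (pp : pred nat) (ff : nat -> int) : x != y ->
  (forall i j, eval N (p * not_e (Sum z (p' * lt_e f' f))) (setv y i (setv x j s)) =
     eval N (p * not_e (Sum z (p' * lt_e f' f))) (setv y i s)) ->
  (forall i, (i < N)%N -> eval N p (setv y (Posz i) s) = Posz (pp i)) ->
  (forall i j, (i < N)%N -> (j < N)%N ->
     eval N p' (setv z (Posz j) (setv y (Posz i) s)) = Posz (pp j) /\
     (pp j -> pp i ->
      eval N f' (setv z (Posz j) (setv y (Posz i) s)) = ff j /\
      eval N f (setv z (Posz j) (setv y (Posz i) s)) = ff i)) ->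
  eval N (argmin_e x y z p f p' f') s = Posz (findn N (minimizer N pp ff)).
Proof.
move=> xy ind pE fE; rewrite /argmin_e; apply: eval_find => // i iN.
rewrite evalM pE // eval_not evalS Posz_boolM Posz_bool_gt0 /minimizer.
case: (boolP (pp i)) => //= pi; congr (~~ _).
rewrite (eq_has (a2 := fun j => 0 < Posz (pp j && (ff j < ff i)))); last first.
  by move=> j; rewrite Posz_bool_gt0.
rewrite -(sum_gt0P (F := fun j => Posz (pp j && (ff j < ff i)))) //.
apply: eq_sum_gt0 => j; have [p'E f'E] := fE i j iN (ltn_ord j).
rewrite -[LHS]/(eval N (p' * lt_e f' f) (setv z j (setv y i s))).
rewrite evalM p'E eval_lt; case: (boolP (pp j)) => [pj|]; last by rewrite mul0r.
by have [-> ->] := f'E pj pi; rewrite mul1r.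
Qed.

Lemma eval_cut s (b : nat) : var s 20 = b ->
  eval N cut_e s = Posz (findn N (minimizer N (fun j => (j < b.+1)%N)
    (fun j => arr s aG j + arr s aKEY j * var s vu))).
Proof.
move=> s20; apply: eval_argmin => // [i iN|i j iN jN]; rewrite ?eval_lt /= ?s20.
  by rewrite -PoszD addn1 ltz_nat.
by rewrite -PoszD addn1 ltz_nat.
Qed.

Lemma eval_next s (a b : nat) (ord : nat -> nat) (done : pred nat)
    (av : nat -> int) (U V : nat -> nat) :
  var s va = a -> var s vb = b ->
  (forall i, (i < b)%N -> arr s aORD i = ord i) ->
  (forall e, arr s aSC e = Posz (done e)) ->
  (forall e, arr s aAV e = av e) ->
  (forall e, arr s aU e = U e) -> (forall e, arr s aV e = V e) ->
  eval N next_e s = Posz (findn N (minimizer N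
     (fun i => [&& (a <= i)%N, (i < b)%N & ~~ done (ord i)])
     (fun i => est U V av (ord i)))).
Proof.
move=> sa sb so sd sv sU sV.
have ready s1 k i : var s1 k = Posz i -> var s1 va = a -> var s1 vb = b ->
    arr s1 = arr s -> (i < N)%N ->
    eval N (ready_e k) s1 =
    Posz [&& (a <= i)%N, (i < b)%N & ~~ done (ord i)].
  move=> ki a1 b1 as1 iN; rewrite /ready_e !evalM !eval_not !eval_lt /= ki a1 b1 as1.
  rewrite Posz_bool_gt0 !ltz_nat !Posz_boolM -leqNgt -andbA.
  case: (ltnP i b) => ib; rewrite ?andbF // so //= sd.
  by rewrite Posz_bool_gt0.
have estE s1 k i : var s1 k = Posz i -> arr s1 = arr s -> (i < b)%N ->
    eval N (est_e (Arr aORD '#k)) s1 = est U V av (ord i).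
  move=> ki as1 ib; rewrite /= ki as1 /= so //= sU sV /= !sv /est.
  case: (ltrP 0 (av (V (ord i)) - av (U (ord i)))) => h; lia.
apply: eval_argmin => // [i iN|i j iN jN]; first exact: ready.
split; first exact: ready.
by move=> /and3P[_ jb _] /and3P[_ ib _]; split; apply: estE.
Qed.

End EvalMin.

(** * Correctness of the phases of the program *)

Section Phases.

Variables (R : realDomainType) (N b m g : nat) (P W : nat -> int).
Variables (U V : nat -> nat) (mem : nat -> nat -> bool) (D big : int).
Hypotheses (b_gt0 : (0 < b)%N) (mgN : (m + g < N)%N)
  (P_gt0 : forall e, (e < m)%N -> 0 < P e)
  (W_ge0 : forall s, 0 <= W s)
  (W_eq0 : forall s, (g <= s)%N -> W s = 0)
  (U_lt : forall e, (e < m)%N -> (U e < N)%N)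
  (V_lt : forall e, (e < m)%N -> (V e < N)%N)
  (bigP : forall z, 0 <= z -> z <= big -> fits b z)
  (N_big : Posz N <= big)
  (tot_big : (2 * Posz m + 2) * tot N m P <= big)
  (W_big : forall i t, (t <= N)%N -> W i * tot N m P ^+ t <= big).

Definition ready (s : store) : Prop :=
  [/\ base N P W U V mem (arr s), var s vN = N, var s vm = m & var s vD = D].

Lemma base_same vs xs s s' : same vs xs s s' ->
  all [pred a | a \notin xs] [:: aIn; aU; aV; aP; aQ; aW] ->
  base N P W U V mem (arr s) -> base N P W U V mem (arr s').
Proof.
move=> [_ ha] /= /and5P[a0 a1 a2 a3 /and3P[a5 a6 _]] [hU hV hP hW hm].
by split; rewrite ?ha.
Qed.

Lemma ready_same vs xs s s' : same vs xs s s' ->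
  all [pred x | x \notin vs] [:: vN; vm; vD] ->
  all [pred a | a \notin xs] [:: aIn; aU; aV; aP; aQ; aW] ->
  ready s -> ready s'.
Proof.
move=> sm /= /and4P[v0 v1 v3 _] axs [bs h0 h1 h3].
split; first exact: base_same sm axs bs.
all: by case: sm => hv _; rewrite hv.
Qed.

Lemma fits_nat_le (n : nat) : (n <= N)%N -> fits b n.
Proof. by move=> nN; apply: bigP => //; apply: le_trans N_big; rewrite lez_nat. Qed.

Lemma tot_le_big : tot N m P <= big.
Proof.
apply: le_trans tot_big; have := @tot_ge1 N m P P_gt0; nia.
Qed.

Let inv_ex e : (e < m)%N -> exists2 v, (v < N)%N & inc U V e v.
Proof. by move=> em; exists (U e); [apply: U_lt | apply: inc_U]. Qed.

Let N_fits : fits b N. Proof. exact: fits_nat_le. Qed.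
Let mgN' : (m + g <= N)%N. Proof. exact: ltnW. Qed.

Definition pd_state (t : nat) (s : store) (os : seq nat) (rw : nat -> int) : Prop :=
  pd_inv R N m g P W (inc U V) mem t os rw /\
  [/\ var s vcnt = size os,
     forall e, arr s aAL e = Posz (alive m os e),
     forall i, arr s aRW i = rw i,
     forall i, arr s aORD i = if (i < size os)%N then Posz (nth 0%N os i) else 0 &
     forall i, arr s aKEY i =
       if (i < size os)%N then top N m P (inc U V) (take i os) else 0].

Lemma top_le_tot os : top N m P (inc U V) os <= tot N m P.
Proof.
apply: top_le => [|v _]; first by apply: ltW; apply: tot_gt0.
apply: (@le_trans _ _ (\sum_(e < N | (e < m)%N) P e)); last by rewrite lerDr.
apply: (@sum_P_le N m P P_gt0 [pred e | alive m os e && inc U V e v]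
  [pred e | e < m]%N) => e //=.
by case/andP=> /andP[].
Qed.

Lemma fits_top os : fits b (top N m P (inc U V) os).
Proof.
by apply: bigP; [apply: top_ge0 | apply: le_trans (top_le_tot os) tot_le_big].
Qed.

Lemma alive_rcons os k e : alive m (rcons os k) e = (e != k) && alive m os e.
Proof. by rewrite /alive mem_rcons inE negb_or andbCA. Qed.

Lemma pd_remove_state t s os rw k : pd_state t s os rw -> alive m os k ->
  (forall i, (i < N)%N -> mem i k -> rw i = 0) ->
  pd_state t.+1 (setv vcnt (Posz (size os) + 1)
    (seta aKEY (size os) (top N m P (inc U V) os)
    (seta aORD (size os) k (seta aAL k 0 s)))) (rcons os k) rw.
Proof.
move=> [I [cnt al rwE ordE keyE]] ak dry; split.
  exact: pd_remove.
split.
- by rewrite /= size_rcons; lia.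
- move=> e; rewrite alive_rcons [LHS](_ : _ = arr (seta aAL k 0 s) aAL e) //.
  by rewrite arr_seta al eqxx; case: eqP.
- by move=> i; rewrite -rwE.
- move=> i; rewrite [LHS](_ : _ = arr (seta aORD (size os) k s) aORD i) //.
  rewrite arr_seta ordE eqxx size_rcons nth_rcons ltnS.
  by case: (ltngtP i (size os)).
- move=> i.
  rewrite [LHS](_ : _ = arr (seta aKEY (size os) (top N m P (inc U V) os) s) aKEY i) //.
  rewrite arr_seta keyE eqxx size_rcons ltnS.
  rewrite -cats1; case: (ltngtP i (size os)) => // [lt|->].
    by rewrite takel_cat // ltnW.
  by rewrite takel_cat // take_size.
Qed.

Lemma wp_pd_step t s os rw : (t < N)%N -> ready s -> pd_state t s os rw ->
  wp N b pd_step (fun s' => exists os' rw', pd_state t.+1 s' os' rw') s.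
Proof.
move=> tN [bs sN sm sD] st; case: (st) => [I [cnt al rwE ordE keyE]].
have N0 : (0 < N)%N by apply: leq_ltn_trans tN.
have [v vE [vN vmax]] := eval_vmax bs al N0.
have topv := top_argmax P_gt0 vN vmax.
have sz := pd_size I.
apply: wp_then; apply: (wp_assign vE); first exact: fits_nat_le (ltnW vN).
apply: wp_then; apply: (@wp_assign _ _ _ _ (top N m P (inc U V) os)).
- by rewrite topv; apply: (@eval_load N m P W U V mem os _ _ v).
- exact: fits_top.
apply: wp_then; apply: wp_assign.
- exact: (@eval_stuck N m P W U V mem os rw _ v).
- exact: fits_nat_le (findn_le _ _).
case: findnP => [k kN /and3P[ak kv /hasPn dry]|none].
  apply: wp_cond => [_|]; last by rewrite /= sN; lia.
  apply: wp_then; apply: (@wp_store _ _ _ _ _ k 0) => //.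
    exact: fits0.
  apply: wp_then; apply: (@wp_store _ _ _ _ _ (size os) k) => //.
    exact: fits_nat_le (ltnW kN).
  apply: wp_then; apply: (@wp_store _ _ _ _ _ (size os) (top N m P (inc U V) os)) => //.
    exact: fits_top.
  apply: (@wp_assign _ _ _ _ (Posz (size os) + 1)).
  - by rewrite /= cnt.
  - by rewrite -PoszD addn1; apply: fits_nat_le; lia.
  exists (rcons os k), rw; apply: pd_remove_state => // i iN ik.
  have := dry i; rewrite mem_iota => /(_ iN); rewrite ik /= -leNgt => rwi.
  by apply/le_anti; rewrite rwi (pd_ge0 I).
apply: wp_cond => [|_]; first by rewrite /= sN; lia.
have payP e : alive m os e -> inc U V e v ->
    [/\ (payer N mem rw e < N)%N, mem (payer N mem rw e) e & 0 < rw (payer N mem rw e)].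
  move=> ae ie; have eN : (e < N)%N by have /andP[] := ae; lia.
  have := none e eN; rewrite /stuck ae ie negbK => hp.
  have pN : (payer N mem rw e < N)%N.
    by rewrite /payer /findn -{2}(size_iota 0 N) -has_find.
  have := nth_find 0%N hp; rewrite nth_iota // add0n => /andP[].
  by split.
pose rate i := \sum_(e < N | alive m os e && inc U V e v && (payer N mem rw e == i)) P e.
have rate0 i : 0 <= rate i.
  by apply: sumr_ge0 => e /andP[/andP[/andP[/P_gt0/ltW]]].
have rate_tot i : rate i <= tot N m P.
  apply: (@le_trans _ _ (\sum_(e < N | (e < m)%N) P e)); last by rewrite lerDr.
  apply: (@sum_P_le N m P P_gt0
    [pred e | alive m os e && inc U V e v && (payer N mem rw e == i)]
    [pred e | e < m]%N) => e //=.
  by case/andP=> /andP[/andP[]].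
apply: wp_then; apply: (wp_map b_gt0 N_fits (F := rate)).
- move=> i s' iN [hv ha] _.
  apply: (@eval_rate N m P W U V mem os rw _ _ v i); rewrite /= ?ha ?hv //.
  exact: (base_same (conj hv ha) isT bs).
- move=> i _; apply: bigP => //; exact: le_trans (rate_tot i) tot_le_big.
move=> s1 [hv ha] rateE; apply: wp_then; apply: wp_assign.
- apply: (@eval_ratio N rw rate) => [i|i iN]; first by rewrite ha //= rwE.
  by rewrite rateE iN.
- exact: fits_nat_le (findn_le _ _).
have keep s2 : (forall a, a != aRATE -> arr s2 a = arr s a) ->
    var s2 vcnt = size os -> pd_state t s2 os rw.
  move=> ha2 hv2; split=> //; split=> //.
  - by move=> e; rewrite ha2.
  - by move=> e; rewrite ha2.
  - by move=> e; rewrite ha2.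
  - by move=> e; rewrite ha2.
(* If no rate is positive, no job is left at [v]; as [v] has maximal load, no job is left anywhere
   and the round is idle. *)
case: (cheapestP N rw rate) => [[kN [rk kmin]]|[-> none']]; last first.
  apply: wp_cond => [|_]; first by rewrite /= hv //= sN; lia.
  apply: wp_nop; exists os, rw.
  have [||] // := keep (setv 60 0 (setv vb N s1)).
  - by move=> a na /=; rewrite ha // inE.
  - by rewrite /= hv.
  move=> _ ?; split=> //; apply: (pd_idle P_gt0 W_ge0 I) => e.
  apply/negP => ae.
  have : 0 < top N m P (inc U V) os.
    exact: (top_gt0 mgN' P_gt0 inv_ex ae).
  rewrite topv; apply/negP; rewrite -leNgt /load big1 // => i /andP[ai ii].
  have [pN _ _] := payP i ai ii; case/negP: (none' _ pN).
  rewrite /rate (bigD1 i) /=; last by rewrite ai ii eqxx.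
  have /andP[im _] := ai.
  apply: ltr_wpDr (P_gt0 im).
  by apply: sumr_ge0 => j /andP[/andP[/andP[/andP[/P_gt0/ltW]]]].
move: kN rk kmin; set k := findn _ _ => kN rk kmin.
apply: wp_cond => [_|]; last by rewrite /= hv //= sN; lia.
apply: wp_then; apply: (@wp_assign _ _ _ _ (rate k)).
- by rewrite /= rateE kN.
- by apply: bigP => //; apply: le_trans (rate_tot _) tot_le_big.
apply: wp_then; apply: (@wp_assign _ _ _ _ (rw k)).
- by rewrite /= ha //= rwE.
- apply: bigP; first exact: (pd_ge0 I).
  by apply: le_trans (pd_le I k) _; apply: W_big; apply: ltnW.
have I' := pd_pay mgN' P_gt0 W_eq0 I topv payP kN rk kmin.
rewrite -/(rate k) in I'.
have rate_out i : (N <= i)%N -> rate i = 0.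
  move=> Ni; rewrite /rate big1 // => e /andP[/andP[ae ie] /eqP pe].
  by have [] := payP e ae ie; rewrite pe ltnNge Ni.
apply: (wp_map b_gt0 N_fits (F := fun i => rw i * rate k - rw k * rate i)).
- move=> i s' iN [hv' ha'] h.
  by rewrite /= !hv' //= h ltnn /= ha' //= rateE iN ha //= rwE.
- move=> i iN; apply: bigP; first exact: (pd_ge0 I' i).
  by apply: le_trans (pd_le I' i) _; apply: W_big.
move=> s' [hv' ha'] h; exists os, (fun i => rw i * rate k - rw k * rate i).
split; first exact: I'.
split.
- by rewrite hv' //= hv.
- by move=> e; rewrite ha' //= ha //= al.
(* The loop rewrites the cells below [N] only; beyond them residual weights and rates vanish, so old
   and new values agree. *)
- move=> i; rewrite h; case: ltnP => // Ni.
  have rwi : rw i = 0 by apply: (pd_eq0 W_eq0 I); lia.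
  by rewrite /= ha //= rwE (rate_out i) // rwi mul0r mulr0 subrr.
- by move=> i; rewrite ha' //= ha //= ordE.
- by move=> i; rewrite ha' //= ha //= keyE.
Qed.

Definition solved (os : seq nat) (s : store) : Prop :=
  [/\ uniq os /\ size os = m, forall e, e \in os -> (e < m)%N,
    forall i, (i < m)%N -> arr s aORD i = nth 0%N os i,
    forall i, (i < m)%N -> arr s aKEY i = top N m P (inc U V) (take i os) &
    forall C Cg : nat -> R, completions N m g P (inc U V) mem C Cg ->
      \sum_(i < N) (W i * top N m P (inc U V) (take (find (mem i) os) os))%:~R <=
      2 * \sum_(i < N) (W i)%:~R * Cg i].

Lemma wp_pd s (Q : store -> Prop) : ready s -> var s vcnt = 0 ->
  (forall e, arr s aAL e = Posz (e < m)%N) -> (forall i, arr s aRW i = W i) ->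
  (forall i, arr s aORD i = 0) -> (forall i, arr s aKEY i = 0) ->
  (forall s' os, same (20 :: vars_set pd_step) (arrs_set pd_step) s s' ->
     solved os s' -> Q s') ->
  wp N b pd_phase Q s.
Proof.
move=> rs s5 al rwE ordE keyE HQ.
pose I t s' := exists os rw, pd_state t s' os rw.
apply: (wp_for b_gt0 N_fits (I := I)).
- exists [::], W; split; first by apply: pd_start.
  by split=> // e; rewrite al /alive andbT.
- move=> t s' tN sm [os [rw st]].
  have sm' : same (20 :: vars_set pd_step) (arrs_set pd_step) s (setv 20 t s').
    exact: same_setv sm.
  by apply: (@wp_pd_step t _ os rw tN) => //; apply: ready_same sm' _ _ rs.
- move=> s' sm [os [rw [I' [_ _ _ ordE' keyE']]]]; apply: (HQ s' os) => //.
  have [sz dual] := pd_final mgN' P_gt0 I' mgN.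
  split=> //.
  + by split=> //; apply: pd_uniq I'.
  + exact: pd_lt I'.
  + by move=> i im; rewrite ordE' sz im.
  + by move=> i im; rewrite keyE' sz im.
Qed.

Section Solved.

Variable (os : seq nat).
Hypotheses (os_uniq : uniq os) (os_lt : forall e, e \in os -> (e < m)%N)
  (os_size : size os = m).
Hypothesis (Wt_big : (\sum_(i < N) W i) * tot N m P <= big).

Let K (i : nat) : int := top N m P (inc U V) (take i os).
Let before (k : nat) : int := \sum_(i < N | (find (mem i) os < k)%N) W i.

Lemma before_ge0 k : 0 <= before k.
Proof. by apply: sumr_ge0. Qed.

Lemma before_le k : before k <= \sum_(i < N) W i.
Proof.
by rewrite /before big_mkcond; apply: ler_sum => i _; case: ifP.
Qed.

(** The equation follows the cut recorded in [A] and prices the schedule built from it; the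
    inequality, optimality over all cuts, is what the averaging argument uses. *)
Definition chain (G : nat -> int) (A : nat -> nat) (k : nat) : Prop :=
  (G 0%N = 0) /\ forall i, (i < k)%N -> (i < m)%N ->
    [/\ (A i.+1 <= i)%N, 0 <= G i.+1,
        G i.+1 = G (A i.+1) + K (A i.+1) * before i.+1 &
        (forall a, (a <= i)%N -> G i.+1 <= G a + K a * before i.+1)].

Lemma wp_dp s (Q : store -> Prop) : ready s -> arr s aG 0 = 0 ->
  (forall i, (i < m)%N -> arr s aORD i = nth 0%N os i) ->
  (forall i, (i < m)%N -> arr s aKEY i = K i) ->
  (forall s' (G : nat -> int) (A : nat -> nat),
     same (20 :: vars_set dp_step) (arrs_set dp_step) s s' ->
     (forall i, (i <= m)%N -> arr s' aG i = G i) ->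
     (forall i, (0 < i)%N -> (i <= m)%N -> arr s' aARG i = A i) ->
     chain G A m -> Q s') ->
  wp N b dp_phase Q s.
Proof.
move=> rs G0 ordE keyE HQ.
pose I k s' := exists A : nat -> nat, chain (arr s' aG) A k /\
  forall i, (0 < i)%N -> (i <= k)%N -> (i <= m)%N -> arr s' aARG i = A i.
apply: (wp_for b_gt0 N_fits (I := I)).
- by exists (fun=> 0%N); split=> // i; case: i.
- move=> k s' kN sm [A [[G0' ch] AE]].
  have rs' : ready (setv 20 k s').
    exact: (ready_same (same_setv (k : int) (mem_head _ _) sm)).
  have [bs _ _ _] := rs'; have sm' : var s' vm = m by case: rs'.
  apply: wp_cond => [km|km]; last first.
    have mk : (m <= k)%N by move: km; rewrite /= sm' //; lia.
    apply: wp_nop; exists A; split; last first.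
      by move=> i i0 ik im; apply: AE => //; lia.
    by split=> // i ik im; apply: ch => //; lia.
  have {}km : (k < m)%N by move: km; rewrite /= sm' //; lia.
  have [hv ha] := sm.
  apply: wp_then; apply: (@wp_assign _ _ _ _ (before k.+1)).
  + apply: (eval_weight bs _ os_size km _) => [i j||i im] /=.
    * by rewrite -PoszD addn1.
    * by lia.
    * by rewrite ha // ordE.
  + apply: bigP; first exact: before_ge0.
    apply: le_trans (before_le _) _; apply: le_trans Wt_big.
    by rewrite ler_peMr ?sumr_ge0 // tot_ge1.
  apply: wp_then; apply: wp_assign.
  + by apply: (@eval_cut _ _ k).
  + exact: fits_nat_le (findn_le _ _).
  case: argminP => [a aN ak amin|/(_ k kN)]; last by rewrite ltnSn.
  have G_ge0 i : (i <= k)%N -> 0 <= arr s' aG i.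
    case: i => [|i] ik; first by rewrite G0'.
    by have [|_ ->] := ch i ik => //; lia.
  set v := arr s' aG a + K a * before k.+1.
  have v0 : 0 <= v by rewrite addr_ge0 ?G_ge0 ?mulr_ge0 ?before_ge0 ?top_ge0.
  have keyE' i : (i <= k)%N -> arr s' aKEY i = K i.
    by move=> ik; rewrite ha // keyE //; lia.
  have vmin a' : (a' <= k)%N -> v <= arr s' aG a' + K a' * before k.+1.
    move=> a'k; have := amin a'; rewrite /= !keyE' //; apply; lia.
  (* Comparison with the single block that starts at 0, whose cost is at most the total weight times
     [tot]. *)
  have v_big : v <= big.
    apply: le_trans (vmin 0%N _) _ => //; rewrite G0' add0r mulrC.
    apply: le_trans Wt_big; apply: ler_pM; rewrite ?before_ge0 ?top_ge0 //.
      exact: before_le.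
    exact: top_le_tot.
  apply: wp_then; apply: (@wp_store _ _ _ _ _ k.+1 (Posz a)).
  + by rewrite /= -PoszD addn1.
  + by [].
  + by apply: fits_nat_le; lia.
  apply: (@wp_store _ _ _ _ _ k.+1 v).
  + by rewrite /= -PoszD addn1.
  + by rewrite /= keyE'.
  + exact: bigP.
  exists (fun i => if i == k.+1 then a else A i).
  have GE i : arr (seta aG k.+1 v (seta aARG k.+1 a (setv va a
      (setv vu (before k.+1) (setv 20 k s'))))) aG i =
      if i == k.+1 then v else arr s' aG i by [].
  split; last first.
    move=> i i0 ik im; rewrite [LHS]/=; case: eqP => // ne.
    by apply: AE => //; lia.
  split; first by rewrite GE.
  move=> i ik im; rewrite !GE eqSS; case: (eqVneq i k) => [->|ne].
    rewrite !(ltn_eqF _) //; split=> //.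
    by move=> a' a'k; rewrite GE (ltn_eqF (_ : a' < k.+1)%N) // vmin.
  have ik' : (i < k)%N by rewrite ltn_neqAle ne.
  have [h1 h2 h3 h4] := ch i ik' im.
  rewrite (ltn_eqF (_ : A i.+1 < k.+1)%N); last lia.
  split=> // a' a'i; rewrite GE (ltn_eqF (_ : a' < k.+1)%N); last lia.
  exact: h4.
- move=> s' sm [A [[G0' ch] AE]]; apply: (HQ s' (arr s' aG) A) => //.
  + by move=> i i0 im; apply: AE => //; lia.
  + by split=> // i im _; apply: ch => //; lia.
Qed.

Let K_load i v : (i < m)%N -> load N m P (inc U V) (take i os) v <= K i.
Proof.
move=> _; case: (ltnP v N) => [|Nv]; first exact: load_le_top.
rewrite /load big_pred0 ?top_ge0 // => e; apply/negP => /andP[/andP[em _]].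
by rewrite /inc => /orP[]/eqP ev; have := U_lt em; have := V_lt em; lia.
Qed.

Section OneBlock.

Variables (a k : nat) (T : int) (st0 : nat -> int).
Hypotheses (ak : (a < k)%N) (km : (k <= m)%N) (T_ge0 : 0 <= T)
  (T_big : T + 2 * K a <= big).

Let X : pred nat := block os a k.

(** Progress is measured by the length of [L]: after [c] rounds the block is exhausted or at least
    [c] of its jobs are placed. *)
Definition block_state (c : nat) (s : store) (L : seq nat) : Prop :=
  [/\ block_inv N P U V X T (K a) L (arr s aAV) (arr s aST),
      uniq L /\ ((forall e, X e -> e \in L) \/ (c <= size L)%N),
      forall e, arr s aSC e = Posz ((e \in drop k os) || (e \in L)) &
      forall e, ~~ X e -> arr s aST e = st0 e].

Let X_lt e : X e -> (e < m)%N.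
Proof. by move=> /mem_drop /mem_take /os_lt. Qed.

Lemma wp_list_step c s L : (c < N)%N -> ready s -> var s va = a -> var s vb = k ->
  (forall i, (i < m)%N -> arr s aORD i = nth 0%N os i) ->
  block_state c s L ->
  wp N b list_step (fun s' => exists L', block_state c.+1 s' L') s.
Proof.
have mN : (m <= N)%N by lia.
move=> cN [bs sN sm sD] sa sk ordE [blk [uL prog] scE outE].
have ordE' i : (i < k)%N -> arr s aORD i = nth 0%N os i by move=> ik; apply: ordE; lia.
apply: wp_then; apply: wp_assign.
- exact: (eval_next N sa sk ordE' scE (fun=> erefl) (base_U bs) (base_V bs)).
- exact: fits_nat_le (findn_le _ _).
case: argminP => [i iN /and3P[ai ik nd] imin|none]; last first.
  apply: wp_cond => [|_]; first by rewrite /= sN; lia.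
  apply: wp_nop; exists L; split=> //; split=> //; left=> e Xe.
  have /(blockP mN os_uniq os_size a e km)[i /andP[ai ik] ee] := Xe.
  have iN : (i < N)%N by lia.
  have := none i iN; rewrite ai ik /= negbK -ee => /orP[|//].
  by rewrite (negbTE (block_disj os_uniq (ltnW ak) Xe)).
apply: wp_cond => [_|]; last by rewrite /= sN; lia.
move: nd imin; set e := nth 0%N os i => nd imin.
have Xe : X e by apply/(blockP mN os_uniq os_size a e km); exists i => //; rewrite ai.
have eL : e \notin L by apply: contra nd => ->; rewrite orbT.
have em := X_lt Xe.
have emin f : X f -> f \notin L -> est U V (arr s aAV) e <= est U V (arr s aAV) f.
  move=> Xf fL; have /(blockP mN os_uniq os_size a f km)[j /andP[aj jk] fe] := Xf.
  rewrite fe; apply: imin; first lia.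
  by rewrite aj jk -fe (negbTE (block_disj os_uniq (ltnW ak) Xf)).
have am : (a < m)%N by lia.
have X_load v : \sum_(f < N | X f && inc U V f v) P f <= K a.
  exact: (block_load mN P_gt0 os_uniq os_size K_load k v am os_lt).
have blk' := block_step mN P_gt0 X_lt X_load blk Xe eL emin.
have e_in : e \in e :: L by rewrite inE eqxx.
have := bl_le blk' e_in; have := bl_ge blk' e_in.
pose x := est U V (arr s aAV) e; rewrite -/x /put eqxx => xT xP.
have Pe := P_gt0 em.
have fx : fits b x by apply: bigP; lia.
apply: wp_then; apply: (@wp_assign _ _ _ _ (Posz e)).
- by rewrite /= ordE' .
- by apply: fits_nat_le; lia.
apply: wp_then; apply: (@wp_assign _ _ _ _ x) => //.
- rewrite /= (base_U bs) (base_V bs) /= /x /est.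
  by case: (ltrP 0 (arr s aAV (V e) - arr s aAV (U e))) => h; lia.
apply: wp_then; apply: (@wp_store _ _ _ _ _ e x) => //.
apply: wp_then; apply: (@wp_store _ _ _ _ _ e 1) => //.
  by apply: fits1.
apply: wp_then; apply: (@wp_assign _ _ _ _ (x + P e)) => //.
- by rewrite /= (base_P bs).
- by apply: bigP; lia.
apply: wp_then; apply: (@wp_store _ _ _ _ _ (U e) (x + P e)) => //.
- by rewrite /= (base_U bs).
- by apply: bigP; lia.
apply: (@wp_store _ _ _ _ _ (V e) (x + P e)) => //.
- by rewrite /= (base_V bs).
- by apply: bigP; lia.
exists (e :: L); split.
- exact: blk'.
- rewrite /= eL uL; split=> //; case: prog => [all|]; [left|right] => //.
  by move=> f /all; rewrite inE => ->; rewrite orbT.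
- move=> f; rewrite [LHS](_ : _ = arr (seta aSC e 1 s) aSC f) //.
  by rewrite arr_seta scE eqxx inE; case: eqP => //=; rewrite orbT.
- move=> f nXf; rewrite [LHS](_ : _ = arr (seta aST e x s) aST f) //.
  by rewrite arr_seta outE // eqxx; case: eqP => // fe; rewrite fe Xe in nXf.
Qed.

End OneBlock.

Let mN : (m <= N)%N. Proof. by lia. Qed.

Section Backtracking.

Variables (G : nat -> int) (A : nat -> nat).
Hypothesis GA : chain G A m.

Let K_ge0 i : 0 <= K i. Proof. exact: top_ge0. Qed.

(** A round that is not idle shortens the remaining prefix by at least one job, hence [k + i <= m],
    and adds at most 2 [tot] to [T]; the resulting bound on [T] keeps all times below [big]. *)
Definition bt_state (i : nat) (s : store) : Prop :=
  exists (k : nat) (T : int),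
    [/\ var s vb = k /\ var s vT = T, (k <= m)%N /\ (k = 0%N \/ (k + i <= m)%N),
        sched_inv N m P U V W mem os G k T (arr s aST),
        T <= 2 * (Posz m - Posz k) * tot N m P &
        forall e, arr s aSC e = Posz (e \in drop k os)].

Lemma wp_bt_step i s : (i < N)%N -> ready s ->
  (forall j, (j < m)%N -> arr s aORD j = nth 0%N os j) ->
  (forall j, (j < m)%N -> arr s aKEY j = K j) ->
  (forall j, (0 < j)%N -> (j <= m)%N -> arr s aARG j = A j) ->
  bt_state i s -> wp N b bt_step (bt_state i.+1) s.
Proof.
move=> iN rs ordE keyE AE [k [T [[sb sT] [km prog] sched Tle scE]]].
have [bs sN sm sD] := rs.
apply: wp_cond => [k0|k0]; last first.
  have k0' : k = 0%N by move: k0; rewrite /= sb; lia.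
  apply: wp_nop; exists k, T; split=> //; split=> //; by left.
have {}k0 : (0 < k)%N by move: k0; rewrite /= sb.
have km1 : (k.-1 < m)%N by lia.
have [] := GA.2 k.-1 km1 km1; rewrite prednK // => Ak _ GE _.
set a := A k in Ak GE.
have ak : (a < k)%N by lia.
have T0 := sc_T sched.
have tot1 := @tot_ge1 N m P P_gt0.
have Ka : K a <= tot N m P by exact: top_le_tot.
have TK : T + 2 * K a <= 2 * (Posz m - Posz a) * tot N m P.
  have : (Posz k - Posz a) * tot N m P >= tot N m P by rewrite ler_peMl //; lia.
  by nia.
have TK_big : T + 2 * K a <= big.
  apply: le_trans TK _; apply: le_trans tot_big; apply: ler_wpM2r; lia.
have K0 := K_ge0 a.
have fT : fits b T by apply: bigP; lia.
apply: wp_then; apply: (@wp_assign _ _ _ _ (Posz a)).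
- by rewrite /= sb /= AE.
- by apply: fits_nat_le; lia.
apply: wp_then; apply: (wp_map b_gt0 N_fits (F := fun=> T)) => //.
- by move=> j s' jN [hv ha] _; rewrite /= hv.
move=> s1 [hv1 ha1] avE.
have rs1 : ready s1.
  split; rewrite ?hv1 //; exact: (base_same (conj hv1 ha1) isT bs).
have a1 : var s1 va = a by rewrite hv1.
have b1 : var s1 vb = k by rewrite hv1.
have X_lt e : block os a k e -> (e < m)%N.
  by move=> /mem_drop /mem_take /os_lt.
apply: wp_then.
apply: (wp_for b_gt0 N_fits (I := fun c s' =>
  exists L, block_state a k T (arr s aST) c s' L)).
- exists [::]; split=> //.
  + apply: block_start => e /X_lt em; rewrite !avE.
    by rewrite U_lt ?V_lt.
  + by split=> //; right.
  + by move=> e; rewrite ha1 //= scE orbF.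
  + by move=> e _; rewrite ha1.
- move=> c s' cN sm' [L st].
  have [hv ha] := sm'.
  have st' : block_state a k T (arr s aST) c (setv 21 c s') L by exact: st.
  have rs' : ready (setv 21 c s').
    by apply: ready_same (same_setv (c : int) (mem_head _ _) sm') _ _ rs1.
  have a' : var (setv 21 c s') va = a by rewrite -a1 -hv.
  have b' : var (setv 21 c s') vb = k by rewrite -b1 -hv.
  have ord' j : (j < m)%N -> arr (setv 21 c s') aORD j = nth 0%N os j.
    by move=> jm; rewrite -ordE // -[arr _ _]/(arr s' aORD) ha // ha1.
  exact: (wp_list_step ak km T0 TK_big cN rs' a' b' ord' st').
move=> s2 sm2 [L [blk [uL prog2] scE2 outE]].
have [hv2 ha2] := sm2.
(* Otherwise [L] would contain at least [N] distinct jobs, more than the [m] that exist. *)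
have all e : block os a k e -> e \in L.
  case: prog2 => [|NL]; first exact.
  have : (size L <= size (iota 0 m))%N.
    apply: uniq_leq_size => // f /(bl_sub blk) /X_lt fm.
    by rewrite mem_iota.
  by rewrite size_iota; lia.
have am : (a < m)%N by lia.
have key2 : arr s2 aKEY a = K a by rewrite ha2 //= ha1 //= keyE.
apply: wp_then; apply: (@wp_assign _ _ _ _ (T + 2 * K a)).
- by rewrite /= hv2 //= hv1 //= sT hv2 //= a1 /= key2.
- by apply: bigP => //; lia.
apply: (@wp_assign _ _ _ _ (Posz a)).
- by rewrite /= hv2.
- by apply: fits_nat_le; lia.
exists a, (T + 2 * K a); split=> //=.
- by split; [lia | case: prog; [lia | right; lia]].
- exact: (sched_step mN os_uniq os_size K_ge0 ak km os_lt GE sched blk all outE).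
- move=> e; rewrite scE2 (drop_split mN os_uniq os_size e (ltnW ak) km) orbC.
  congr (Posz (nat_of_bool (_ || _))); apply/idP/idP; last exact: all.
  exact: (bl_sub blk).
Qed.

Lemma wp_bt s (Q : store -> Prop) : ready s ->
  (forall j, (j < m)%N -> arr s aORD j = nth 0%N os j) ->
  (forall j, (j < m)%N -> arr s aKEY j = K j) ->
  (forall j, (0 < j)%N -> (j <= m)%N -> arr s aARG j = A j) ->
  (forall e, arr s aSC e = 0) ->
  (forall s' T, same [:: vb, vT, 20 & vars_set bt_step] (arrs_set bt_step) s s' ->
     T <= big -> sched_inv N m P U V W mem os G 0 T (arr s' aST) -> Q s') ->
  wp N b bt_phase Q s.
Proof.
move=> rs ordE keyE AE scE HQ; have [bs sN sm sD] := rs.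
apply: wp_then; apply: (@wp_assign _ _ _ _ (Posz m)) => //.
  exact: fits_nat_le mN.
apply: wp_then; apply: (@wp_assign _ _ _ _ 0) => //; first exact: fits0.
apply: (wp_for b_gt0 N_fits (I := bt_state)).
- exists m, 0; split=> //; first by split=> //; right; rewrite addn0.
  + exact: sched_start.
  + by rewrite subrr mulr0 mul0r.
  + by move=> e; rewrite scE -os_size drop_size.
- move=> i s' iN sm' st; have [hv ha] := sm'.
  apply: wp_bt_step => //=.
  + by apply: (ready_same (same_setv (i : int) (mem_head _ _) sm')).
  + by move=> j jm; rewrite ha //= ordE.
  + by move=> j jm; rewrite ha //= keyE.
  + by move=> j j0 jm; rewrite ha //= AE.
- move=> s' [hv ha] [k [T [_ [_ prog] sched Tle _]]].
  have k0 : k = 0%N by case: prog => //; lia.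
  rewrite k0 in sched Tle; apply: HQ sched; last first.
    apply: le_trans Tle _; apply: le_trans tot_big; apply: ler_wpM2r; last lia.
    by apply: ltW; apply: tot_gt0.
  split=> x; last exact: ha.
  rewrite 2!in_cons 2!negb_or => /and3P[x1 x2 x3].
  by rewrite hv //= (negbTE x1) (negbTE x2).
Qed.

End Backtracking.

End Solved.

End Phases.

(** * Reading the instance and writing the schedule *)

Notation in_e e := (Arr aIn e).

(** Three header numbers and the list of vertices precede the edges, each of which takes four
    numbers. *)
Definition edge_e (e : aexp) : aexp := (Lit 3 + in_e (Lit 0) + Lit 4 * e)%A.

(** The product of the denominators serves as common denominator: each of them divides it, and its
    length is polynomial in the input. *)
Definition parse_den : stm :=
  For 20 (Cond ('#vm - '#20)
    (Assign vD ('#vD * in_e (edge_e '#20 + Lit 3))) nop).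

Definition parse_edges : stm :=
  For 20 (Cond ('#vm - '#20)
    (Store aU '#20 (in_e (edge_e '#20)) ;;
     Store aV '#20 (in_e (edge_e '#20 + Lit 1)) ;;
     Store aP '#20 (in_e (edge_e '#20 + Lit 2) *
                    ('#vD / in_e (edge_e '#20 + Lit 3))) ;;
     Store aAL '#20 (Lit 1)) nop).

(** The records of the groups vary in length, so their positions are found by a scan from one to the
    next. *)
Definition parse_groups : stm :=
  For 20 (Cond (in_e (Lit 2) - '#20)
    (Store aQ '#20 '#vq ;;
     Assign vE ('#vE * in_e ('#vq + Lit 1)) ;;
     Assign vq ('#vq + Lit 3 + in_e ('#vq + Lit 2))) nop).

Definition parse_weights : stm :=
  For 20 (Cond (in_e (Lit 2) - '#20)
    (Store aW '#20 (in_e (Arr aQ '#20) * ('#vE / in_e (Arr aQ '#20 + Lit 1))) ;;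
     Store aRW '#20 (Arr aW '#20)) nop).

Definition parse_phase : stm :=
  Assign vm (in_e (Lit 1)) ;;
  Assign vD (Lit 1) ;;
  parse_den ;;
  parse_edges ;;
  Assign vq (edge_e '#vm) ;;
  Assign vE (Lit 1) ;;
  parse_groups ;;
  parse_weights.

(** The output overwrites the input zone, and all starting times share the denominator [D]. Variable
    0 is register 0, where the output length is expected. *)
Definition out_phase : stm :=
  For 20 (Cond ('#vm - '#20)
    (Store aIn (Lit 2 * '#20) (Arr aST '#20) ;;
     Store aIn (Lit 2 * '#20 + Lit 1) '#vD) nop) ;;
  Assign vN (Lit 2 * '#vm).

Definition program : stm :=
  parse_phase ;; pd_phase ;; dp_phase ;; bt_phase ;; out_phase.

Definition prod_to (f : nat -> int) (k : nat) : int := \prod_(i < k) f i.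

(** The numerator of p(i) / q(i) over the common denominator, extended by 0 so that sums may run
    over all indices below the input length. *)
Definition scaled (k : nat) (p q : nat -> int) (i : nat) : int :=
  if (i < k)%N then p i * (prod_to q k %/ q i)%Z else 0.

Lemma prod_to_ge1 f k j : (j <= k)%N -> (forall i, (i < k)%N -> 0 < f i) ->
  1 <= prod_to f j.
Proof.
move=> jk f0; rewrite /prod_to; elim/big_ind: _ => // [x y|i _]; first nia.
by have := f0 i (leq_trans (ltn_ord i) jk); lia.
Qed.

Lemma prod_to_le f k j : (j <= k)%N -> (forall i, (i < k)%N -> 0 < f i) ->
  prod_to f j <= prod_to f k.
Proof.
move=> jk; rewrite -(subnKC jk); elim: (k - j)%N => [|d IH] f0; first by rewrite addn0.
apply: le_trans (IH _) _; first by move=> i id; apply: f0; lia.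
rewrite addnS /prod_to big_ord_recr /= ler_peMr //; last first.
  by have := f0 (j + d)%N; rewrite addnS; apply.
apply: ltW; apply: lt_le_trans (prod_to_ge1 (leqnn _) _) => // i id.
by apply: f0; lia.
Qed.

Lemma prod_to_div f k i : (i < k)%N -> (forall i, (i < k)%N -> 0 < f i) ->
  (prod_to f k %/ f i)%Z * f i = prod_to f k.
Proof.
move=> ik f0; apply: divzK; rewrite /prod_to (bigD1 (Ordinal ik)) //=.
exact: dvdz_mulr.
Qed.

Lemma scaled_gt0 k p q i : (i < k)%N -> (forall i, (i < k)%N -> 0 < p i) ->
  (forall i, (i < k)%N -> 0 < q i) -> 0 < scaled k p q i.
Proof.
move=> ik p0 q0; rewrite /scaled ik mulr_gt0 ?p0 //.
have := prod_to_div ik q0; have := prod_to_ge1 (leqnn k) q0; have := q0 i ik.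
by nia.
Qed.

Lemma scaled_ge0 k p q i : (forall i, (i < k)%N -> 0 < p i) ->
  (forall i, (i < k)%N -> 0 < q i) -> 0 <= scaled k p q i.
Proof.
move=> p0 q0; case: (ltnP i k) => ik; first by apply: ltW; apply: scaled_gt0.
by rewrite /scaled ltnNge ik.
Qed.

Section Parse.

Variables (N b n m g : nat) (low : nat -> int).
Variables (U V : nat -> nat) (num den wnum wden : nat -> int) (pos card : nat -> nat).
Variable big : int.
Hypotheses (b_gt0 : (0 < b)%N) (bigP : forall z, 0 <= z -> z <= big -> fits b z)
  (N_big : Posz N <= big) (mgN : (m + g < N)%N)
  (low0 : low 0%N = n) (low1 : low 1%N = m) (low2 : low 2%N = g)
  (lowU : forall e, (e < m)%N -> low (3 + n + 4 * e)%N = U e)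
  (lowV : forall e, (e < m)%N -> low (3 + n + 4 * e + 1)%N = V e)
  (lownum : forall e, (e < m)%N -> low (3 + n + 4 * e + 2)%N = num e)
  (lowden : forall e, (e < m)%N -> low (3 + n + 4 * e + 3)%N = den e)
  (pos0 : pos 0%N = (3 + n + 4 * m)%N)
  (posS : forall i, (i < g)%N -> pos i.+1 = (pos i + 3 + card i)%N)
  (pos_le : forall i, (i <= g)%N -> (pos i <= N)%N)
  (loww : forall i, (i < g)%N -> low (pos i) = wnum i)
  (lowwd : forall i, (i < g)%N -> low (pos i + 1)%N = wden i)
  (lowc : forall i, (i < g)%N -> low (pos i + 2)%N = card i)
  (U_out : forall e, (m <= e)%N -> U e = 0%N)
  (V_out : forall e, (m <= e)%N -> V e = 0%N)
  (U_lt : forall e, (e < m)%N -> (U e < N)%N)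
  (V_lt : forall e, (e < m)%N -> (V e < N)%N)
  (num_gt0 : forall e, (e < m)%N -> 0 < num e)
  (den_gt0 : forall e, (e < m)%N -> 0 < den e)
  (wnum_gt0 : forall i, (i < g)%N -> 0 < wnum i)
  (wden_gt0 : forall i, (i < g)%N -> 0 < wden i).

Let D : int := prod_to den m.
Let E : int := prod_to wden g.
Let P : nat -> int := scaled m num den.
Let W : nat -> int := scaled g wnum wden.

Hypotheses (D_big : D <= big) (E_big : E <= big)
  (P_big : forall e, P e <= big) (W_big : forall i, W i <= big).

Definition parsed (s : store) : Prop :=
  [/\ forall e, arr s aU e = U e, forall e, arr s aV e = V e,
     forall e, arr s aP e = P e, forall e, arr s aAL e = Posz (e < m)%N &
     [/\ var s vD = D, forall i, arr s aW i = W i, forall i, arr s aRW i = W i &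
         forall i, arr s aQ i = if (i < g)%N then Posz (pos i) else 0]].

Let fits_nat_le (k : nat) : (k <= N)%N -> fits b k.
Proof. by move=> kN; apply: bigP => //; apply: le_trans N_big; rewrite lez_nat. Qed.

Let N_fits : fits b N. Proof. exact: fits_nat_le. Qed.

Lemma eval_edge x s (e : nat) : arr s aIn = low -> eval N x s = e ->
  eval N (edge_e x) s = Posz (3 + n + 4 * e)%N.
Proof. by move=> sl xe; rewrite /= sl low0 xe /=; lia. Qed.

Lemma wp_parse_den (Q : store -> Prop) s : arr s aIn = low -> var s vm = m ->
  var s vD = 1 ->
  (forall s', same (20 :: vD :: 60 :: nil) nil s s' -> var s' vD = D -> Q s') ->
  wp N b parse_den Q s.
Proof.
move=> sl sm sD HQ.
apply: (wp_for b_gt0 N_fits (I := fun k s' => var s' vD = prod_to den (minn k m))).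
- by rewrite sD min0n /prod_to big_ord0.
- move=> k s' kN [hv ha] Ds.
  apply: wp_cond => [km|km]; last first.
    have mk : (m <= k)%N by move: km; rewrite /= hv // sm; lia.
    apply: wp_nop; rewrite [LHS]/= Ds; congr prod_to; lia.
  have {}km : (k < m)%N by move: km; rewrite /= hv // sm; lia.
  have E1 : prod_to den (minn k.+1 m) = prod_to den k * den k.
    by rewrite (minn_idPl km) /prod_to big_ord_recr.
  apply: (@wp_assign _ _ _ _ (prod_to den (minn k.+1 m))) => //.
  - rewrite E1 /= ha // Ds sl low0 (minn_idPl (ltnW km)); congr (_ * _).
    by rewrite -lowden //; congr low; lia.
  - apply: bigP.
      by apply: le_trans (prod_to_ge1 _ den_gt0) => //; apply: geq_minr.
    by apply: le_trans D_big; apply: prod_to_le => //; apply: geq_minr.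
- move=> s' [hv ha] Ds; apply: HQ; first by split.
  by rewrite Ds; congr prod_to; lia.
Qed.

Lemma W_ge0 i : 0 <= W i. Proof. exact: scaled_ge0. Qed.

Lemma wp_parse_edges (Q : store -> Prop) s : arr s aIn = low -> var s vm = m ->
  var s vD = D ->
  (forall a e, a \in [:: aU; aV; aP; aAL] -> arr s a e = 0) ->
  (forall s', same [:: 20; 60] [:: aU; aV; aP; aAL] s s' ->
     (forall e, arr s' aU e = U e) -> (forall e, arr s' aV e = V e) ->
     (forall e, arr s' aP e = P e) ->
     (forall e, arr s' aAL e = Posz (e < m)%N) -> Q s') ->
  wp N b parse_edges Q s.
Proof.
move=> sl sm sD s0 HQ.
pose I k s' := forall e, [/\ arr s' aU e = (if (e < k)%N then Posz (U e) else 0),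
  arr s' aV e = (if (e < k)%N then Posz (V e) else 0),
  arr s' aP e = (if (e < k)%N then P e else 0) &
  arr s' aAL e = (if (e < k)%N then Posz (e < m)%N else 0)].
apply: (wp_for b_gt0 N_fits (I := I)).
- by move=> e; rewrite !s0.
- move=> k s' kN [hv ha] IH.
  apply: wp_cond => [km|km]; last first.
    have mk : (m <= k)%N by move: km; rewrite /= hv // sm; lia.
    apply: wp_nop => e; have [-> -> -> ->] := IH e.
    rewrite ltnS [(e <= k)%N]leq_eqVlt; case: (eqVneq e k) => [->|_] //=.
    rewrite ltnn U_out // V_out // /P /scaled ltnNge mk.
    by [].
  have {}km : (k < m)%N by move: km; rewrite /= hv // sm; lia.
  have lE j : arr s' aIn (absz (3 + arr s' aIn 0%N + 4 * Posz k + Posz j)%R) =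
      low (3 + n + 4 * k + j)%N.
    by rewrite ha // sl low0; congr low; lia.
  have lE0 : arr s' aIn (absz (3 + arr s' aIn 0%N + 4 * Posz k)%R) = low (3 + n + 4 * k)%N.
    by rewrite -(addn0 (_ + _)%N) -lE addr0.
  apply: wp_then; apply: (@wp_store _ _ _ _ _ k (U k)) => //.
  + by rewrite /= lE0 lowU.
  + by apply: fits_nat_le; apply: ltnW; apply: U_lt.
  apply: wp_then; apply: (@wp_store _ _ _ _ _ k (V k)) => //.
  + by rewrite /= (lE 1%N) lowV.
  + by apply: fits_nat_le; apply: ltnW; apply: V_lt.
  apply: wp_then; apply: (@wp_store _ _ _ _ _ k (P k)) => //.
  + rewrite /= (lE 2%N) (lE 3%N) lownum // lowden // hv // sD.
    by rewrite /P /scaled km.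
  + by apply: bigP => //; apply: scaled_ge0.
  apply: (@wp_store _ _ _ _ _ k 1) => //; first exact: fits1.
  move=> e; have [u v p l] := IH e.
  rewrite /= u v p l ltnS [(e <= k)%N]leq_eqVlt; case: (eqVneq e k) => [->|_] //=.
  by rewrite km.
- move=> s' sm' IH; apply: HQ => //; move=> e; have [u v p l] := IH e.
  + by rewrite u; case: ltnP => // Ne; rewrite U_out //; lia.
  + by rewrite v; case: ltnP => // Ne; rewrite V_out //; lia.
  + by rewrite p; case: ltnP => // Ne; rewrite /P /scaled ltnNge (_ : m <= e)%N //; lia.
  + by rewrite l; case: ltnP => // Ne; rewrite ltnNge (_ : m <= e)%N //; lia.
Qed.

Let Qf (i : nat) : int := if (i < g)%N then Posz (pos i) else 0.

Lemma wp_parse_groups (Q : store -> Prop) s : arr s aIn = low ->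
  var s vq = pos 0%N -> var s vE = 1 -> (forall i, arr s aQ i = 0) ->
  (forall s', same [:: 20; vE; vq; 60] [:: aQ] s s' ->
     (forall i, arr s' aQ i = Qf i) -> var s' vE = E -> Q s') ->
  wp N b parse_groups Q s.
Proof.
move=> sl sq sE s0 HQ.
pose I k s' := [/\ var s' vE = prod_to wden (minn k g),
  var s' vq = pos (minn k g) &
  forall i, arr s' aQ i = if (i < k)%N then Qf i else 0].
apply: (wp_for b_gt0 N_fits (I := I)).
- by split=> //; rewrite ?min0n // sE /prod_to big_ord0.
- move=> k s' kN [hv ha] [Es qs Qs].
  apply: wp_cond => [kg|kg]; last first.
    have gk : (g <= k)%N by move: kg; rewrite /= ha // sl low2; lia.
    have mk : minn k.+1 g = minn k g by lia.
    apply: wp_nop; split; rewrite /= ?mk // => i; rewrite Qs.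
    rewrite ltnS [(i <= k)%N]leq_eqVlt; case: (eqVneq i k) => [->|_] //=.
    by rewrite ltnn /Qf ltnNge gk.
  have {}kg : (k < g)%N by move: kg; rewrite /= ha // sl low2; lia.
  have mk : minn k g = k by lia.
  have mk1 : minn k.+1 g = k.+1 by lia.
  rewrite mk in Es qs.
  have E1 : prod_to wden k.+1 = prod_to wden k * wden k.
    by rewrite /prod_to big_ord_recr.
  apply: wp_then; apply: (@wp_store _ _ _ _ _ k (pos k)) => //.
  + by apply: fits_nat_le; apply: pos_le; apply: ltnW.
  apply: wp_then; apply: (@wp_assign _ _ _ _ (prod_to wden k.+1)).
  + rewrite E1 /= Es qs ha // sl -lowwd //.
  + apply: bigP.
      by apply: le_trans (prod_to_ge1 _ wden_gt0).
    by apply: le_trans E_big; apply: prod_to_le.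
  apply: (@wp_assign _ _ _ _ (pos k.+1)).
  + rewrite /= qs ha // sl posS //= lowc //; lia.
  + by apply: fits_nat_le; apply: pos_le.
  split; rewrite /= ?mk1 // => i; rewrite Qs ltnS [(i <= k)%N]leq_eqVlt.
  by case: (eqVneq i k) => [->|_] //=; rewrite /Qf kg.
- move=> s' sm' [Es qs Qs]; apply: HQ => //; first last.
    by rewrite Es; congr prod_to; lia.
  by move=> i; rewrite Qs; case: ltnP => // Ni; rewrite /Qf ltnNge (_ : g <= i)%N //; lia.
Qed.

Lemma wp_parse_weights (Q : store -> Prop) s : arr s aIn = low ->
  (forall i, arr s aQ i = Qf i) -> var s vE = E ->
  (forall a i, a \in [:: aW; aRW] -> arr s a i = 0) ->
  (forall s', same [:: 20; 60] [:: aW; aRW] s s' ->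
     (forall i, arr s' aW i = W i) -> (forall i, arr s' aRW i = W i) -> Q s') ->
  wp N b parse_weights Q s.
Proof.
move=> sl sQ sE s0 HQ.
pose I k s' := forall i, arr s' aW i = (if (i < k)%N then W i else 0) /\
  arr s' aRW i = (if (i < k)%N then W i else 0).
apply: (wp_for b_gt0 N_fits (I := I)).
- by move=> i; rewrite !s0.
- move=> k s' kN [hv ha] IH.
  apply: wp_cond => [kg|kg]; last first.
    have gk : (g <= k)%N by move: kg; rewrite /= ha // sl low2; lia.
    apply: wp_nop => i; have [-> ->] := IH i.
    rewrite ltnS [(i <= k)%N]leq_eqVlt; case: (eqVneq i k) => [->|_] //=.
    by rewrite ltnn /W /scaled ltnNge gk.
  have {}kg : (k < g)%N by move: kg; rewrite /= ha // sl low2; lia.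
  have fW : fits b (W k) by apply: bigP => //; apply: W_ge0.
  apply: wp_then; apply: (@wp_store _ _ _ _ _ k (W k)) => //.
  + rewrite /= hv // !ha //= sl sQ sE /Qf kg /=.
    by rewrite loww // lowwd // /W /scaled kg.
  apply: (@wp_store _ _ _ _ _ k (W k)) => //; first by rewrite /= eqxx.
  move=> i; have [w r] := IH i.
  by rewrite /= w r ltnS [(i <= k)%N]leq_eqVlt; case: (eqVneq i k) => [->|_] //=.
- move=> s' sm' IH; apply: HQ => // i; have [w r] := IH i.
  + by rewrite w; case: ltnP => // Ni; rewrite /W /scaled ltnNge (_ : g <= i)%N //; lia.
  + by rewrite r; case: ltnP => // Ni; rewrite /W /scaled ltnNge (_ : g <= i)%N //; lia.
Qed.

Definition parse_vars := [:: vm; vD; 20; 60; vq; vE].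
Definition parse_arrs := [:: aU; aV; aP; aAL; aQ; aW; aRW].

Lemma wp_parse (Q : store -> Prop) s : arr s aIn = low ->
  (forall a i, a \in parse_arrs -> arr s a i = 0) ->
  (forall s', same parse_vars parse_arrs s s' -> var s' vm = m -> parsed s' -> Q s') ->
  wp N b parse_phase Q s.
Proof.
move=> sl s0 HQ.
apply: wp_then; apply: (@wp_assign _ _ _ _ (Posz m)).
- by rewrite /= sl.
- by apply: fits_nat_le; lia.
apply: wp_then; apply: (@wp_assign _ _ _ _ 1) => //; first exact: fits1.
apply: wp_then; apply: wp_parse_den => // s1 [hv1 ha1] D1.
have sl1 : arr s1 aIn = low by rewrite ha1.
have m1 : var s1 vm = m by rewrite hv1.
apply: wp_then; apply: wp_parse_edges => //.
  move=> a e ain; rewrite ha1 //= s0 //; apply: (allP _ _ ain).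
  by [].
move=> s2 [hv2 ha2] U2 V2 P2 A2.
have sl2 : arr s2 aIn = low by rewrite ha2.
have m2 : var s2 vm = m by rewrite hv2.
apply: wp_then; apply: (@wp_assign _ _ _ _ (Posz (pos 0))).
- by rewrite (@eval_edge _ _ m) // pos0.
- by apply: fits_nat_le; apply: pos_le.
apply: wp_then; apply: (@wp_assign _ _ _ _ 1) => //; first exact: fits1.
apply: wp_then; apply: wp_parse_groups => //.
  by move=> i; rewrite /= ha2 // ha1 //= s0.
move=> s3 [hv3 ha3] Q3 E3.
apply: wp_parse_weights => //.
- by rewrite ha3.
- move=> a i ain; have -> : arr s3 a = arr s a; last first.
    by apply: s0; apply: (allP _ _ ain).
  by move: ain; rewrite !inE => /orP[]/eqP ->; rewrite ha3 //= ha2 //= ha1.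
move=> s4 [hv4 ha4] W4 R4; apply: HQ.
- split=> [x|a].
    rewrite !inE !negb_or => /and5P[x1 x2 x3 x4 /andP[x5 x6]].
    rewrite hv4 ?inE ?negb_or ?x3 // hv3 ?inE ?negb_or ?x3 ?x4 ?x5 ?x6 //=.
    rewrite (negbTE x5) (negbTE x6) hv2 ?inE ?negb_or ?x3 //=.
    by rewrite hv1 ?inE ?negb_or ?x2 ?x3 //= (negbTE x1) (negbTE x2).
  rewrite !inE !negb_or => /and5P[x1 x2 x3 x4 /and3P[x5 x6 x7]].
  rewrite ha4 ?inE ?negb_or ?x6 // ha3 ?inE ?x5 //=.
  by rewrite ha2 ?inE ?negb_or ?x1 ?x2 ?x3 ?x4 //= ha1.
- by rewrite hv4 // hv3 //= hv2 // hv1.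
- split; last split.
  + by move=> e; rewrite ha4 // ha3 //= U2.
  + by move=> e; rewrite ha4 // ha3 //= V2.
  + by move=> e; rewrite ha4 // ha3 //= P2.
  + by move=> e; rewrite ha4 // ha3 //= A2.
  + by rewrite hv4 // hv3 //= hv2 //= D1.
  + exact: W4.
  + exact: R4.
  + by move=> i; rewrite ha4 // Q3.
Qed.

Lemma wp_store0 e1 e2 (j : nat) v (Q : store -> Prop) s : (j < N)%N ->
  eval N e1 s = j -> eval N e2 s = v -> fits b v -> Q (seta 0 j v s) ->
  wp N b (Store 0 e1 e2) Q s.
Proof. by move=> jN ej <- fv q; rewrite /= ej /storeto leqNgt jN. Qed.

Hypothesis m2N : (2 * m <= N)%N.

Lemma wp_out (Q : store -> Prop) s : var s vm = m -> var s vD = D ->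
  (forall e, (e < m)%N -> fits b (arr s aST e)) ->
  (forall s', var s' vN = (2 * m)%N ->
     (forall e, (e < m)%N -> arr s' aIn (2 * e)%N = arr s aST e /\
        arr s' aIn (2 * e).+1 = D) -> Q s') ->
  wp N b out_phase Q s.
Proof.
move=> sm sD fST HQ; apply: wp_then.
pose I k s' := [/\ var s' vm = m, var s' vD = D, arr s' aST = arr s aST &
  forall e, (e < k)%N -> (e < m)%N -> arr s' aIn (2 * e)%N = arr s aST e /\
        arr s' aIn (2 * e).+1 = D].
apply: (wp_for b_gt0 N_fits (I := I)) => //.
- move=> k s' kN _ [km kD kST kI].
  apply: wp_cond => [km'|km']; last first.
    have mk : (m <= k)%N by move: km'; rewrite /= km; lia.
    by apply: wp_nop; split=> // e ek em; apply: kI => //; lia.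
  have {}km' : (k < m)%N by move: km'; rewrite /= km; lia.
  apply: wp_then; apply: (@wp_store0 _ _ (2 * k) (arr s aST k)).
  + by lia.
  + by rewrite /=; lia.
  + by rewrite /= kST.
  + exact: fST.
  apply: (@wp_store0 _ _ (2 * k).+1 D).
  + by lia.
  + by rewrite /=; lia.
  + by rewrite /= kD.
  + by apply: bigP => //; apply: le_trans (prod_to_ge1 (leqnn _) den_gt0).
  split=> // e ek em; rewrite !arr_seta !eqxx !andTb.
  have -> : ((2 * e)%N == (2 * k).+1) = false by apply/eqP; lia.
  have -> : ((2 * e).+1 == (2 * k)%N) = false by apply/eqP; lia.
  rewrite !eqn_mul2l /=.
  case: (eqVneq e k) => [->//|ek'].
  by apply: kI => //; rewrite ltn_neqAle ek' -ltnS.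
- move=> s' _ [km kD kST kI]; apply: (@wp_assign _ _ _ _ (Posz (2 * m))).
  + by rewrite /= km; lia.
  + exact: fits_nat_le.
  by apply: HQ => // e em; apply: kI => //; lia.
Qed.

Variable R : archiRealFieldType.

Hypotheses (tot_big : (2 * Posz m + 2) * tot N m P <= big)
  (Wtot_big : forall i t, (t <= N)%N -> W i * tot N m P ^+ t <= big)
  (Wsum_big : (\sum_(i < N) W i) * tot N m P <= big).

Let mem : nat -> nat -> bool := listed N low Qf.

(** Competing schedules enter only through [completions], so the guarantee can be proved about
    integer data before instances are considered. The values [fin] bound the group completion times
    of the answer. *)
Definition good_schedule (st : nat -> int) : Prop :=
  [/\ forall e, (e < m)%N -> 0 <= st e,
      forall e f v, (e < m)%N -> (f < m)%N -> e != f -> inc U V e v -> inc U V f v ->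
        st e + P e <= st f \/ st f + P f <= st e &
      exists fin : nat -> int, [/\ forall i, 0 <= fin i,
        forall i e, (e < m)%N -> mem i e -> st e + P e <= fin i &
        exists2 c : rat, c <= 27185%:R / 10000%:R &
        forall C Cg : nat -> R, completions N m g P (inc U V) mem C Cg ->
          (\sum_(i < N) W i * fin i)%:~R <=
          4 * ratr c * \sum_(i < N) (W i)%:~R * Cg i]].

Lemma P_gt0 e : (e < m)%N -> 0 < P e.
Proof. by move=> em; apply: scaled_gt0. Qed.

(** One factor 2 compares the length of a block with its load, the other is the duality bound; [c]
    is the loss of the cutting. *)
Lemma chain_cost os G A (st : nat -> int) T : uniq os ->
  (forall e, e \in os -> (e < m)%N) -> size os = m ->
  chain N m P W U V mem os G A m ->
  (forall C Cg : nat -> R, completions N m g P (inc U V) mem C Cg ->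
      \sum_(i < N) (W i * top N m P (inc U V) (take (find (mem i) os) os))%:~R <=
      2 * \sum_(i < N) (W i)%:~R * Cg i) ->
  sched_inv N m P U V W mem os G 0 T st ->
  good_schedule st.
Proof.
move=> uos os_lt sz [G0 ch] dual [T0 ge le disj [fin [fin0 finE cost]]].
have mN : (m <= N)%N by lia.
have mgN' : (m + g <= N)%N by lia.
have in_os e : (e < m)%N -> e \in drop 0 os.
  move=> em; rewrite drop0; have := all_removed e uos os_lt sz.
  by rewrite /alive em /= => /negbFE.
split.
- by move=> e em; apply: ge; apply: in_os.
- by move=> e f v em fm; apply: disj; apply: in_os.
exists fin; split; first exact: fin0.
  by move=> i e em ie; apply: finE => //; apply: in_os.
pose K i := top N m P (inc U V) (take i os).
have inc_ex e : (e < m)%N -> exists2 v, (v < N)%N & inc U V e v.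
  by move=> em; exists (U e); [apply: U_lt | apply: inc_U].
have K_ge0 i : 0 <= K i by rewrite /K; apply: top_ge0; apply: P_gt0.
have K_ge1 i : (i < m)%N -> 1 <= K i.
  by move=> im; apply: (top_take_ge1 mgN' P_gt0 inc_ex) => //; rewrite sz.
have K_mono i j : (i <= j)%N -> (j < m)%N -> K j <= K i.
  by move=> ij _; rewrite /K; apply: top_take_mono => //; apply: P_gt0.
have GS a k : (a <= k)%N -> (k < m)%N ->
    G k.+1 <= G a + K a * \sum_(i < N | (find (mem i) os < k.+1)%N) W i.
  by move=> ak km; have [_ _ _ GE] := ch k km km; apply: GE.
have G0' : G 0%N <= 0 by rewrite G0.
have W0 i : (i < N)%N -> 0 <= W i by move=> _; apply: W_ge0.
have [c c_le [c0 bound]] :=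
  @chain_bound_euler m N K W (fun i => find (mem i) os) G K_ge1 K_mono W0 G0' GS.
exists c; first exact: c_le.
move=> C Cg CC {c_le}; have {}dual := dual C Cg CC.
have cR : 0 <= ratr c :> R by rewrite ler0q.
have boundR : (G m)%:~R <= ratr c *
    \sum_(i < N) (W i * K (find (mem i) os))%:~R :> R.
  move: bound; rewrite -(ler_rat R) rmorphM rmorph_sum /=.
  rewrite ratr_int => /le_trans; apply; rewrite ler_wpM2l //.
  rewrite big_mkcond; apply: ler_sum => i _; case: ifP => _; rewrite ?ratr_int //.
  by rewrite ler0z mulr_ge0 ?W_ge0.
have cost' : \sum_(i < N) W i * fin i <= 2 * G m.
  apply: le_trans cost; rewrite G0 mulr0 addr0.
  by rewrite [X in _ <= _ + T * X]big_pred0 // mulr0 addr0.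
apply: (@le_trans _ _ (2 * (G m)%:~R)).
  by rewrite -[2]/(2%:~R) -intrM ler_int.
have -> (y : R) : 4 * ratr c * y = 2 * (ratr c * (2 * y)) by ring.
by rewrite ler_wpM2l // (le_trans boundR) // ler_wpM2l.
Qed.

Definition answers (s : store) : Prop :=
  exists st : nat -> int, [/\ var s vN = (2 * m)%N,
    forall e, (e < m)%N -> arr s aIn (2 * e)%N = st e /\ arr s aIn (2 * e).+1 = D &
    good_schedule st].

Lemma W_eq0 i : (g <= i)%N -> W i = 0.
Proof. by move=> gi; rewrite /W /scaled ltnNge gi. Qed.

Theorem program_correct s : arr s aIn = low -> var s vN = N ->
  (forall x, x != vN -> var s x = 0) ->
  (forall a i, a != aIn -> arr s a i = 0) ->
  wp N b program answers s.
Proof.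
move=> sl sN sv sa; apply: wp_then; apply: wp_parse => //.
  by move=> a i ain; apply: sa; apply: contraL ain => /eqP ->.
move=> s1 [hv1 ha1] m1 [U1 V1 P1 AL1 [D1 W1 RW1 Q1]].
have rs1 : ready N m P W U V mem D s1.
  split=> //; last by rewrite hv1.
  split=> // i e; have -> : arr s1 aIn = low by rewrite ha1.
  by have -> : arr s1 aQ = Qf by apply/funext.
have [N_gt0 tot_gt0'] : (0 < N)%N /\ 0 < tot N m P.
  by split; [lia | apply: tot_gt0; apply: P_gt0].
apply: wp_then.
apply: (@wp_pd R N b m g P W U V mem D big b_gt0 mgN P_gt0 W_ge0 W_eq0 U_lt bigP
  N_big tot_big Wtot_big) => //.
- by rewrite hv1 // sv.
- by move=> i; rewrite ha1 // sa.
- by move=> i; rewrite ha1 // sa.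
move=> s2 os sm2 [[uos sz] os_lt ordE keyE dual].
have rs2 := ready_same sm2 isT isT rs1; have [hv2 ha2] := sm2.
apply: wp_then.
apply: (@wp_dp N b m g P W U V mem D big b_gt0 mgN P_gt0 W_ge0 bigP
  N_big tot_big os uos sz Wsum_big) => //.
- by rewrite ha2 // ha1 // sa.
move=> s3 G A sm3 GE AE ch.
have rs3 := ready_same sm3 isT isT rs2; have [hv3 ha3] := sm3.
apply: wp_then.
apply: (@wp_bt N b m g P W U V mem D big b_gt0 mgN P_gt0 U_lt V_lt bigP
  N_big tot_big os uos os_lt sz Wsum_big G A ch) => //.
- by move=> j jm; rewrite ha3 // ordE.
- by move=> j jm; rewrite ha3 // keyE.
- by move=> e; rewrite ha3 // ha2 // ha1 // sa.
move=> s4 T sm4 T_big sched.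
have [_ _ m4 D4] := ready_same sm4 isT isT rs3.
have good := chain_cost uos os_lt sz ch dual sched.
apply: wp_out => //.
- move=> e em; have [ge _ _] := good.
  apply: bigP; first exact: ge.
  have in_os : e \in drop 0 os.
    rewrite drop0; have := all_removed e uos os_lt sz.
    by rewrite /alive em /= => /negbFE.
  by apply: le_trans T_big; have := sc_le sched in_os; have := P_gt0 em; lia.
- by move=> s5 m5 out; exists (arr s4 aST).
Qed.

End Parse.

(** * Instances and their encoding *)

Section OneMachine.

Variables (R : realFieldType) (T : finType) (p s : T -> R).
Hypotheses (p_gt0 : forall e, 0 < p e) (s_ge0 : forall e, 0 <= s e).

Definition sequential (A : {set T}) : Prop :=
  forall e f, e \in A -> f \in A -> e != f -> s e + p e <= s f \/ s f + p f <= s e.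

(** Take the latest start; the opposite order would make [f] start even later, processing times
    being positive. *)
Lemma last_job (A : {set T}) e : sequential A -> e \in A ->
  exists2 k, k \in A & forall f, f \in A :\ k -> s f + p f <= s k.
Proof.
move=> seqA eA.
have [k kA kmax] := @Order.TotalTheory.arg_maxP _ _ _ e (fun i => i \in A) s eA.
exists k => // f; rewrite in_setD1 => /andP[fk fA].
have [//|kf] := seqA f k fA kA fk.
have fk' : s f <= s k := kmax f fA; have pk := p_gt0 k.
by exfalso; move: kf fk' pk; clear; lra.
Qed.

Lemma sequentialD1 (A : {set T}) k : sequential A -> sequential (A :\ k).
Proof.
by move=> seqA e f /setD1P[_ eA] /setD1P[_ fA]; apply: seqA.
Qed.

Lemma sum_le_deadline (A : {set T}) t : sequential A -> 0 <= t ->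
  (forall e, e \in A -> s e + p e <= t) -> \sum_(e in A) p e <= t.
Proof.
have [n] := ubnP #|A|; elim: n A t => // n IH A t An seqA t0 At.
have [->|[e eA]] := set_0Vmem A; first by rewrite big_set0.
have [k kA last] := last_job seqA eA.
rewrite (big_setD1 k kA) /=.
have : \sum_(i in A :\ k) p i <= s k.
  apply: IH => //; last exact: sequentialD1.
  by rewrite (cardsD1 k) kA in An.
by have := At k kA; lra.
Qed.

(** Induction on the last job k, with processing time p. The other jobs have total x <= s(k), so (x
    + p)^2 - x^2 = 2 p x + p^2 is at most 2 p (s(k) + p). *)
Lemma sqr_sum_le (A : {set T}) : sequential A ->
  (\sum_(e in A) p e) ^+ 2 <= 2 * \sum_(e in A) p e * (s e + p e).
Proof.
have [n] := ubnP #|A|; elim: n A => // n IH A An seqA.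
have [->|[e eA]] := set_0Vmem A; first by rewrite !big_set0 expr0n mulr0.
have [k kA last] := last_job seqA eA.
have seqA' := @sequentialD1 A k seqA.
have := IH (A :\ k); rewrite (cardsD1 k) kA in An => /(_ An seqA').
have := sum_le_deadline seqA' (s_ge0 k) last.
rewrite !(big_setD1 k kA) /=.
move: (\sum_(i in A :\ k) p i) (\sum_(i in A :\ k) _) (p_gt0 k) (s_ge0 k).
by move=> x y pk sk xs xy; nra.
Qed.

End OneMachine.

(** The program indexes by natural numbers, so the data of an instance are continued by a default
    beyond their range. *)
Definition ext (A : Type) (k : nat) (x0 : A) (f : 'I_k -> A) (i : nat) : A :=
  oapp f x0 (insub i).

Lemma extE A k (x0 : A) (f : 'I_k -> A) (i : 'I_k) : ext x0 f i = f i.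
Proof. by rewrite /ext valK. Qed.

Lemma ext_out A k (x0 : A) (f : 'I_k -> A) i : (k <= i)%N -> ext x0 f i = x0.
Proof. by move=> ki; rewrite /ext insubN // -leqNgt. Qed.

Lemma ext_lt A k (x0 : A) (f : 'I_k -> A) i (ik : (i < k)%N) :
  ext x0 f i = f (Ordinal ik).
Proof. by rewrite -[i in LHS]/(val (Ordinal ik)) extE. Qed.

Lemma nth_flatten_take (A : Type) (x0 : A) ss i r :
  (i < size ss)%N -> (r < size (nth [::] ss i))%N ->
  nth x0 (flatten ss) (sumn (shape (take i ss)) + r) = nth x0 (nth [::] ss i) r.
Proof.
move=> iss ri; rewrite -{1}(cat_take_drop i ss) flatten_cat nth_cat size_flatten.
by rewrite ltnNge leq_addr addKn (drop_nth [::]) //= nth_cat ri.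
Qed.

Lemma sumn_shape_ord (A : Type) k (F : 'I_k -> seq A) i : (i <= k)%N ->
  sumn (shape (take i [seq F j | j <- enum 'I_k])) =
  \sum_(j < i) ext 0%N (fun j => size (F j)) j.
Proof.
move=> ik; rewrite -map_take /shape -map_comp sumnE big_map.
have -> : take i (enum 'I_k) = [seq widen_ord ik j | j <- enum 'I_i].
  apply: (inj_map val_inj); rewrite map_take val_enum_ord -map_comp.
  rewrite (eq_map (g := val)) ?val_enum_ord ?take_iota //.
  by congr iota; apply/minn_idPl.
rewrite big_map big_enum /=; apply: eq_bigr => j _.
by rewrite -[nat_of_ord j in RHS]/(val (widen_ord ik j)) extE.
Qed.

Lemma nth_flatten_ord (A : Type) (x0 : A) k (F : 'I_k -> seq A) (i : 'I_k) r :
  (r < size (F i))%N ->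
  nth x0 (flatten [seq F j | j <- enum 'I_k])
    (\sum_(j < i) ext 0%N (fun j => size (F j)) j + r) = nth x0 (F i) r.
Proof.
move=> ri; have ik := ltn_ord i.
have ni : nth [::] [seq F j | j <- enum 'I_k] i = F i.
  by rewrite (nth_map i) ?size_enum_ord // nth_ord_enum.
by rewrite -sumn_shape_ord ?(ltnW ik) // nth_flatten_take ?ni // size_map size_enum_ord.
Qed.

Lemma size_flatten_ord (A : Type) k (F : 'I_k -> seq A) :
  size (flatten [seq F j | j <- enum 'I_k]) =
  \sum_(j < k) ext 0%N (fun j => size (F j)) j.
Proof.
rewrite size_flatten -sumn_shape_ord // take_oversize //.
by rewrite size_map size_enum_ord.
Qed.

Lemma sum_ord_cond (V : nmodType) N m (A : pred nat) (F : nat -> V) :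
  (m <= N)%N -> (forall e, A e -> (e < m)%N) ->
  \sum_(e < N | A e) F e = \sum_(e < m | A e) F e.
Proof.
move=> mN Am; rewrite [RHS](big_ord_widen_cond N) //; apply: eq_bigl => e.
by case: (boolP (A e)) => // /Am ->.
Qed.

Lemma sum_ord_trunc (V : nmodType) N m (F : nat -> V) : (m <= N)%N ->
  (forall e, (m <= e)%N -> F e = 0) -> \sum_(e < N) F e = \sum_(e < m) F e.
Proof.
move=> mN F0; rewrite [RHS](big_ord_widen N) // [RHS]big_mkcond.
by apply: eq_bigr => e _; case: ltnP => // /F0.
Qed.

(** * The encoded instance as the program sees it, and the size of its numbers *)

Section Link.

Variable I : instance.

Let n := nvert I.
Let m := nedge I.
Let g := ngroup I.
Let inp := encode I.
Let N := size inp.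
Let low (k : nat) : int := inp`_k.

Definition edge_code (e : 'I_m) : seq int :=
  [:: (val (ends e).1)%:Z; (val (ends e).2)%:Z] ++ encode_rat (ptime e).

Definition group_code (i : 'I_g) : seq int :=
  encode_rat (weight i) ++ #|group i|%:Z :: [seq (val e)%:Z | e <- enum (group i)].

Definition end1 : nat -> nat := ext 0%N (fun e : 'I_m => val (ends e).1).
Definition end2 : nat -> nat := ext 0%N (fun e : 'I_m => val (ends e).2).
Definition pnum : nat -> int := ext 1 (fun e : 'I_m => numq (ptime e)).
Definition pden : nat -> int := ext 1 (fun e : 'I_m => denq (ptime e)).
Definition wnum : nat -> int := ext 1 (fun i : 'I_g => numq (weight i)).
Definition wden : nat -> int := ext 1 (fun i : 'I_g => denq (weight i)).
Definition gcard : nat -> nat := ext 0%N (fun i : 'I_g => #|group i|).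
Definition gpos (i : nat) : nat :=
  3 + n + 4 * m + \sum_(j < i) ext 0%N (fun j : 'I_g => size (group_code j)) j.

Lemma encodeE : inp = [:: n%:Z; m%:Z; g%:Z] ++ [seq (val v)%:Z | v <- enum 'I_n] ++
  flatten [seq edge_code e | e <- enum 'I_m] ++
  flatten [seq group_code i | i <- enum 'I_g].
Proof. by []. Qed.

Lemma size_group_code i : size (group_code i) = (3 + #|group i|)%N.
Proof. by rewrite /= size_map -cardE. Qed.

Lemma low_tail k : low (3 + n + k)%N =
  (flatten [seq edge_code e | e <- enum 'I_m] ++
   flatten [seq group_code i | i <- enum 'I_g])`_k.
Proof.
rewrite /low encodeE -addnA nth_cat ltnNge leq_addr addKn nth_cat size_map.
by rewrite size_enum_ord ltnNge leq_addr addKn.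
Qed.

Lemma sum_edge_code k : (k <= m)%N ->
  \sum_(j < k) ext 0%N (fun j : 'I_m => size (edge_code j)) j = (4 * k)%N.
Proof.
move=> km; rewrite (eq_bigr (fun=> 4%N)) ?sum_nat_const ?card_ord 1?mulnC // => j _.
by rewrite (ext_lt _ _ (leq_trans (ltn_ord j) km)).
Qed.

Lemma size_edges : size (flatten [seq edge_code e | e <- enum 'I_m]) = (4 * m)%N.
Proof. by rewrite size_flatten_ord sum_edge_code. Qed.

Lemma low_edge (e : 'I_m) r : (r < 4)%N ->
  low (3 + n + 4 * e + r)%N = (edge_code e)`_r.
Proof.
move=> r4; rewrite -addnA low_tail nth_cat size_edges.
have em := ltn_ord e; have -> : (4 * e + r < 4 * m)%N by lia.
by rewrite -(sum_edge_code (ltnW em)) nth_flatten_ord.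
Qed.

Lemma low_group (i : 'I_g) r : (r < 3 + #|group i|)%N ->
  low (gpos i + r)%N = (group_code i)`_r.
Proof.
move=> ri; rewrite /gpos -addnA -[in LHS](addnA (3 + n)%N) low_tail nth_cat size_edges.
by rewrite ltnNge leq_addr addKn nth_flatten_ord // size_group_code.
Qed.

Lemma size_inp : N = gpos g.
Proof.
by rewrite /N encodeE !size_cat size_map size_enum_ord size_edges size_flatten_ord /gpos !addnA.
Qed.

Lemma gposS i : (i < g)%N -> gpos i.+1 = (gpos i + 3 + gcard i)%N.
Proof.
move=> ig; have E : ext 0%N (fun j : 'I_g => size (group_code j)) i = (3 + gcard i)%N.
  by rewrite /gcard !(ext_lt _ _ ig) size_group_code.
by rewrite -[RHS]addnA -E /gpos big_ord_recr !addnA.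
Qed.

Lemma gpos_le i : (i <= g)%N -> (gpos i <= N)%N.
Proof.
move=> ig; rewrite size_inp /gpos leq_add2l.
by rewrite (big_ord_widen g _ ig) [leqLHS]big_mkcond; apply: leq_sum => j _; case: ifP.
Qed.

Lemma gpos_ge i : (i <= g)%N -> (3 + n + 4 * m + 3 * i <= gpos i)%N.
Proof.
elim: i => [|i IH] ig; first by rewrite /gpos muln0 leq_add2l.
by rewrite gposS //; have := IH (ltnW ig); lia.
Qed.

Lemma size_inp_ge : (3 + n + 4 * m + 3 * g <= N)%N.
Proof. by rewrite size_inp; apply: gpos_ge. Qed.

Let Qf (i : nat) : int := if (i < g)%N then Posz (gpos i) else 0.

(** The record of the group lies inside the input, so it has at most [N] members and the sum in
    [mem_e] reaches each of them. *)
Lemma listedE (i : 'I_g) (e : 'I_m) : listed N low Qf i e = (e \in group i).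
Proof.
have ig := ltn_ord i; have := gpos_le ig; rewrite gposS // /gcard extE => iN.
rewrite /listed /Qf ig.
have low2 : low (absz (Posz (gpos i) + 2)%R) = Posz #|group i|.
  rewrite (_ : absz _ = gpos i + 2)%N ?low_group //; lia.
rewrite low2.
have lowj j : (j < #|group i|)%N ->
    low (absz (Posz (gpos i) + 3 + Posz j)%R) = Posz (nth e (enum (group i)) j).
  move=> jc; rewrite (_ : absz _ = gpos i + (3 + j))%N; last lia.
  rewrite low_group; last lia.
  by rewrite /= (nth_map e) // -cardE.
pose F j := Posz (Posz j < Posz #|group i|)%R *
  Posz (low (absz (Posz (gpos i) + 3 + Posz j)%R) == Posz e).
rewrite -/(F _) (sum_gt0P (F := F)); last first.
  by move=> j _; rewrite /F; case: ltrP => _; case: eqP.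
have FE j : (0 < F j) = (j < #|group i|)%N && (nth e (enum (group i)) j == e).
  rewrite /F ltz_nat; case: ltnP => [jc|_]; last by rewrite mul0r ltxx.
  by rewrite mul1r lowj // eqz_nat (inj_eq val_inj); case: eqP.
apply/hasP/idP => [[j _]|eg].
  rewrite FE => /andP[jc /eqP <-].
  by rewrite -mem_enum mem_nth // -cardE.
exists (index e (enum (group i))).
  rewrite mem_iota /=; have : (index e (enum (group i)) < #|group i|)%N.
    by rewrite cardE index_mem mem_enum.
  by move/leq_trans; apply; apply: leq_trans iN; apply: leq_addl.
by rewrite FE cardE index_mem nth_index mem_enum ?eg /=.
Qed.

Lemma end1_lt e : (e < m)%N -> (end1 e < N)%N.
Proof.
move=> em; rewrite /end1 (ext_lt _ _ em); apply: leq_trans (ltn_ord _) _.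
by apply: leq_trans size_inp_ge; rewrite -/n; lia.
Qed.

Lemma end2_lt e : (e < m)%N -> (end2 e < N)%N.
Proof.
move=> em; rewrite /end2 (ext_lt _ _ em); apply: leq_trans (ltn_ord _) _.
by apply: leq_trans size_inp_ge; rewrite -/n; lia.
Qed.

Lemma pnum_gt0 e : (e < m)%N -> 0 < pnum e.
Proof. by move=> em; rewrite /pnum (ext_lt _ _ em) numq_gt0 ptime_gt0. Qed.

Lemma pden_gt0 e : (e < m)%N -> 0 < pden e.
Proof. by move=> em; rewrite /pden (ext_lt _ _ em) denq_gt0. Qed.

Lemma wnum_gt0 i : (i < g)%N -> 0 < wnum i.
Proof. by move=> ig; rewrite /wnum (ext_lt _ _ ig) numq_gt0 weight_gt0. Qed.

Lemma wden_gt0 i : (i < g)%N -> 0 < wden i.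
Proof. by move=> ig; rewrite /wden (ext_lt _ _ ig) denq_gt0. Qed.

Let Z := bitsize inp.

(** Every integer, even 0, has bit length at least 1. *)
Lemma size_le_bitsize : (N <= Z)%N.
Proof.
rewrite /N /Z /bitsize; elim: inp => [|z l IH]; first by rewrite big_nil.
by rewrite big_cons /=; apply: leq_ltn_trans IH _; rewrite /bitlen; lia.
Qed.

Lemma low_fits k : fits Z (low k).
Proof.
rewrite /low; case: (ltnP k N) => [kN|Nk]; last first.
  by rewrite nth_default // fits0.
apply: fits_le (fits_of_bitlen _); rewrite /Z /bitsize.
have := mem_nth 0 kN; move: (inp`_k) => z; elim: inp => // y l IH.
rewrite inE big_cons => /predU1P[->|/IH h]; first exact: leq_addr.
by apply: leq_trans h _; apply: leq_addl.
Qed.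

Let pw (a : nat) : int := Posz (2 ^ a)%N.

Lemma pwD a c : pw (a + c) = pw a * pw c.
Proof. by rewrite /pw expnD PoszM. Qed.

Lemma pw_le a c : (a <= c)%N -> pw a <= pw c.
Proof. by move=> ac; rewrite /pw lez_nat leq_exp2l. Qed.

Lemma pw_ge1 a : 1 <= pw a.
Proof. by rewrite /pw lez_nat expn_gt0. Qed.

Lemma pw_ge0 a : 0 <= pw a. Proof. by []. Qed.

Lemma pwX a t : pw (a * t) = pw a ^+ t.
Proof.
elim: t => [|t IH]; first by rewrite muln0 expr0.
by rewrite mulnS pwD IH exprS.
Qed.

Lemma low_le k : low k <= pw Z.
Proof. by have := low_fits k; rewrite /fits /pw; move: (2 ^ Z)%N => x; lia. Qed.

Lemma nat_le_pw k : (k <= Z)%N -> Posz k <= pw Z.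
Proof. by move=> kZ; rewrite lez_nat; apply: leq_trans kZ (ltnW (ltn_expl _ _)). Qed.

Lemma prod_to_pw (f : nat -> int) k a : (forall i, (i < k)%N -> 0 < f i) ->
  (forall i, (i < k)%N -> f i <= pw a) -> prod_to f k <= pw (a * k).
Proof.
elim: k => [|k IH] f0 fa; first by rewrite /prod_to big_ord0 pw_ge1.
have -> : prod_to f k.+1 = prod_to f k * f k by rewrite /prod_to big_ord_recr.
have f1 : 1 <= prod_to f k.
  by apply: (prod_to_ge1 (leqnn k)) => i ik; apply: f0; lia.
rewrite mulnSr pwD ler_pM ?fa //; first exact: le_trans f1.
  by apply: ltW; apply: f0.
by apply: IH => i ik; [apply: f0 | apply: fa]; lia.
Qed.

Lemma scaled_pw k p q i a : (forall i, (i < k)%N -> 0 < p i) ->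
  (forall i, (i < k)%N -> 0 < q i) -> (forall i, (i < k)%N -> p i <= pw a) ->
  (forall i, (i < k)%N -> q i <= pw a) -> scaled k p q i <= pw (a + a * k).
Proof.
move=> p0 q0 pa qa; rewrite /scaled; case: ltnP => // ik.
have Dq := prod_to_div ik q0; have D1 := prod_to_ge1 (leqnn k) q0.
have qi := q0 i ik; rewrite pwD ler_pM ?pa //; first exact: ltW (p0 i ik).
  by nia.
by apply: le_trans (prod_to_pw q0 qa); nia.
Qed.

Lemma sum_pw k (F : nat -> int) a (A : pred nat) : (k <= Z)%N ->
  (forall i, 0 <= F i) -> (forall i, F i <= pw a) ->
  \sum_(i < k | A i) F i <= pw (Z + a).
Proof.
move=> kZ F0 Fa; apply: (@le_trans _ _ (\sum_(i < k) pw a)).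
  by rewrite big_mkcond; apply: ler_sum => i _; case: ifP.
rewrite sumr_const card_ord -mulr_natl pwD ler_wpM2r // natz.
exact: nat_le_pw.
Qed.

Let P : nat -> int := scaled m pnum pden.
Let W : nat -> int := scaled g wnum wden.

Lemma pnumE e (em : (e < m)%N) : pnum e = low (3 + n + 4 * e + 2)%N.
Proof. by rewrite (low_edge (Ordinal em)) // /pnum (ext_lt _ _ em). Qed.

Lemma pdenE e (em : (e < m)%N) : pden e = low (3 + n + 4 * e + 3)%N.
Proof. by rewrite (low_edge (Ordinal em)) // /pden (ext_lt _ _ em). Qed.

Lemma wnumE i (ig : (i < g)%N) : wnum i = low (gpos i).
Proof. by rewrite -[gpos i]addn0 (low_group (i := Ordinal ig)) // /wnum (ext_lt _ _ ig). Qed.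

Lemma wdenE i (ig : (i < g)%N) : wden i = low (gpos i + 1)%N.
Proof. by rewrite (low_group (i := Ordinal ig)) // /wden (ext_lt _ _ ig). Qed.

Lemma gcardE i (ig : (i < g)%N) : low (gpos i + 2)%N = gcard i.
Proof. by rewrite (low_group (i := Ordinal ig)) // /gcard (ext_lt _ _ ig). Qed.

(* Bounds for the bit lengths of the processing times and weights over a      *)
(* common denominator, of the total processing time, and of all the numbers   *)
(* occurring in a run.                                                        *)
Definition c_bits (z : nat) : nat := z + z * z.
Definition t_bits (z : nat) : nat := (z + c_bits z).+1.
Definition bits (z : nat) : nat :=
  c_bits z + c_bits z + t_bits z * z + t_bits z + z + z + 5.

Let mZ : (m <= Z)%N. Proof. by have := size_inp_ge; have := size_le_bitsize; lia. Qed.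
Let gZ : (g <= Z)%N. Proof. by have := size_inp_ge; have := size_le_bitsize; lia. Qed.

Lemma P_pw e : P e <= pw (c_bits Z).
Proof.
apply: (@le_trans _ _ (pw (Z + Z * m))); last first.
  by apply: pw_le; rewrite /c_bits leq_add2l leq_mul2l mZ orbT.
apply: scaled_pw => [||i im|i im]; [exact: pnum_gt0 | exact: pden_gt0 | |].
- by rewrite pnumE // low_le.
- by rewrite pdenE // low_le.
Qed.

Lemma W_pw i : W i <= pw (c_bits Z).
Proof.
apply: (@le_trans _ _ (pw (Z + Z * g))); last first.
  by apply: pw_le; rewrite /c_bits leq_add2l leq_mul2l gZ orbT.
apply: scaled_pw => [||j jg|j jg]; [exact: wnum_gt0 | exact: wden_gt0 | |].
- by rewrite wnumE // low_le.
- by rewrite wdenE // low_le.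
Qed.

Let P_ge0 e : 0 <= P e. Proof. exact: scaled_ge0 pnum_gt0 pden_gt0. Qed.
Let W_ge0 i : 0 <= W i. Proof. exact: scaled_ge0 wnum_gt0 wden_gt0. Qed.

Lemma tot_pw : tot N m P <= pw (t_bits Z).
Proof.
rewrite /t_bits -addn1 addnC pwD /tot.
have : \sum_(e < N | (e < m)%N) P e <= pw (Z + c_bits Z).
  exact: (sum_pw (fun e => e < m)%N size_le_bitsize P_ge0 P_pw).
have := pw_ge1 (Z + c_bits Z); rewrite (_ : pw 1 = 2) //; lia.
Qed.

Let b := bits Z.
Let big : int := pw b - 1.

Lemma fits_big z : 0 <= z -> z <= big -> fits b z.
Proof. by rewrite /big /pw /fits; move: (2 ^ b)%N => x; lia. Qed.

Lemma pw_lt_big a : (a < b)%N -> pw a <= big.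
Proof.
move=> ab; have := pw_le ab; rewrite -add1n pwD /big (_ : pw 1 = 2) //.
by have := pw_ge1 a; lia.
Qed.

Let tot_ge0 : 0 <= tot N m P.
Proof. by apply: ltW; apply: tot_gt0 => e em; apply: scaled_gt0 pnum_gt0 pden_gt0. Qed.

Lemma big_N : Posz N <= big.
Proof.
apply: le_trans (nat_le_pw size_le_bitsize) _; apply: pw_lt_big.
by rewrite /b /bits; lia.
Qed.

Lemma big_tot : (2 * Posz m + 2) * tot N m P <= big.
Proof.
apply: (@le_trans _ _ (pw (Z + 2 + t_bits Z))); last first.
  by apply: pw_lt_big; rewrite /b /bits; lia.
rewrite pwD ler_pM ?tot_pw ?tot_ge0 // pwD (_ : pw 2 = 4) //.
by have := nat_le_pw mZ; have := pw_ge1 Z; lia.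
Qed.

Lemma big_W i t : (t <= N)%N -> W i * tot N m P ^+ t <= big.
Proof.
move=> tN; apply: (@le_trans _ _ (pw (c_bits Z + t_bits Z * t))); last first.
  apply: pw_lt_big; rewrite /b /bits.
  have : (t_bits Z * t <= t_bits Z * Z)%N.
    by rewrite leq_mul2l (leq_trans tN size_le_bitsize) orbT.
  by move: (t_bits Z * t)%N (t_bits Z * Z)%N => x y; lia.
rewrite pwD ler_pM ?exprn_ge0 ?tot_ge0 ?W_ge0 ?W_pw // pwX.
by rewrite lerXn2r ?nnegrE ?tot_ge0 ?tot_pw // pw_ge0.
Qed.

Lemma big_Wsum : (\sum_(i < N) W i) * tot N m P <= big.
Proof.
apply: (@le_trans _ _ (pw (Z + c_bits Z + t_bits Z))); last first.
  by apply: pw_lt_big; rewrite /b /bits; lia.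
rewrite pwD ler_pM ?tot_pw ?tot_ge0 ?sumr_ge0 //.
exact: (sum_pw predT size_le_bitsize W_ge0 W_pw).
Qed.

Lemma big_prod f k : (k <= Z)%N -> (forall i, (i < k)%N -> 0 < f i) ->
  (forall i, (i < k)%N -> f i <= pw Z) -> prod_to f k <= big.
Proof.
move=> kZ f0 fZ; apply: le_trans (prod_to_pw f0 fZ) _; apply: pw_lt_big.
have : (Z * k <= Z * Z)%N by rewrite leq_mul2l kZ orbT.
rewrite /b /bits /c_bits; move: (Z * k)%N (Z * Z)%N => x y; lia.
Qed.

Theorem program_solves (R : archiRealFieldType) :
  wp N b program
    (answers N m g low end1 end2 pnum pden wnum wden gpos R) (start inp).
Proof.
have c_lt : (c_bits Z < b)%N by rewrite /b /bits; lia.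
have Pb e : P e <= big by apply: le_trans (P_pw e) (pw_lt_big c_lt).
have Wb i : W i <= big by apply: le_trans (W_pw i) (pw_lt_big c_lt).
have bits_gt0 : (0 < b)%N by rewrite /b /bits; lia.
have Nge := size_inp_ge.
have mgN : (m + g < N)%N by lia.
have m2N : (2 * m <= N)%N by lia.
have D_big : prod_to pden m <= big.
  by apply: big_prod pden_gt0 _ => // e em; rewrite pdenE // low_le.
have E_big : prod_to wden g <= big.
  by apply: big_prod wden_gt0 _ => // i ig; rewrite wdenE // low_le.
have low_e e r (em : (e < m)%N) : (r < 4)%N ->
    low (3 + n + 4 * e + r)%N = (edge_code (Ordinal em))`_r.
  exact: (low_edge (Ordinal em)).
apply: (program_correct (card := gcard) bits_gt0 fits_big big_N mgN) => //.
- move=> e em; rewrite -[(_ + _ * _)%N]addn0 (low_e e 0%N em) //.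
  by rewrite /end1 (ext_lt _ _ em).
- by move=> e em; rewrite (low_e e 1%N em) // /end2 (ext_lt _ _ em).
- by move=> e em; rewrite -pnumE.
- by move=> e em; rewrite -pdenE.
- by rewrite /gpos big_ord0 addn0.
- exact: gposS.
- exact: gpos_le.
- by move=> i ig; rewrite -wnumE.
- by move=> i ig; rewrite -wdenE.
- exact: gcardE.
- exact: ext_out.
- exact: ext_out.
- exact: end1_lt.
- exact: end2_lt.
- exact: pnum_gt0.
- exact: pden_gt0.
- exact: wnum_gt0.
- exact: wden_gt0.
- exact: big_tot.
- exact: big_W.
- exact: big_Wsum.
- by move=> x /negbTE x0; rewrite /= x0.
- by move=> a i /negbTE a0; rewrite /= a0.
Qed.

End Link.

(** * The approximation ratio *)

Lemma ratr_scaled (R : realType) k (f : 'I_k -> rat) (i : 'I_k) :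
  (forall i, 0 < f i) ->
  let p := ext 1 (fun i => numq (f i)) in let q := ext 1 (fun i => denq (f i)) in
  ratr (f i) = (scaled k p q i)%:~R / (prod_to q k)%:~R :> R.
Proof.
move=> f0 p q; have q0 j : (j < k)%N -> 0 < q j.
  by move=> jk; rewrite /q (ext_lt _ _ jk) denq_gt0.
have ik := ltn_ord i; have qi := q0 i ik.
have Dq := prod_to_div ik q0; have D1 := prod_to_ge1 (leqnn k) q0.
rewrite /scaled ik; move: Dq D1; set D := prod_to q k; set d := (_ %/ _)%Z => Dq D1.
have d0 : d != 0 by apply: contraTneq D1 => d0; rewrite -Dq d0 mul0r.
rewrite -Dq !intrM [(p i)%:~R * _]mulrC -mulf_div divff ?intr_eq0 // mul1r.
by rewrite /p /q !extE.
Qed.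

Lemma ratr_le_nat (R : realType) (c : rat) (a b : nat) :
  c <= a%:R / b%:R -> ratr c <= a%:R / b%:R :> R.
Proof.
move=> c_le; have := c_le; rewrite -(@ler_rat R c).
by rewrite rmorphM fmorphV !rmorph_nat.
Qed.

(** 4 times 2.7185 is exactly 10.874. *)
Lemma ratr_le (R : realType) (c : rat) : c <= 27185%:R / 10000%:R ->
  4 * ratr c <= 10%:R + 874%:R / 1000%:R :> R.
Proof. by move=> /(@ratr_le_nat R _ _ _); move: (ratr c) => x; clear; lra. Qed.

Section Ratio.

Variables (R : realType) (I : instance).

Let m := nedge I.
Let g := ngroup I.
Let N := size (encode I).
Let low (k : nat) : int := (encode I)`_k.
Let P : nat -> int := scaled m (@pnum I) (@pden I).
Let W : nat -> int := scaled g (@wnum I) (@wden I).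
Let D : R := (prod_to (@pden I) m)%:~R.
Let E : R := (prod_to (@wden I) g)%:~R.
Let mem (i e : nat) : bool :=
  listed N low (fun i => if (i < g)%N then Posz (gpos I i) else 0) i e.

Let D_gt0 : 0 < D.
Proof. by rewrite ltr0z (lt_le_trans _ (prod_to_ge1 (leqnn m) (@pden_gt0 I))). Qed.

Let E_gt0 : 0 < E.
Proof. by rewrite ltr0z (lt_le_trans _ (prod_to_ge1 (leqnn g) (@wden_gt0 I))). Qed.

Let mN : (m <= N)%N. Proof. by have := size_inp_ge I; rewrite /N /m; lia. Qed.
Let gN : (g <= N)%N. Proof. by have := size_inp_ge I; rewrite /N /g; lia. Qed.

Lemma ptimeE (e : 'I_m) : ratr (ptime e) = (P e)%:~R / D.
Proof. by rewrite (ratr_scaled R e (@ptime_gt0 I)). Qed.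

Lemma weightE (i : 'I_g) : ratr (weight i) = (W i)%:~R / E.
Proof. by rewrite (ratr_scaled R i (@weight_gt0 I)). Qed.

Lemma incE (e : 'I_m) v : inc (@end1 I) (@end2 I) e v =
  (val (ends e).1 == v) || (val (ends e).2 == v).
Proof. by rewrite /inc /end1 /end2 !extE. Qed.

Lemma group_completion_ge (s : schedule R I) (i : 'I_g) (e : 'I_m) :
  e \in group i -> edge_completion s e <= group_completion s i.
Proof.
move=> ei; rewrite /group_completion (bigD1 e) //= le_max lexx.
by [].
Qed.

Lemma group_completion_ge0 (s : schedule R I) (i : 'I_g) : 0 <= group_completion s i.
Proof.
rewrite /group_completion; elim: (index_enum _) => [|e l IH]; first by rewrite big_nil.
by rewrite big_cons; case: ifP => // _; rewrite le_max IH orbT.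
Qed.

(** If the two intervals overlapped, both jobs would be active at the later of their starting times,
    against the matching condition at the common end. *)
Lemma feasible_seq (s : schedule R I) (e f : 'I_m) v : feasible s ->
  e != f -> inc (@end1 I) (@end2 I) e v -> inc (@end1 I) (@end2 I) f v ->
  edge_completion s e <= s f \/ edge_completion s f <= s e.
Proof.
move=> [s0 sM] ef; rewrite !incE => ev fv.
case: (lerP (edge_completion s e) (s f)) => [|h1]; first by left.
case: (lerP (edge_completion s f) (s e)) => [|h2]; first by right.
have pos k : s k < edge_completion s k.
  by rewrite /edge_completion ltrDl ltr0q ptime_gt0.
have pe := pos e; have pf := pos f.
pose w := if val (ends e).1 == v then (ends e).1 else (ends e).2.
have wv : val w = v.
  by rewrite /w; case: ifP ev => [/eqP //|_ /= /eqP].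
have we : incident w e by rewrite /incident /w; case: ifP; rewrite eqxx ?orbT.
have wf : incident w f.
  by move: fv; rewrite /incident -wv !(inj_eq val_inj) ![w == _]eq_sym.
case/eqP: ef; apply: (sM (Num.max (s e) (s f)) e f w) => //; rewrite inE.
  by rewrite le_max lexx /= gt_max pe.
by rewrite le_max lexx orbT /= gt_max pf h2.
Qed.

(** Scaling by the common denominator [D] makes the processing times the integers [P]. Jobs at a
    common vertex are disjoint in time, so the one-machine inequality applies. *)
Lemma completions_of (s : schedule R I) : feasible s ->
  completions N m g P (inc (@end1 I) (@end2 I)) mem
    (ext 0 (fun e => D * edge_completion s e))
    (ext 0 (fun i => D * group_completion s i)).
Proof.
move=> fs; have [s0 _] := fs; split.
- move=> v A Av.
  have Am e : A e -> (e < m)%N by move=> /Av /andP[].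
  rewrite (sum_ord_cond P mN Am).
  rewrite (sum_ord_cond (fun e => (P e)%:~R * ext 0 (fun e => D * edge_completion s e) e)
    mN Am).
  rewrite rmorph_sum /=.
  pose p (e : 'I_m) : R := D * ratr (ptime e).
  have pE (e : 'I_m) : (P e)%:~R = p e.
    by rewrite /p ptimeE mulrCA divff ?mulr1 // gt_eqF.
  have seqA : sequential p (fun e => D * s e) [set e : 'I_m | A e]%SET.
    move=> e f; rewrite !inE => /Av/andP[_ ev] /Av/andP[_ fv] ef.
    rewrite /p -!mulrDr !(ler_pM2l D_gt0).
    exact: (feasible_seq fs ef ev fv).
  have p0 (e : 'I_m) : 0 < p e by rewrite mulr_gt0 // ltr0q ptime_gt0.
  have Ds0 (e : 'I_m) : 0 <= D * s e by rewrite mulr_ge0 // ltW.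
  have := sqr_sum_le p0 Ds0 seqA.
  have inA (F : 'I_m -> R) :
      \sum_(e in [set e : 'I_m | A e]%SET) F e = \sum_(e < m | A e) F e.
    by apply: eq_bigl => e; rewrite inE.
  rewrite !inA => /le_trans H.
  under eq_bigr do rewrite pE; apply: H; rewrite le_eqVlt; apply/orP; left.
  apply/eqP; congr (2 * _); apply: eq_bigr => e _; rewrite pE.
  by rewrite extE /edge_completion [in RHS](mulrDr D).
- move=> i e ig em; rewrite (ext_lt _ _ ig) (ext_lt _ _ em) => ie.
  rewrite ler_pM2l //; apply: group_completion_ge.
  by rewrite -(listedE (Ordinal ig) (Ordinal em)).
- move=> i; rewrite /ext; case: insub => //= i'.
  by rewrite mulr_ge0 ?group_completion_ge0 // ltW.
Qed.

Lemma costE (s : schedule R I) :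
  \sum_(i < N) (W i)%:~R * ext 0 (fun i => D * group_completion s i) i =
  E * (D * cost s).
Proof.
rewrite (sum_ord_trunc (m := g)
  (F := fun i => (W i)%:~R * ext 0 (fun i => D * group_completion s i) i)) //; last first.
  by move=> i gi; rewrite ext_out ?mulr0.
rewrite /cost !mulr_sumr; apply: eq_bigr => i _.
rewrite extE weightE; field.
by rewrite gt_eqF.
Qed.

Variable st : nat -> int.
Hypothesis good : good_schedule N m g low (@end1 I) (@end2 I) (@pnum I) (@pden I)
  (@wnum I) (@wden I) (@gpos I) R st.

Let s : schedule R I := fun e => (st e)%:~R / D.

Let completionE (e : 'I_m) : edge_completion s e = (st e + P e)%:~R / D.
Proof. by rewrite /edge_completion /s ptimeE intrD mulrDl. Qed.

Lemma good_feasible : feasible s.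
Proof.
have [st0 disj _] := good; split=> [e|t e f v].
  apply: divr_ge0; last exact: ltW.
  by rewrite ler0z; apply: st0; apply: ltn_ord.
rewrite !inE => /andP[e1 e2] /andP[f1 f2] ve vf.
apply/eqP; apply: contraT => ef.
have incv k : incident v k -> inc (@end1 I) (@end2 I) k (val v).
  by rewrite incE /incident !(inj_eq val_inj) ![_ == v]eq_sym.
have [h|h] := disj e f (val v) (ltn_ord e) (ltn_ord f) ef (incv e ve) (incv f vf).
- have : edge_completion s e <= s f.
    by rewrite completionE ler_pM2r ?invr_gt0 // ler_int.
  by move=> /(lt_le_trans e2)/lt_le_trans/(_ f1); rewrite ltxx.
- have : edge_completion s f <= s e.
    by rewrite completionE ler_pM2r ?invr_gt0 // ler_int.
  by move=> /(lt_le_trans f2)/lt_le_trans/(_ e1); rewrite ltxx.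
Qed.

(** Both costs are scaled by [E] for the weights and [D] for the times, and the common positive
    factor is cancelled at the end. *)
Lemma good_cost : exists2 c : rat, c <= 27185%:R / 10000%:R &
  forall s' : schedule R I, feasible s' -> cost s <= 4 * ratr c * cost s'.
Proof.
have [_ _ [fin [fin0 finE [c c_le bound]]]] := good.
exists c; first exact: c_le.
clear c_le; move=> s' fs'; have := bound _ _ (completions_of fs'); rewrite costE.
have W0 i : 0 <= W i := scaled_ge0 i (@wnum_gt0 I) (@wden_gt0 I).
have gle (i : 'I_g) : group_completion s i <= (fin i)%:~R / D.
  rewrite /group_completion; elim/big_rec: _ => [|e x ei xf].
    by apply: divr_ge0; [rewrite ler0z; apply: fin0 | apply: ltW].
  rewrite ge_max xf andbT completionE ler_pM2r ?invr_gt0 // ler_int.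
  by apply: finE => //; rewrite (listedE i e).
have le_fin : E * (D * cost s) <= (\sum_(i < N) W i * fin i)%:~R.
  rewrite (sum_ord_trunc (m := g) (F := fun i => W i * fin i)) //; last first.
    by move=> i gi; rewrite /W /scaled ltnNge gi mul0r.
  rewrite rmorph_sum /cost !mulr_sumr; apply: ler_sum => i _ /=.
  rewrite weightE intrM.
  have -> : E * (D * ((W i)%:~R / E * group_completion s i)) =
      (W i)%:~R * (D * group_completion s i).
    by field; rewrite gt_eqF.
  by rewrite ler_wpM2l ?ler0z // -ler_pdivlMl // mulrC.
move=> /(le_trans le_fin).
have -> : 4 * ratr c * (E * (D * cost s')) = E * (D * (4 * ratr c * cost s')) by ring.
by rewrite !ler_pM2l ?D_gt0 ?E_gt0.
Qed.

(** [opt] is an infimum, so the comparison with each feasible schedule is turned into a lower bound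
    for the set of costs, which is nonempty since it contains the cost of the schedule found. *)
Lemma good_opt : cost s <= (10%:R + 874%:R / 1000%:R) * opt R I.
Proof.
have [c c_le cost_le] := good_cost.
have := @ratr_le R c; set alpha := _ + _ => /(_ c_le) c_alpha.
have alpha_gt0 : 0 < alpha by rewrite /alpha addr_gt0 // ?divr_gt0 ?ltr0n.
clearbody alpha; clear c_le.
rewrite -ler_pdivrMl //; apply: lb_le_inf.
  by exists (cost s), s; first exact: good_feasible.
move=> _ [s' fs' <-]; rewrite ler_pdivrMl //.
apply: le_trans (cost_le _ fs') _; apply: ler_wpM2r => //.
apply: sumr_ge0 => k _; rewrite mulr_ge0 ?group_completion_ge0 //.
by rewrite ler0q ltW ?weight_gt0.
Qed.

End Ratio.

Lemma ex_poly_bits : exists p : {poly nat}, forall z, p.[z] = bits z.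
Proof.
have [c cE] : exists c : {poly nat}, forall z, c.[z] = c_bits z.
  by exists ('X + 'X * 'X) => z; rewrite hornerD hornerM hornerX.
have [t tE] : exists t : {poly nat}, forall z, t.[z] = t_bits z.
  exists ('X + c + 1%:P) => z.
  by rewrite 2!hornerD hornerX hornerC cE /t_bits -[RHS]addn1.
exists (c + c + t * 'X + t + 'X + 'X + 5%N%:P) => z.
by rewrite !hornerD hornerM cE tE hornerX hornerC.
Qed.

Theorem theorem23 (R : realType) :
  exists c : cmd, approximation_algorithm (10%:R + 874%:R / 1000%:R : R) c.
Proof.
exists (compile program).
have [c [d timeP]] := poly_bounded_tstm program.
have [p pE] := ex_poly_bits.
(* The first three terms cover the copy of the input length, the last one the program itself, with
   ['X] bounding the number of inputs and [p] the length of stored numbers. *)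
exists (p + p + 4%N%:P + c%:P * ('X + p + 1) ^+ d) => I.
set N := size (encode I); set b := bits (bitsize (encode I)).
have b_gt0 : (0 < b)%N by rewrite /b /bits addnS.
have zb : (bitsize (encode I) <= b)%N by rewrite /b /bits; lia.
have N_fits : fits b N.
  apply: (@leq_ltn_trans (bitsize (encode I))); first exact: size_le_bitsize.
  exact: leq_ltn_trans zb (ltn_expl b _).
have inp_fits j : fits b (encode I)`_j by apply: fits_le zb (low_fits I j).
have [s [st [sN out good]] H] :=
  compile_runs b_gt0 N_fits inp_fits (program_solves I R).
have m2N : (2 * nedge I <= N)%N.
  by apply: leq_trans (size_inp_ge I); lia.
have size_out : size (mkseq (arr s 0) (2 * nedge I)) = (2 * nedge I)%N.
  by rewrite size_mkseq.
have nth_out k : (k < 2 * nedge I)%N -> (mkseq (arr s 0) (2 * nedge I))`_k = arr s 0 k.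
  by move=> ?; rewrite nth_mkseq.
have [|||T T_le run] := H (mkseq (arr s 0) (2 * nedge I)).
- by rewrite size_out.
- by rewrite size_out.
- by move=> k; rewrite size_out => /nth_out.
exists T, (mkseq (arr s 0) (2 * nedge I)),
  (fun e => (st e)%:~R / (prod_to (@pden I) (nedge I))%:~R).
split.
- exact: run.
- apply: leq_trans T_le _; rewrite 3!hornerD hornerM !hornerC pE.
  apply: leq_add; first by rewrite -addn4.
  apply: leq_trans (timeP _ _) _; rewrite leq_mul2l; apply/orP; right.
  rewrite horner_exp 2!hornerD hornerX hornerC pE.
  have [->|d_gt0] := posnP d; first by rewrite expn0 expr0.
  rewrite natrXE leq_exp2r // -[leqLHS]addn1 leq_add2r leq_add2r.
  exact: size_le_bitsize.
- split=> // e; have em := ltn_ord e.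
  rewrite !nth_out; try lia.
  have [-> ->] := out e em; split=> //.
  have := prod_to_ge1 (leqnn _) (@pden_gt0 I).
  by apply: contraTneq => ->.
- exact: good_feasible good.
- exact: good_opt good.
Qed.
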